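(* Let $\xi\in\mathfrak{h}^*/\mathbb{Z}R$ be of nonzero central charge and assume that $\lambda(h)\in\mathbb{Z}$ for any $\lambda\in\xi$. For $i\in\mathbb{Z}_+=\{0,1,2,\dots\}$ let $\lambda_i\in\xi$ be the element with $\lambda_i(h)=-1+i$, and let $\mathcal{O}[\xi]_{\lambda_i}$ be the Serre subcategory of $\mathcal{O}[\xi]$ generated by $\Delta(\lambda_i)$ and $\Delta(r\cdot\lambda_i)$. Then: (i) The module $\Delta(\lambda)$ is simple for each $\lambda\in\xi$. (ii) There is a decomposition $\mathcal{O}[\xi]\cong\bigoplus_{i\in\mathbb{Z}_+}\mathcal{O}[\xi]_{\lambda_i}$. (iii) For every $i\in\mathbb{Z}_+$ the category $\mathcal{O}[\xi]_{\lambda_i}$ is equivalent to the category of finitely generated modules over the algebra $\mathbb{C}\oplus\mathbb{C}$.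
   Context: The Schrödinger algebra $\mathfrak{s}$ is the complex Lie algebra with basis $e,h,f,p,q,z$, with $z$ central and the remaining brackets $[h,e]=2e$, $[e,f]=h$, $[h,f]=-2f$, $[e,q]=p$, $[e,p]=0$, $[h,p]=p$, $[f,p]=q$, $[f,q]=0$, $[h,q]=-q$, $[p,q]=z$. Put $U=U(\mathfrak{s})$, $\mathfrak{h}=\mathbb{C}h\oplus\mathbb{C}z$, $\mathfrak{n}_+=\mathbb{C}e\oplus\mathbb{C}p$, $\mathfrak{n}_-=\mathbb{C}f\oplus\mathbb{C}q$, $\mathfrak{b}=\mathfrak{h}\oplus\mathfrak{n}_+$. Let $\{h^\vee,z^\vee\}\subset\mathfrak{h}^*$ be the basis dual to $\{h,z\}$, and $R=\{\pm h^\vee,\pm 2h^\vee\}$, so $\mathbb{Z}R=\mathbb{Z}h^\vee$. Let $\rho=\frac32h^\vee$, let $r$ be the linear map on $\mathfrak{h}^*$ with $r(z^\vee)=z^\vee$, $r(h^\vee)=-h^\vee$, and put $r\cdot\lambda=r(\lambda+\rho)-\rho$; thus $(r\cdot\lambda)(z)=\lambda(z)$ and $(r\cdot\lambda)(h)=-\lambda(h)-3$. For a $U$-module $M$ and $\lambda\in\mathfrak{h}^*$ let $M_\lambda=\{v\in M: Hv=\lambda(H)v\ \forall H\in\mathfrak{h}\}$; $M$ is a weight module if $M=\bigoplus_\lambda M_\lambda$; its support is the set of $\lambda$ with $M_\lambda\ne0$. Category $\mathcal{O}$ is the full subcategory of the category of $U$-modules consisting of the finitely generated weight modules $M$ with $\dim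 U(\mathfrak{n}_+)v<\infty$ for all $v\in M$. The Verma module is $\Delta(\lambda)=U\otimes_{U(\mathfrak{b})}\mathbb{C}_\lambda$, where $\mathfrak{n}_+$ acts on the one-dimensional module $\mathbb{C}_\lambda$ by $0$ and $\mathfrak{h}$ acts via $\lambda$. For a coset $\xi\in\mathfrak{h}^*/\mathbb{Z}R$, $\mathcal{O}[\xi]$ is the full subcategory of $\mathcal{O}$ of modules with support contained in $\xi$. The value $\lambda(z)$, which does not depend on $\lambda\in\xi$, is called the central charge of $\xi$. *)

(* Defs.v *)
From HB Require Import structures.
From mathcomp Require Import all_boot all_order all_algebra.
From mathcomp Require Import generic_quotient complex.
From mathcomp Require Import boolp classical_sets reals.
From mathcomp Require Import ring.

Set Implicit Arguments.
Unset Strict Implicit.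
Unset Printing Implicit Defensive.

Import GRing.Theory.
Local Open Scope ring_scope.
Local Open Scope quotient_scope.

HB.mixin Record isLie (K : fieldType) L of GRing.Lmodule K L := {
  lie_bracket : L -> L -> L;
  bracketPl : forall (a : K) (x y t : L),
    lie_bracket (a *: x + y) t = a *: lie_bracket x t + lie_bracket y t;
  bracketPr : forall (a : K) (x y t : L),
    lie_bracket t (a *: x + y) = a *: lie_bracket t x + lie_bracket t y;
  bracketxx : forall x : L, lie_bracket x x = 0;
  jacobi : forall x y t : L,
    lie_bracket x (lie_bracket y t) + lie_bracket y (lie_bracket t x)
      + lie_bracket t (lie_bracket x y) = 0
}.

#[short(type="lieAlgType")]
HB.structure Definition Lie (K : fieldType) :=
  { L of GRing.Lmodule K L & isLie K L }.

(* The universal enveloping algebra, presented by generators and relations: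
   noncommutative polynomial expressions in the elements of L, modulo the
   smallest congruence containing the axioms of unital associative K-algebras,
   the linearity of the embedding of L, and [x, y] = x y - y x. *)
Section Enveloping.
Variables (K : fieldType) (L : lieAlgType K).

Inductive uterm : Type :=
| UGen of L
| UScal of K
| UAdd of uterm & uterm
| UMul of uterm & uterm.

Inductive ueq : uterm -> uterm -> Prop :=
| ueq_refl t : ueq t t
| ueq_sym t u : ueq t u -> ueq u t
| ueq_trans t u v : ueq t u -> ueq u v -> ueq t v
| ueq_addc t t' u u' : ueq t t' -> ueq u u' -> ueq (UAdd t u) (UAdd t' u')
| ueq_mulc t t' u u' : ueq t t' -> ueq u u' -> ueq (UMul t u) (UMul t' u')
| ueq_addA t u v : ueq (UAdd t (UAdd u v)) (UAdd (UAdd t u) v)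
| ueq_addC t u : ueq (UAdd t u) (UAdd u t)
| ueq_add0 t : ueq (UAdd (UScal 0) t) t
| ueq_addN t : ueq (UAdd (UMul (UScal (-1)) t) t) (UScal 0)
| ueq_mulA t u v : ueq (UMul t (UMul u v)) (UMul (UMul t u) v)
| ueq_mul1l t : ueq (UMul (UScal 1) t) t
| ueq_mul1r t : ueq (UMul t (UScal 1)) t
| ueq_mulDl t u v : ueq (UMul (UAdd t u) v) (UAdd (UMul t v) (UMul u v))
| ueq_mulDr t u v : ueq (UMul t (UAdd u v)) (UAdd (UMul t u) (UMul t v))
| ueq_scalD a b : ueq (UScal (a + b)) (UAdd (UScal a) (UScal b))
| ueq_scalM a b : ueq (UScal (a * b)) (UMul (UScal a) (UScal b))
| ueq_scalC a t : ueq (UMul (UScal a) t) (UMul t (UScal a))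
| ueq_genD x y : ueq (UGen (x + y)) (UAdd (UGen x) (UGen y))
| ueq_genZ a x : ueq (UGen (a *: x)) (UMul (UScal a) (UGen x))
| ueq_bracket x y :
    ueq (UGen (lie_bracket x y))
        (UAdd (UMul (UGen x) (UGen y))
              (UMul (UScal (-1)) (UMul (UGen y) (UGen x)))).

HB.instance Definition _ := gen_eqMixin uterm.
HB.instance Definition _ := gen_choiceMixin uterm.

Definition ueqb (t u : uterm) : bool := `[< ueq t u >].

Lemma ueqb_refl : reflexive ueqb.
Proof. by move=> t; apply/asboolP; apply: ueq_refl. Qed.

Lemma ueqb_sym : symmetric ueqb.
Proof.
by move=> t u; apply/asboolP/asboolP; apply: ueq_sym.
Qed.

Lemma ueqb_trans : transitive ueqb.
Proof.
by move=> u t v /asboolP tu /asboolP uv; apply/asboolP; apply: ueq_trans uv.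
Qed.

Definition ueq_equiv := EquivRel ueqb ueqb_refl ueqb_sym ueqb_trans.

Definition uea : Type := {eq_quot ueq_equiv}.

HB.instance Definition _ : EqQuotient _ ueq_equiv uea := EqQuotient.on uea.
HB.instance Definition _ := Choice.on uea.

Definition uclass (t : uterm) : uea := \pi_uea t.

Lemma uclass_eq t u : ueq t u -> uclass t = uclass u.
Proof. by move=> tu; apply/eqmodP/asboolP. Qed.

Lemma uclassP (x : uea) : exists t, x = uclass t.
Proof. by exists (repr x); rewrite /uclass reprK. Qed.

Lemma ueq_repr t : ueq (repr (uclass t)) t.
Proof. by apply/asboolP; rewrite -/(ueqb _ _) -[ueqb _ _]/(ueq_equiv _ _); apply/eqmodP; rewrite reprK. Qed.

Definition uadd (x y : uea) : uea := uclass (UAdd (repr x) (repr y)).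
Definition umul (x y : uea) : uea := uclass (UMul (repr x) (repr y)).
Definition uscal (a : K) : uea := uclass (UScal a).
Definition uopp (x : uea) : uea := umul (uscal (-1)) x.

Lemma uaddE t u : uadd (uclass t) (uclass u) = uclass (UAdd t u).
Proof. by apply: uclass_eq; apply: ueq_addc; apply: ueq_repr. Qed.

Lemma umulE t u : umul (uclass t) (uclass u) = uclass (UMul t u).
Proof. by apply: uclass_eq; apply: ueq_mulc; apply: ueq_repr. Qed.

Lemma uaddA : associative uadd.
Proof.
move=> x y v; case: (uclassP x) (uclassP y) (uclassP v) => t -> [u ->] [w ->].
by rewrite !uaddE; apply/uclass_eq/ueq_addA.
Qed.

Lemma uaddC : commutative uadd.
Proof.
move=> x y; case: (uclassP x) (uclassP y) => t -> [u ->].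
by rewrite !uaddE; apply/uclass_eq/ueq_addC.
Qed.

Lemma uadd0 : left_id (uscal 0) uadd.
Proof.
by move=> x; have [t ->] := uclassP x; rewrite uaddE; apply/uclass_eq/ueq_add0.
Qed.

Lemma uaddN : left_inverse (uscal 0) uopp uadd.
Proof.
move=> x; have [t ->] := uclassP x; rewrite /uopp umulE uaddE.
exact/uclass_eq/ueq_addN.
Qed.

HB.instance Definition _ :=
  GRing.isZmodule.Build uea uaddA uaddC uadd0 uaddN.

Lemma umulA : associative umul.
Proof.
move=> x y v; case: (uclassP x) (uclassP y) (uclassP v) => t -> [u ->] [w ->].
by rewrite !umulE; apply/uclass_eq/ueq_mulA.
Qed.

Lemma umul1l : left_id (uscal 1) umul.
Proof.
by move=> x; have [t ->] := uclassP x; rewrite umulE; apply/uclass_eq/ueq_mul1l.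
Qed.

Lemma umul1r : right_id (uscal 1) umul.
Proof.
by move=> x; have [t ->] := uclassP x; rewrite umulE; apply/uclass_eq/ueq_mul1r.
Qed.

Lemma umulDl : left_distributive umul uadd.
Proof.
move=> x y v; case: (uclassP x) (uclassP y) (uclassP v) => t -> [u ->] [w ->].
by rewrite !(umulE, uaddE); apply/uclass_eq/ueq_mulDl.
Qed.

Lemma umulDr : right_distributive umul uadd.
Proof.
move=> x y v; case: (uclassP x) (uclassP y) (uclassP v) => t -> [u ->] [w ->].
by rewrite !(umulE, uaddE); apply/uclass_eq/ueq_mulDr.
Qed.

Section Eval.
Variables (A : algType K) (phi : {linear L -> A}).

Fixpoint ueval (t : uterm) : A :=
  match t with
  | UGen x => phi x
  | UScal a => a%:A
  | UAdd t u => ueval t + ueval u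
  | UMul t u => ueval t * ueval u
  end.

Definition lie_morphism :=
  forall x y, phi (lie_bracket x y) = phi x * phi y - phi y * phi x.

Lemma ueval_eq : lie_morphism -> forall t u, ueq t u -> ueval t = ueval u.
Proof.
move=> phiB t u; elim=> {t u} //=.
- by move=> t u v _ ->.
- by move=> t t' u u' _ -> _ ->.
- by move=> t t' u u' _ -> _ ->.
- by move=> t u v; rewrite addrA.
- by move=> t u; rewrite addrC.
- by move=> t; rewrite scale0r add0r.
- by move=> t; rewrite scaleN1r scale0r mulN1r addNr.
- by move=> t u v; rewrite mulrA.
- by move=> t; rewrite scale1r mul1r.
- by move=> t; rewrite scale1r mulr1.
- by move=> t u v; rewrite mulrDl.
- by move=> t u v; rewrite mulrDr.
- by move=> a b; rewrite scalerDl.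
- by move=> a b; rewrite -scalerAl mul1r scalerA.
- by move=> a t; rewrite -scalerAl -scalerAr mul1r mulr1.
- by move=> x y; rewrite linearD.
- by move=> a x; rewrite linearZ /= -scalerAl mul1r.
- by move=> x y; rewrite phiB scaleN1r mulN1r.
Qed.

End Eval.

Lemma uone_neq0 : uscal 1 != uscal 0.
Proof.
apply/eqP => /eqmodP/asboolP.
have phiB : lie_morphism (\0 : {linear L -> K^o}).
  by move=> x y; rewrite /= mulr0 subr0.
move=> /(ueval_eq phiB) /=; rewrite !scale0r scale1r => /eqP.
by rewrite oner_eq0.
Qed.

HB.instance Definition _ := GRing.Zmodule_isNzRing.Build uea
  umulA umul1l umul1r umulDl umulDr uone_neq0.

Definition uscale (a : K) (x : uea) : uea := uscal a * x.

Lemma uscalM a b : uscal (a * b) = uscal a * uscal b.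
Proof. by rewrite /GRing.mul /= umulE; apply/uclass_eq/ueq_scalM. Qed.

Lemma uscalD a b : uscal (a + b) = uscal a + uscal b.
Proof. by rewrite /GRing.add /= uaddE; apply/uclass_eq/ueq_scalD. Qed.

Lemma uscaleA a b x : uscale a (uscale b x) = uscale (a * b) x.
Proof. by rewrite /uscale uscalM mulrA. Qed.

Lemma uscale1 : left_id 1 uscale.
Proof. exact: mul1r. Qed.

Lemma uscaleDr : right_distributive uscale +%R.
Proof. by move=> a x y; apply: mulrDr. Qed.

Lemma uscaleDl x : {morph uscale^~ x : a b / a + b}.
Proof. by move=> a b; rewrite /uscale uscalD mulrDl. Qed.

HB.instance Definition _ := GRing.Zmodule_isLmodule.Build K uea
  uscaleA uscale1 uscaleDr uscaleDl.

Lemma uscaleAl (a : K) (x y : uea) : a *: (x * y) = (a *: x) * y.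
Proof. exact: mulrA. Qed.

HB.instance Definition _ := GRing.Lmodule_isLalgebra.Build K uea uscaleAl.

Lemma uscaleAr (a : K) (x y : uea) : a *: (x * y) = x * (a *: y).
Proof.
rewrite /GRing.scale /= /uscale !mulrA; congr (_ * _).
have [t ->] := uclassP x.
by rewrite /GRing.mul /= !umulE; apply/uclass_eq/ueq_scalC.
Qed.

HB.instance Definition _ := GRing.Lalgebra_isAlgebra.Build K uea uscaleAr.

Definition ugen (x : L) : uea := uclass (UGen x).

Lemma ugen_linear : linear ugen.
Proof.
move=> a x y; rewrite /GRing.scale /= /uscale /GRing.mul /GRing.add /=.
rewrite umulE uaddE; apply: uclass_eq; apply: ueq_trans (ueq_genD _ _) _.
by apply: ueq_addc (ueq_genZ _ _) (ueq_refl _).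
Qed.

HB.instance Definition _ := GRing.isLinear.Build K L uea _ ugen ugen_linear.

Lemma ugen_bracket x y :
  ugen (lie_bracket x y) = ugen x * ugen y - ugen y * ugen x.
Proof.
have -> : - (ugen y * ugen x)
    = uclass (UMul (UScal (-1)) (UMul (UGen y) (UGen x))).
  by rewrite -[RHS]umulE -umulE.
rewrite /ugen /GRing.mul /GRing.add /= !(umulE, uaddE).
exact/uclass_eq/ueq_bracket.
Qed.

Section Lift.
Variables (A : algType K) (phi : {linear L -> A}).
Hypothesis phiB : lie_morphism phi.

(* The algebra morphism uea -> A extending the Lie algebra morphism phi. *)
Definition ulift of lie_morphism phi := fun x : uea => ueval phi (repr x).

Local Notation lift := (ulift phiB).

Lemma uliftE t : lift (uclass t) = ueval phi t.
Proof. by apply: ueval_eq phiB _ _ (ueq_repr t). Qed.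

Lemma ulift_gen x : lift (ugen x) = phi x.
Proof. by rewrite uliftE. Qed.

Lemma ulift_linear : linear lift.
Proof.
move=> a x y; case: (uclassP x) (uclassP y) => t -> [u ->].
rewrite /GRing.scale /= /uscale /GRing.mul /GRing.add /= umulE uaddE !uliftE /=.
by rewrite -scalerAl mul1r.
Qed.

Lemma ulift_monoid_morphism : monoid_morphism lift.
Proof.
split; first by rewrite uliftE /= scale1r.
move=> x y; case: (uclassP x) (uclassP y) => t -> [u ->].
by rewrite /GRing.mul /= umulE !uliftE.
Qed.

HB.instance Definition _ := GRing.isLinear.Build K uea A _ lift ulift_linear.
HB.instance Definition _ :=
  GRing.isMonoidMorphism.Build uea A lift ulift_monoid_morphism.

End Lift.
End Enveloping.

Section LieSubalgebra.
Variables (K : fieldType) (L : lieAlgType K) (S : submodClosed L).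

Definition lie_closed :=
  forall x y, x \in S -> y \in S -> lie_bracket x y \in S.

Record sublie (SB : lie_closed) : Type :=
  SubLie { sublie_val :> L; _ : sublie_val \in S }.

Variable SB : lie_closed.
Local Notation T := (sublie SB).

HB.instance Definition _ := [isSub for @sublie_val SB].
HB.instance Definition _ := [Choice of T by <:].
HB.instance Definition _ := [SubChoice_isSubLmodule of T by <:].

Definition sublie_bracket (x y : T) : T := SubLie SB (SB (valP x) (valP y)).

Lemma sublie_bracketPl (a : K) (x y t : T) :
  sublie_bracket (a *: x + y) t
  = a *: sublie_bracket x t + sublie_bracket y t.
Proof. by apply: val_inj; apply: bracketPl. Qed.

Lemma sublie_bracketPr (a : K) (x y t : T) :
  sublie_bracket t (a *: x + y)
  = a *: sublie_bracket t x + sublie_bracket t y.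
Proof. by apply: val_inj; apply: bracketPr. Qed.

Lemma sublie_bracketxx (x : T) : sublie_bracket x x = 0.
Proof. by apply: val_inj; apply: bracketxx. Qed.

Lemma sublie_jacobi (x y t : T) :
  sublie_bracket x (sublie_bracket y t) + sublie_bracket y (sublie_bracket t x)
    + sublie_bracket t (sublie_bracket x y) = 0.
Proof. by apply: val_inj; apply: jacobi. Qed.

HB.instance Definition _ := isLie.Build K T
  sublie_bracketPl sublie_bracketPr sublie_bracketxx sublie_jacobi.

Definition sublie_ugen (x : T) : uea L := ugen (sublie_val x).

Lemma sublie_ugen_linear : linear sublie_ugen.
Proof. by move=> a x y; rewrite -linearP; congr ugen. Qed.

HB.instance Definition _ :=
  GRing.isLinear.Build K T (uea L) _ sublie_ugen sublie_ugen_linear.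

Lemma sublie_ugen_morphism : lie_morphism sublie_ugen.
Proof. by move=> x y; apply: ugen_bracket. Qed.

(* The canonical map U(a) -> U(L) for a Lie subalgebra a of L. *)
Definition uea_incl : {lrmorphism uea T -> uea L} :=
  ulift sublie_ugen_morphism.

End LieSubalgebra.

(* Extension of scalars B ⊗_A N along phi : A -> B, where A acts on B on the
   right through phi.  A list of pairs stands for the sum of the corresponding
   pure tensors. *)
Section Tensor.
Variables (A B : pzRingType) (phi : {rmorphism A -> B}) (N : lmodType A).

Inductive teq : seq (B * N) -> seq (B * N) -> Prop :=
| teq_refl s : teq s s
| teq_sym s t : teq s t -> teq t s
| teq_trans s t u : teq s t -> teq t u -> teq s u
| teq_cat s s' t t' : teq s s' -> teq t t' -> teq (s ++ t) (s' ++ t')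
| teq_catC s t : teq (s ++ t) (t ++ s)
| teq_Dl b b' n : teq [:: (b + b', n)] [:: (b, n); (b', n)]
| teq_Dr b n n' : teq [:: (b, n + n')] [:: (b, n); (b, n')]
| teq_bal b a n : teq [:: (b * phi a, n)] [:: (b, a *: n)]
| teq_0 n : teq [:: (0, n)] [::].

Definition teqb s t : bool := `[< teq s t >].

Lemma teqb_refl : reflexive teqb.
Proof. by move=> t; apply/asboolP; apply: teq_refl. Qed.

Lemma teqb_sym : symmetric teqb.
Proof. by move=> t u; apply/asboolP/asboolP; apply: teq_sym. Qed.

Lemma teqb_trans : transitive teqb.
Proof.
by move=> u t v /asboolP tu /asboolP uv; apply/asboolP; apply: teq_trans uv.
Qed.

Definition teq_equiv := EquivRel teqb teqb_refl teqb_sym teqb_trans.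

Definition tensor : Type := {eq_quot teq_equiv}.

HB.instance Definition _ : EqQuotient _ teq_equiv tensor :=
  EqQuotient.on tensor.
HB.instance Definition _ := Choice.on tensor.

Definition tclass (s : seq (B * N)) : tensor := \pi_tensor s.

Definition pure_tensor (b : B) (n : N) : tensor := tclass [:: (b, n)].

Lemma tclass_eq s t : teq s t -> tclass s = tclass t.
Proof. by move=> st; apply/eqmodP/asboolP. Qed.

Lemma tclassP (x : tensor) : exists s, x = tclass s.
Proof. by exists (repr x); rewrite /tclass reprK. Qed.

Lemma teq_repr s : teq (repr (tclass s)) s.
Proof.
apply/asboolP; rewrite -/(teqb _ _) -[teqb _ _]/(teq_equiv _ _).
by apply/eqmodP; rewrite reprK.
Qed.

Definition smul (b : B) (s : seq (B * N)) : seq (B * N) :=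
  [seq (b * x.1, x.2) | x <- s].

Definition tadd (x y : tensor) : tensor := tclass (repr x ++ repr y).
Definition tscale (b : B) (x : tensor) : tensor := tclass (smul b (repr x)).

Lemma smul_teq b s t : teq s t -> teq (smul b s) (smul b t).
Proof.
elim=> {s t} /=.
- by move=> s; apply: teq_refl.
- by move=> s t _; apply: teq_sym.
- by move=> s t u _ st _; apply: teq_trans st.
- by move=> s s' t t' _ ss' _ tt'; rewrite /smul !map_cat; apply: teq_cat.
- by move=> s t; rewrite /smul !map_cat; apply: teq_catC.
- by move=> c c' n; rewrite mulrDr; apply: teq_Dl.
- by move=> c n n'; apply: teq_Dr.
- by move=> c a n; rewrite mulrA; apply: teq_bal.
- by move=> n; rewrite mulr0; apply: teq_0.
Qed.

Lemma taddE s t : tadd (tclass s) (tclass t) = tclass (s ++ t).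
Proof. by apply: tclass_eq; apply: teq_cat; apply: teq_repr. Qed.

Lemma tscaleE b s : tscale b (tclass s) = tclass (smul b s).
Proof. by apply: tclass_eq; apply: smul_teq; apply: teq_repr. Qed.

Lemma taddA : associative tadd.
Proof.
move=> x y v; case: (tclassP x) (tclassP y) (tclassP v) => s -> [t ->] [u ->].
by rewrite !taddE catA.
Qed.

Lemma taddC : commutative tadd.
Proof.
move=> x y; case: (tclassP x) (tclassP y) => s -> [t ->].
by rewrite !taddE; apply/tclass_eq/teq_catC.
Qed.

Lemma tadd0 : left_id (tclass [::]) tadd.
Proof. by move=> x; case: (tclassP x) => s ->; rewrite taddE. Qed.

Lemma smulDl b c s : teq (smul (b + c) s) (smul b s ++ smul c s).
Proof.
elim: s => [|[d n] s IHs] /=; first exact: teq_refl.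
rewrite mulrDl -cat1s.
apply: teq_trans (teq_cat (teq_Dl _ _ _) IHs) _.
rewrite -[X in teq _ X]/([:: (b * d, n)]
  ++ (smul b s ++ [:: (c * d, n)] ++ smul c s)).
apply: (teq_cat (teq_refl [:: (b * d, n)])).
by rewrite -cat_cons -cat1s catA; apply: teq_cat (teq_catC _ _) (teq_refl _).
Qed.

Lemma smul0 s : teq (smul 0 s) [::].
Proof.
elim: s => [|[d n] s IHs] /=; first exact: teq_refl.
by rewrite mul0r -cat1s; apply: teq_cat (teq_0 n) IHs.
Qed.

Lemma smul1 s : smul 1 s = s.
Proof. by elim: s => [|[d n] s IHs] //=; rewrite mul1r IHs. Qed.

Lemma taddN : left_inverse (tclass [::]) (tscale (-1)) tadd.
Proof.
move=> x; case: (tclassP x) => s ->; rewrite tscaleE taddE; apply: tclass_eq.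
rewrite -{2}(smul1 s); apply: teq_trans (teq_sym (smulDl _ _ _)) _.
by rewrite addNr; apply: smul0.
Qed.

HB.instance Definition _ :=
  GRing.isZmodule.Build tensor taddA taddC tadd0 taddN.

Lemma tscaleA b c (x : tensor) : tscale b (tscale c x) = tscale (b * c) x.
Proof.
case: (tclassP x) => s ->; rewrite !tscaleE /smul -map_comp.
by congr tclass; apply: eq_map => y /=; rewrite mulrA.
Qed.

Lemma tscale1 : left_id 1 tscale.
Proof. by move=> x; case: (tclassP x) => s ->; rewrite tscaleE smul1. Qed.

Lemma tscaleDr : right_distributive tscale +%R.
Proof.
move=> b x y; case: (tclassP x) (tclassP y) => s -> [t ->].
by rewrite /GRing.add /= taddE !tscaleE taddE /smul map_cat.
Qed.

Lemma tscaleDl (x : tensor) : {morph tscale^~ x : b c / b + c}.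
Proof.
move=> b c; case: (tclassP x) => s ->.
rewrite !tscaleE [RHS]taddE; apply: tclass_eq; exact: smulDl.
Qed.

HB.instance Definition _ := GRing.Zmodule_isLmodule.Build B tensor
  tscaleA tscale1 tscaleDr tscaleDl.

End Tensor.

Section Schrodinger.
Variable K : fieldType.

Definition schrodinger : Type := 'rV[K]_6.
HB.instance Definition _ := GRing.Lmodule.on schrodinger.

Definition ie : 'I_6 := @Ordinal 6 0 isT.
Definition ih : 'I_6 := @Ordinal 6 1 isT.
Definition if_ : 'I_6 := @Ordinal 6 2 isT.
Definition ip : 'I_6 := @Ordinal 6 3 isT.
Definition iq : 'I_6 := @Ordinal 6 4 isT.
Definition iz : 'I_6 := @Ordinal 6 5 isT.

Definition coord (i : 'I_6) (x : schrodinger) : K := (x : 'rV[K]_6) 0 i.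
Definition vec (i : 'I_6) : schrodinger := delta_mx 0 i.

(* [wedge x y i j *: t] is the contribution of the bracket [i, j] = t of two
   basis vectors to [x, y]. *)
Definition wedge (x y : schrodinger) (i j : 'I_6) : K :=
  coord i x * coord j y - coord j x * coord i y.

Definition sbracket (x y : schrodinger) : schrodinger :=
  let w := wedge x y in
  w ih ie *: (2 *: vec ie) + w ie if_ *: vec ih + w ih if_ *: (-2 *: vec if_)
  + w ie iq *: vec ip + w ih ip *: vec ip + w if_ ip *: vec iq
  + w ih iq *: - vec iq + w ip iq *: vec iz.

Lemma coordP (x y : schrodinger) : (forall i, coord i x = coord i y) -> x = y.
Proof. by move=> xy; apply/rowP => i; apply: xy. Qed.

Lemma ord6P (P : 'I_6 -> Prop) :
  P ie -> P ih -> P if_ -> P ip -> P iq -> P iz -> forall i, P i.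
Proof.
move=> Pe Ph Pf Pp Pq Pz; case=> [[|[|[|[|[|[|k]]]]]] i6]; last by [].
- by rewrite (_ : Ordinal i6 = ie) //; apply: val_inj.
- by rewrite (_ : Ordinal i6 = ih) //; apply: val_inj.
- by rewrite (_ : Ordinal i6 = if_) //; apply: val_inj.
- by rewrite (_ : Ordinal i6 = ip) //; apply: val_inj.
- by rewrite (_ : Ordinal i6 = iq) //; apply: val_inj.
- by rewrite (_ : Ordinal i6 = iz) //; apply: val_inj.
Qed.

Lemma coordD i x y : coord i (x + y) = coord i x + coord i y.
Proof. by rewrite /coord mxE. Qed.
Lemma coordZ i a x : coord i (a *: x) = a * coord i x.
Proof. by rewrite /coord mxE. Qed.
Lemma coordN i x : coord i (- x) = - coord i x.
Proof. by rewrite /coord mxE. Qed.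
Lemma coord0 i : coord i 0 = 0.
Proof. by rewrite /coord mxE. Qed.
Lemma coord_vec i j : coord i (vec j) = (i == j)%:R.
Proof. by rewrite /coord mxE. Qed.

Definition coordE := (coordD, coordZ, coordN, coord0, coord_vec).

Lemma coord_bracket_e x y :
  coord ie (sbracket x y) = 2 * wedge x y ih ie.
Proof. by rewrite /sbracket !coordE /=; ring. Qed.
Lemma coord_bracket_h x y :
  coord ih (sbracket x y) = wedge x y ie if_.
Proof. by rewrite /sbracket !coordE /=; ring. Qed.
Lemma coord_bracket_f x y :
  coord if_ (sbracket x y) = -2 * wedge x y ih if_.
Proof. by rewrite /sbracket !coordE /=; ring. Qed.
Lemma coord_bracket_p x y :
  coord ip (sbracket x y) = wedge x y ie iq + wedge x y ih ip.
Proof. by rewrite /sbracket !coordE /=; ring. Qed.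
Lemma coord_bracket_q x y :
  coord iq (sbracket x y) = wedge x y if_ ip - wedge x y ih iq.
Proof. by rewrite /sbracket !coordE /=; ring. Qed.
Lemma coord_bracket_z x y :
  coord iz (sbracket x y) = wedge x y ip iq.
Proof. by rewrite /sbracket !coordE /=; ring. Qed.

Definition coord_bracketE := (coord_bracket_e, coord_bracket_h, coord_bracket_f,
  coord_bracket_p, coord_bracket_q, coord_bracket_z).

Lemma sbracketPl (a : K) (x y t : schrodinger) :
  sbracket (a *: x + y) t = a *: sbracket x t + sbracket y t.
Proof.
apply: coordP; apply: ord6P; rewrite ?(coordE, coord_bracketE) /wedge ?coordE; ring.
Qed.

Lemma sbracketPr (a : K) (x y t : schrodinger) :
  sbracket t (a *: x + y) = a *: sbracket t x + sbracket t y.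
Proof.
apply: coordP; apply: ord6P; rewrite ?(coordE, coord_bracketE) /wedge ?coordE; ring.
Qed.

Lemma sbracketxx (x : schrodinger) : sbracket x x = 0.
Proof.
apply: coordP; apply: ord6P; rewrite ?(coordE, coord_bracketE) /wedge ?coordE; ring.
Qed.

Lemma sbracket_jacobi (x y t : schrodinger) :
  sbracket x (sbracket y t) + sbracket y (sbracket t x)
    + sbracket t (sbracket x y) = 0.
Proof.
by apply: coordP; apply: ord6P;
  rewrite 2!coordD coord0 ?coord_bracketE /wedge ?coord_bracketE /wedge; ring.
Qed.

HB.instance Definition _ := isLie.Build K schrodinger
  sbracketPl sbracketPr sbracketxx sbracket_jacobi.

Local Ltac bracket_vec :=
  apply: coordP; apply: ord6P;
  rewrite ?(coordE, coord_bracketE) /wedge ?coordE /=; ring.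

Lemma bracket_he : sbracket (vec ih) (vec ie) = 2 *: vec ie.
Proof. by bracket_vec. Qed.
Lemma bracket_ef : sbracket (vec ie) (vec if_) = vec ih.
Proof. by bracket_vec. Qed.
Lemma bracket_hf : sbracket (vec ih) (vec if_) = -2 *: vec if_.
Proof. by bracket_vec. Qed.
Lemma bracket_eq : sbracket (vec ie) (vec iq) = vec ip.
Proof. by bracket_vec. Qed.
Lemma bracket_ep : sbracket (vec ie) (vec ip) = 0.
Proof. by bracket_vec. Qed.
Lemma bracket_hp : sbracket (vec ih) (vec ip) = vec ip.
Proof. by bracket_vec. Qed.
Lemma bracket_fp : sbracket (vec if_) (vec ip) = vec iq.
Proof. by bracket_vec. Qed.
Lemma bracket_fq : sbracket (vec if_) (vec iq) = 0.
Proof. by bracket_vec. Qed.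
Lemma bracket_hq : sbracket (vec ih) (vec iq) = - vec iq.
Proof. by bracket_vec. Qed.
Lemma bracket_pq : sbracket (vec ip) (vec iq) = vec iz.
Proof. by bracket_vec. Qed.
Lemma bracket_z x : sbracket (vec iz) x = 0.
Proof. by bracket_vec. Qed.

Definition nplus_pred : {pred schrodinger} := fun x =>
  [&& coord ih x == 0, coord if_ x == 0, coord iq x == 0 & coord iz x == 0].

Definition borel_pred : {pred schrodinger} := fun x =>
  (coord if_ x == 0) && (coord iq x == 0).

Definition cartan_pred : {pred schrodinger} := fun x =>
  [&& coord ie x == 0, coord if_ x == 0, coord ip x == 0 & coord iq x == 0].

Lemma nplus_submod : submod_closed nplus_pred.
Proof.
split=> [|a x y]; first by rewrite unfold_in !coord0 !eqxx.
rewrite !unfold_in => /and4P[/eqP xh /eqP xf /eqP xq /eqP xz].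
move=> /and4P[/eqP yh /eqP yf /eqP yq /eqP yz].
by rewrite !coordE xh xf xq xz yh yf yq yz mulr0 addr0 eqxx.
Qed.

HB.instance Definition _ :=
  GRing.isSubmodClosed.Build K schrodinger nplus_pred nplus_submod.

Lemma borel_submod : submod_closed borel_pred.
Proof.
split=> [|a x y]; first by rewrite unfold_in !coord0 !eqxx.
rewrite !unfold_in => /andP[/eqP xf /eqP xq] /andP[/eqP yf /eqP yq].
by rewrite !coordE xf xq yf yq mulr0 addr0 eqxx.
Qed.

HB.instance Definition _ :=
  GRing.isSubmodClosed.Build K schrodinger borel_pred borel_submod.

Lemma nplus_closed : lie_closed nplus_pred.
Proof.
move=> x y; rewrite !unfold_in => /and4P[/eqP xh /eqP xf /eqP xq _].
move=> /and4P[/eqP yh /eqP yf /eqP yq _].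
rewrite !coord_bracketE /wedge xh xf xq yh yf yq.
by rewrite !(mulr0, mul0r, subr0, addr0) eqxx.
Qed.

Lemma borel_closed : lie_closed borel_pred.
Proof.
move=> x y; rewrite !unfold_in => /andP[/eqP xf /eqP xq] /andP[/eqP yf /eqP yq].
rewrite !coord_bracketE /wedge xf xq yf yq.
by rewrite !(mulr0, mul0r, subr0, addr0) eqxx.
Qed.

Definition nplus : lieAlgType K := sublie nplus_closed.
Definition borel : lieAlgType K := sublie borel_closed.

Definition U : algType K := uea schrodinger.

(* A weight is given by its coordinates in the basis dual to (h, z). *)
Definition weight : Type := (K * K)%type.
HB.instance Definition _ := GRing.Zmodule.on weight.

Definition weval (l : weight) (x : schrodinger) : K :=
  l.1 * coord ih x + l.2 * coord iz x.

Definition borel_char (l : weight) (x : borel) : K^o := weval l (sublie_val x).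

Lemma borel_char_linear l : linear (borel_char l).
Proof.
move=> a x y; rewrite /borel_char /weval.
have -> : sublie_val (a *: x + y) = a *: sublie_val x + sublie_val y by [].
by rewrite !coordE /GRing.scale /=; ring.
Qed.

HB.instance Definition _ l :=
  GRing.isLinear.Build K borel K^o _ (borel_char l) (borel_char_linear l).

Lemma borel_char_morphism l : lie_morphism (borel_char l).
Proof.
case=> [x xb] [y yb]; rewrite [X in _ = _ - X]mulrC subrr.
rewrite -[LHS]/(weval l (sbracket x y)) /weval.
move: xb yb; rewrite !unfold_in.
move=> /andP[/eqP xf /eqP xq] /andP[/eqP yf /eqP yq].
rewrite !coord_bracketE /wedge xf xq yf yq.
by rewrite !(mulr0, mul0r, subr0, addr0).
Qed.

Section OneDim.
Variable l : weight.

(* The one-dimensional U(b)-module on which h acts via l and n_+ by 0. *)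
Definition char_module of weight : Type := K.
HB.instance Definition _ := GRing.Zmodule.on (char_module l).

Definition weight_char : uea borel -> K^o := ulift (borel_char_morphism l).

Definition wm_scale (a : uea borel) (c : char_module l) : char_module l :=
  (weight_char a : K) * (c : K).

Lemma wm_scaleA a b c : wm_scale a (wm_scale b c) = wm_scale (a * b) c.
Proof. by rewrite /wm_scale /weight_char rmorphM mulrA. Qed.

Lemma wm_scale1 : left_id 1 wm_scale.
Proof. by move=> c; rewrite /wm_scale /weight_char rmorph1 mul1r. Qed.

Lemma wm_scaleDr : right_distributive wm_scale +%R.
Proof. by move=> a c d; apply: mulrDr. Qed.

Lemma wm_scaleDl c : {morph wm_scale^~ c : a b / a + b}.
Proof. by move=> a b; rewrite /wm_scale /weight_char raddfD; apply: mulrDl. Qed.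

HB.instance Definition _ :=
  GRing.Zmodule_isLmodule.Build (uea borel) (char_module l)
    wm_scaleA wm_scale1 wm_scaleDr wm_scaleDl.

Definition verma : lmodType U :=
  tensor (uea_incl borel_closed) (char_module l).

End OneDim.
End Schrodinger.

Record category : Type := Category {
  obj :> Type;
  hom : obj -> obj -> Type;
  idc : forall X, hom X X;
  compc : forall X Y Z, hom Y Z -> hom X Y -> hom X Z;
  compcA : forall X Y Z W (h : hom Z W) (g : hom Y Z) (f : hom X Y),
    compc h (compc g f) = compc (compc h g) f;
  comp1c : forall X Y (f : hom X Y), compc (idc Y) f = f;
  compc1 : forall X Y (f : hom X Y), compc f (idc X) = f
}.
Arguments hom {c} _ _.
Arguments idc {c} _.
Arguments compc {c X Y Z} _ _.

Record functor (C D : category) : Type := Functor {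
  fobj :> C -> D;
  fmap : forall X Y : C, hom X Y -> hom (fobj X) (fobj Y);
  fmap1 : forall X : C, fmap (idc X) = idc (fobj X);
  fmapM : forall (X Y Z : C) (g : hom Y Z) (f : hom X Y),
    fmap (compc g f) = compc (fmap g) (fmap f)
}.
Arguments fmap {C D} _ {X Y} _.

Definition functor_id (C : category) : functor C C.
Proof. by exists (fun X => X) (fun X Y f => f). Defined.

Definition functor_comp (C D E : category) (G : functor D E) (F : functor C D) :
  functor C E.
Proof.
exists (fun X => G (F X)) (fun X Y f => fmap G (fmap F f)).
- by move=> X; rewrite !fmap1.
- by move=> X Y Z g f; rewrite !fmapM.
Defined.

Definition is_iso (C : category) (X Y : C) (f : hom X Y) : Prop :=
  exists g : hom Y X, compc g f = idc X /\ compc f g = idc Y.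

Definition naturally_isomorphic (C D : category) (F G : functor C D) : Prop :=
  exists eta : forall X : C, hom (F X) (G X),
    (forall X, is_iso (eta X)) /\
    (forall (X Y : C) (f : hom X Y),
       compc (eta Y) (fmap F f) = compc (fmap G f) (eta X)).

Definition is_equivalence (C D : category) (F : functor C D) : Prop :=
  exists G : functor D C,
    naturally_isomorphic (functor_comp G F) (functor_id C) /\
    naturally_isomorphic (functor_comp F G) (functor_id D).

Definition equivalent (C D : category) : Prop :=
  exists F : functor C D, is_equivalence F.

Definition is_zero_obj (C : category) (X : C) : Prop :=
  forall Y : C, (exists! f : hom X Y, True) /\ (exists! f : hom Y X, True).

Section DirectSumCategory.
Variables (I : eqType) (C : I -> category).

Record dsum_obj : Type := DsumObj {
  dsum_fam :> forall i, C i;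
  _ : exists s : seq I, forall i, i \notin s -> is_zero_obj (dsum_fam i)
}.

Definition dsum_category : category.
Proof.
exists dsum_obj (fun X Y => forall i, hom (X i) (Y i))
  (fun X i => idc (X i)) (fun X Y Z g f i => compc (g i) (f i)).
- by move=> *; apply: functional_extensionality_dep => i; apply: compcA.
- by move=> *; apply: functional_extensionality_dep => i; apply: comp1c.
- by move=> *; apply: functional_extensionality_dep => i; apply: compc1.
Defined.

End DirectSumCategory.

Section ModuleCategories.
Variable A : pzRingType.

Lemma linear_eq (M N : lmodType A) (f g : {linear M -> N}) : f =1 g -> f = g.
Proof.
case: f => f [[f1] [f2]]; case: g => g [[g1] [g2]] /= /funext fg.
case: _ / fg in g1 g2 *.
by rewrite (Prop_irrelevance f1 g1) (Prop_irrelevance f2 g2).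
Qed.

Record full_obj (P : lmodType A -> Prop) : Type :=
  FullObj { full_mod :> lmodType A; full_objP : P full_mod }.

(* The full subcategory of the category of A-modules on the modules
   satisfying P. *)
Definition module_category (P : lmodType A -> Prop) : category.
Proof.
exists (full_obj P) (fun M N : full_obj P => {linear M -> N})
  (fun M : full_obj P => idfun : {linear M -> M})
  (fun (M N Q : full_obj P) (g : {linear N -> Q}) (f : {linear M -> N}) =>
     (g \o f)%FUN : {linear M -> Q}).
- by move=> *; apply: linear_eq.
- by move=> *; apply: linear_eq.
- by move=> *; apply: linear_eq.
Defined.

Definition all_modules : category := module_category (fun=> True).

Definition inclusion_functor (P : lmodType A -> Prop) :
  functor (module_category P) all_modules.
Proof.
by exists (fun M : full_obj P => @FullObj (fun=> True) M Logic.I)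
  (fun M N f => f).
Defined.

Definition is_submodule (M : lmodType A) (N : set M) : Prop :=
  [/\ N 0, forall x y, N x -> N y -> N (x + y) & forall a x, N x -> N (a *: x)].

Definition simple_module (M : lmodType A) : Prop :=
  (exists v : M, v != 0) /\
  forall N : set M, is_submodule N -> N = [set 0]%classic \/ N = setT.

Definition finitely_generated (M : lmodType A) : Prop :=
  exists (n : nat) (s : 'I_n -> M),
    forall v : M, exists a : 'I_n -> A, v = \sum_i a i *: s i.

Definition short_exact (M N Q : lmodType A)
    (f : {linear M -> N}) (g : {linear N -> Q}) : Prop :=
  [/\ injective f, forall z, exists y, g y = z &
      forall y, g y = 0 <-> exists x, f x = y].

(* S is a Serre subcategory of the full subcategory of the modules satisfying
   P, which is meant to be closed under submodules and quotients. *)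
Definition serre_subcategory (P S : lmodType A -> Prop) : Prop :=
  [/\ forall M, S M -> P M,
      exists M, S M &
      forall (M N Q : lmodType A) (f : {linear M -> N}) (g : {linear N -> Q}),
        P M -> P N -> P Q -> short_exact f g -> (S N <-> S M /\ S Q)].

Definition serre_generated (P gen : lmodType A -> Prop) (M : lmodType A) :
    Prop :=
  P M /\ forall S, serre_subcategory P S -> (forall N, gen N -> S N) -> S M.

Section DirectSum.
Variables (I : eqType) (M : I -> lmodType A).

Definition finsupp (f : forall i, M i) : Prop :=
  exists s : seq I, forall i, i \notin s -> f i = 0.

Record dsum : Type := Dsum { dsum_val :> forall i, M i; _ : finsupp dsum_val }.

HB.instance Definition _ := gen_eqMixin dsum.
HB.instance Definition _ := gen_choiceMixin dsum.

Lemma dsumP (x y : dsum) : (forall i, x i = y i) -> x = y.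
Proof.
case: x y => [f fP] [g gP] /= fg.
have {}fg : f = g by apply: functional_extensionality_dep.
by subst g; rewrite (Prop_irrelevance fP gP).
Qed.

Lemma finsupp0 : finsupp (fun i => 0).
Proof. by exists [::]. Qed.

Lemma finsuppD (x y : dsum) : finsupp (fun i => x i + y i).
Proof.
case: x y => [f [s fs]] [g [t gt]] /=; exists (s ++ t) => i.
by rewrite mem_cat negb_or => /andP[/fs -> /gt ->]; rewrite addr0.
Qed.

Lemma finsuppZ a (x : dsum) : finsupp (fun i => a *: x i).
Proof. by case: x => [f [s fs]]; exists s => i /fs /= ->; rewrite scaler0. Qed.

Definition dsum_zero := Dsum finsupp0.
Definition dsum_add x y := Dsum (finsuppD x y).
Definition dsum_scale a x := Dsum (finsuppZ a x).

Lemma dsum_addA : associative dsum_add.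
Proof. by move=> x y z; apply: dsumP => i /=; rewrite addrA. Qed.
Lemma dsum_addC : commutative dsum_add.
Proof. by move=> x y; apply: dsumP => i /=; rewrite addrC. Qed.
Lemma dsum_add0 : left_id dsum_zero dsum_add.
Proof. by move=> x; apply: dsumP => i /=; rewrite add0r. Qed.
Lemma dsum_addN : left_inverse dsum_zero (dsum_scale (-1)) dsum_add.
Proof. by move=> x; apply: dsumP => i /=; rewrite scaleN1r addNr. Qed.

HB.instance Definition _ :=
  GRing.isZmodule.Build dsum dsum_addA dsum_addC dsum_add0 dsum_addN.

Lemma dsum_scaleA a b x : dsum_scale a (dsum_scale b x) = dsum_scale (a * b) x.
Proof. by apply: dsumP => i /=; rewrite scalerA. Qed.
Lemma dsum_scale1 : left_id 1 dsum_scale.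
Proof. by move=> x; apply: dsumP => i /=; rewrite scale1r. Qed.
Lemma dsum_scaleDr : right_distributive dsum_scale +%R.
Proof. by move=> a x y; apply: dsumP => i /=; rewrite scalerDr. Qed.
Lemma dsum_scaleDl x : {morph dsum_scale^~ x : a b / a + b}.
Proof. by move=> a b; apply: dsumP => i /=; rewrite scalerDl. Qed.

HB.instance Definition _ := GRing.Zmodule_isLmodule.Build A dsum
  dsum_scaleA dsum_scale1 dsum_scaleDr dsum_scaleDl.

End DirectSum.

Section DirectSumMap.
Variables (I : eqType) (M N : I -> lmodType A).
Variable f : forall i, {linear M i -> N i}.

Lemma finsupp_map (x : dsum M) : finsupp (fun i => f i (x i)).
Proof. by case: x => [g [s gs]]; exists s => i /gs /= ->; rewrite linear0. Qed.

Definition dsum_map (x : dsum M) : dsum N := Dsum (finsupp_map x).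

Lemma dsum_map_linear : linear dsum_map.
Proof. by move=> a x y; apply: dsumP => i /=; rewrite linearP. Qed.

HB.instance Definition _ :=
  GRing.isLinear.Build A (dsum M) (dsum N) _ dsum_map dsum_map_linear.

End DirectSumMap.

Section DirectSumFunctor.
Variables (I : eqType) (P : I -> lmodType A -> Prop).
Local Notation dsum_cat := (dsum_category (fun i => module_category (P i))).

Definition dsum_module (X : dsum_cat) : lmodType A :=
  dsum (fun i => full_mod (X i : full_obj (P i))).

Definition dsum_hom (X Y : dsum_cat) (f : hom X Y) :
  {linear dsum_module X -> dsum_module Y} := dsum_map f.

Definition dsum_functor : functor dsum_cat all_modules.
Proof.
exists (fun X => @FullObj (fun=> True) (dsum_module X) Logic.I) dsum_hom.
- by move=> X; apply: linear_eq => x; apply: dsumP.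
- by move=> X Y Z g f; apply: linear_eq => x; apply: dsumP.
Defined.

End DirectSumFunctor.

(* The category of the modules satisfying P is the direct sum of its full
   subcategories of the modules satisfying Pi i: taking direct sums of modules
   is an equivalence. *)
Definition decomposes (I : eqType) (P : lmodType A -> Prop)
    (Pi : I -> lmodType A -> Prop) : Prop :=
  exists F : functor (dsum_category (fun i => module_category (Pi i)))
                     (module_category P),
    is_equivalence F /\
    naturally_isomorphic (functor_comp (inclusion_functor P) F)
                         (dsum_functor Pi).

End ModuleCategories.

Section CategoryO.
Variable K : fieldType.
Local Notation U := (U K).
Local Notation weight := (weight K).
Implicit Types (M : lmodType U) (l : weight).

Definition weight_vector M l (v : M) : Prop :=
  forall x : schrodinger K, x \in @cartan_pred K ->
    (ugen x : U) *: v = ((weval l x)%:A : U) *: v.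

Definition is_weight_module M : Prop :=
  (forall v : M, exists (s : seq weight) (w : weight -> M),
     (forall l, weight_vector l (w l)) /\ v = \sum_(l <- s) w l) /\
  (forall (s : seq weight) (w : weight -> M), uniq s ->
     (forall l, weight_vector l (w l)) -> \sum_(l <- s) w l = 0 ->
     forall l, l \in s -> w l = 0).

Definition support M : set weight :=
  [set l : weight | exists2 v : M, v != 0 & weight_vector l v]%classic.

(* U(n_+) v is finite-dimensional. *)
Definition nplus_finite M (v : M) : Prop :=
  exists (n : nat) (s : 'I_n -> uea (nplus K)), forall u : uea (nplus K),
    exists c : 'I_n -> K,
      (uea_incl (@nplus_closed K) u : U) *: v
      = \sum_i ((c i)%:A : U) *: ((uea_incl (@nplus_closed K) (s i) : U) *: v).

Definition category_O M : Prop :=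
  [/\ finitely_generated M, is_weight_module M &
      forall v : M, nplus_finite v].

(* The root lattice of R = {h^, - h^, 2 h^, -2 h^} is Z h^, with h^ = hcheck. *)
Definition hcheck : weight := (1, 0).

Definition rho : weight := (3 / 2, 0).

Definition refl l : weight := (- l.1, l.2).

Definition refl_dot l : weight := refl (l + rho) - rho.

Definition is_coset (xi : set weight) : Prop :=
  exists l0 : weight,
    xi = [set l : weight | exists n : int, l = l0 + hcheck *~ n]%classic.

Definition O_coset (xi : set weight) M : Prop :=
  category_O M /\ (support M `<=` xi)%classic.

Definition O_block (xi : set weight) l : lmodType U -> Prop :=
  serre_generated (O_coset xi)
    (fun M => M = verma l \/ M = verma (refl_dot l)).

End CategoryO.

(* Main.v *)
Require Import Defs.
From HB Require Import structures.
From mathcomp Require Import all_boot all_order all_algebra.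
From mathcomp Require Import complex.
From mathcomp Require Import boolp classical_sets reals functions.
From mathcomp Require Import ssrAC ring zify.

(* Let c be the central charge.  The element F = f + q^2 / (2 c) commutes with
   p and q, so a module on which z acts by c decomposes as a Fock module for
   (p, q) tensored with ker p, on which (e, F) generate an action of sl_2 whose
   highest weights are lambda(h) + 1/2.  For integral lambda(h) these are
   half-integers, hence e^n F^n and p^n q^n act on singular vectors (those
   killed by e and p) by nonzero scalars.  Two facts follow: every module of
   O[xi] is generated by its singular vectors, and the submodule generated by
   an h-stable space T of singular vectors has no other singular vector than
   those of T.  So M is controlled by the space of its singular vectors: Verma
   modules are simple, homomorphisms are the h-equivariant maps between spaces
   of singular vectors, and M is the direct sum of the submodules generated by
   the singular vectors of weights lambda_i and r . lambda_i. *)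

Set Implicit Arguments.
Unset Strict Implicit.
Unset Printing Implicit Defensive.

Import GRing.Theory.
Local Open Scope ring_scope.

(** The predicate [good] isolates the condition on weights and the local nilpotency of e and p,
    because these pass to submodules at once while finite generation does not. In a finitely
    generated good module the singular vectors form a finite-dimensional space, and this is what
    makes its submodules finitely generated. The Serre subcategory generated by two Verma modules is
    an intersection over all Serre subcategories that contain them; it becomes tractable once
    identified with a condition on the weights of singular vectors. The two weights n and -3 - n of
    a block are distinct by parity, so the algebra acting on singular vectors is C[h] / ((h - n) (h
    + 3 + n)), which is the C + C of the theorem. A Verma module is a quotient of formal sums, where
    nonvanishing cannot be read off; its generator is shown to be nonzero by mapping it to an
    explicit module of functions on Z x Z. The values of these functions lie in a module over a
    commutative ring: over C this serves the Verma modules, over C x C it provides a block module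
    for every finitely generated module. *)

Section EnvelopingInduction.
Variables (K : fieldType) (L : lieAlgType K).

Lemma uscal_alg (a : K) : uscal L a = a%:A.
Proof. by rewrite -[RHS]/(uscal L a * 1) mulr1. Qed.

Lemma uea_ind (P : uea L -> Prop) :
  (forall x, P (ugen x)) -> (forall a : K, P a%:A) ->
  (forall u v, P u -> P v -> P (u + v)) ->
  (forall u v, P u -> P v -> P (u * v)) -> forall u, P u.
Proof.
move=> Pg Ps Pa Pm u; have [t ->] := uclassP u.
elim: t => [x|a|t IHt t' IHt'|t IHt t' IHt'].
- exact: Pg.
- by rewrite -[uclass _]/(uscal L a) uscal_alg.
- by rewrite -uaddE; apply: Pa.
- by rewrite -umulE; apply: Pm.
Qed.

End EnvelopingInduction.

(** * Relations among the generators, and scalars on U-modules *)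

Section Scalars.
Variables (K : fieldType).
Local Notation U := (Defs.U K).

Definition gen (i : 'I_6) : U := ugen (vec K i).

Local Notation ge := (gen ie).
Local Notation gh := (gen ih).
Local Notation gf := (gen if_).
Local Notation gp := (gen ip).
Local Notation gq := (gen iq).
Local Notation gz := (gen iz).

Lemma gen_comm i j : gen i * gen j = gen j * gen i + ugen (lie_bracket (vec K i) (vec K j)).
Proof. by rewrite ugen_bracket addrC subrK. Qed.

Lemma gen_he : gh * ge = ge * gh + 2 *: ge.
Proof. by rewrite gen_comm [lie_bracket _ _]bracket_he linearZ. Qed.
Lemma gen_ef : ge * gf = gf * ge + gh.
Proof. by rewrite gen_comm [lie_bracket _ _]bracket_ef. Qed.
Lemma gen_hf : gh * gf = gf * gh - 2 *: gf.
Proof. by rewrite gen_comm [lie_bracket _ _]bracket_hf linearZ -scaleNr. Qed.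
Lemma gen_eqp : ge * gq = gq * ge + gp.
Proof. by rewrite gen_comm [lie_bracket _ _]bracket_eq. Qed.
Lemma gen_ep : ge * gp = gp * ge.
Proof. by rewrite gen_comm [lie_bracket _ _]bracket_ep linear0 addr0. Qed.
Lemma gen_hp : gh * gp = gp * gh + gp.
Proof. by rewrite gen_comm [lie_bracket _ _]bracket_hp. Qed.
Lemma gen_fp : gf * gp = gp * gf + gq.
Proof. by rewrite gen_comm [lie_bracket _ _]bracket_fp. Qed.
Lemma gen_fq : gf * gq = gq * gf.
Proof. by rewrite gen_comm [lie_bracket _ _]bracket_fq linear0 addr0. Qed.
Lemma gen_hq : gh * gq = gq * gh - gq.
Proof. by rewrite gen_comm [lie_bracket _ _]bracket_hq linearN. Qed.
Lemma gen_pq : gp * gq = gq * gp + gz.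
Proof. by rewrite gen_comm [lie_bracket _ _]bracket_pq. Qed.
Lemma gen_z i : gz * gen i = gen i * gz.
Proof. by rewrite gen_comm [lie_bracket _ _]bracket_z linear0 addr0. Qed.

Lemma ugenE (x : schrodinger K) : ugen x = \sum_i Defs.coord i x *: gen i :> U.
Proof.
rewrite {1}(_ : x = \sum_i Defs.coord i x *: vec K i).
  by rewrite linear_sum; apply: eq_bigr => i _; rewrite linearZ.
exact: (row_sum_delta x).
Qed.

Variable M : lmodType U.
Implicit Types (a b : K) (u : U) (v w : M).

(** A U-module has no separate K-module structure, so scalars act through their image in U. *)
Definition sc a v : M := (a%:A : U) *: v.

Lemma scZ a u v : (a *: u) *: v = sc a (u *: v).
Proof. by rewrite /sc scalerA mulr_algl. Qed.
Lemma scU u a v : u *: sc a v = sc a (u *: v).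
Proof. by rewrite /sc !scalerA mulr_algl mulr_algr. Qed.
Lemma scA a b v : sc a (sc b v) = sc (a * b) v.
Proof. by rewrite -scZ scalerA. Qed.
Lemma sc1 v : sc 1 v = v. Proof. by rewrite /sc !scale1r. Qed.
Lemma sc0l v : sc 0 v = 0. Proof. by rewrite /sc !scale0r. Qed.
Lemma sc0 a : sc a 0 = 0. Proof. exact: scaler0. Qed.
Lemma scD a v w : sc a (v + w) = sc a v + sc a w. Proof. exact: scalerDr. Qed.
Lemma scDl v a b : sc (a + b) v = sc a v + sc b v.
Proof. by rewrite /sc !scalerDl. Qed.
Lemma scN a v : sc a (- v) = - sc a v. Proof. exact: scalerN. Qed.
Lemma scNl a v : sc (- a) v = - sc a v. Proof. by rewrite /sc !scaleNr. Qed.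
Lemma scB a v w : sc a (v - w) = sc a v - sc a w. Proof. exact: scalerBr. Qed.
Lemma scBl v a b : sc (a - b) v = sc a v - sc b v.
Proof. by rewrite /sc !scalerBl. Qed.
Lemma sc_sumr I (r : seq I) (P : pred I) a (F : I -> M) :
  sc a (\sum_(i <- r | P i) F i) = \sum_(i <- r | P i) sc a (F i).
Proof. exact: scaler_sumr. Qed.
Lemma sc_eq0 a v : a != 0 -> sc a v = 0 -> v = 0.
Proof.
by move=> a0 av; rewrite -[v]sc1 -(mulVf a0) -scA av sc0.
Qed.
Lemma submodule_gen (N : set M) : N 0 -> (forall v w, N v -> N w -> N (v + w)) ->
  (forall a v, N v -> N (sc a v)) -> (forall i v, N v -> N (gen i *: v)) ->
  is_submodule N.
Proof.
move=> N0 ND NZ NG; split=> // u v.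
elim/uea_ind: u v => [x|a|u u' IHu IHu'|u u' IHu IHu'] v Nv.
- rewrite ugenE scaler_suml; elim/big_ind: _ => [//||i _]; first exact: ND.
  by rewrite scZ; apply: NZ; apply: NG.
- exact: NZ.
- by rewrite scalerDl; apply: ND; [apply: IHu|apply: IHu'].
- by rewrite -scalerA; apply: IHu; apply: IHu'.
Qed.

End Scalars.
Arguments sc {K M} a v.

Local Notation ge := (gen _ ie).
Local Notation gh := (gen _ ih).
Local Notation gf := (gen _ if_).
Local Notation gp := (gen _ ip).
Local Notation gq := (gen _ iq).
Local Notation gz := (gen _ iz).

(** * Weight vectors *)

Section WeightVectors.
Variables (K : fieldType).
Local Notation U := (Defs.U K).
Local Notation weight := (weight K).
Implicit Types (l m : weight) (s : seq weight).

(** The weights of e, h, f, p, q, z, in this order, under the adjoint action. *)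
Definition shift (i : 'I_6) : weight :=
  (nth 0 [:: 2; 0; - 2; 1; - 1; 0] i, 0).

Lemma gen_h_comm i : gh * gen K i = gen K i * gh + (shift i).1 *: gen K i.
Proof.
rewrite /shift; elim/ord6P: i => /=.
- exact: gen_he.
- by rewrite scale0r addr0.
- by rewrite gen_hf scaleNr.
- by rewrite gen_hp scale1r.
- by rewrite gen_hq scaleNr scale1r.
- by rewrite gen_z scale0r addr0.
Qed.

Section OneModule.
Variable M : lmodType U.
Implicit Types v w : M.

Definition wv l v := gh *: v = sc l.1 v /\ gz *: v = sc l.2 v.

Lemma wvP l v : weight_vector l v <-> wv l v.
Proof.
split=> [lv|[hv zv] x].
  split; [have := lv (vec K ih)|have := lv (vec K iz)];
  rewrite unfold_in !coord_vec /weval !coord_vec /= !eqxx mulr1 mulr0;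
  by rewrite ?addr0 ?add0r; apply.
rewrite unfold_in => /and4P[/eqP xe /eqP xf /eqP xp /eqP xq].
rewrite ugenE scaler_suml.
rewrite (bigD1 ih) //= (bigD1 iz) //= big1 ?addr0.
  rewrite !scZ hv zv !scA -scDl scale1r /weval.
  by congr sc; ring.
by move=> i; elim/ord6P: i => // _; rewrite ?xe ?xf ?xp ?xq scale0r scale0r.
Qed.

Lemma wv0 l : wv l 0.
Proof. by split; rewrite scaler0 sc0. Qed.
Lemma wvD l v w : wv l v -> wv l w -> wv l (v + w).
Proof. by move=> [hv zv] [hw zw]; split; rewrite scalerDr scD ?hv ?hw ?zv ?zw. Qed.
Lemma wvZ l a v : wv l v -> wv l (sc a v).
Proof. by move=> [hv zv]; split; rewrite scU ?hv ?zv !scA mulrC. Qed.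
Lemma wv_gen l i v : wv l v -> wv (l + shift i) (gen K i *: v).
Proof.
move=> [hv zv]; split; last by rewrite scalerA gen_z -scalerA zv scU /= addr0.
by rewrite scalerA gen_h_comm scalerDl -scalerA hv scU scZ -scDl.
Qed.

(** A Lagrange interpolation factor inside U: it acts by 1 on weight l and by 0 on weight m, using h
    if it separates the two weights and z otherwise. The product [wproj] is the projector onto
    weight l among the weights of s. *)
Definition pfactor l m : U :=
  if m.1 != l.1 then (l.1 - m.1)^-1 *: (gh - m.1%:A)
  else (l.2 - m.2)^-1 *: (gz - m.2%:A).

Definition wproj s l : U := \prod_(m <- s | m != l) pfactor l m.

Definition pfactor_val l m k : K :=
  if m.1 != l.1 then (l.1 - m.1)^-1 * (k.1 - m.1)
  else (l.2 - m.2)^-1 * (k.2 - m.2).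

Lemma pfactorE l m k v : wv k v -> pfactor l m *: v = sc (pfactor_val l m k) v.
Proof.
move=> [hv zv]; rewrite /pfactor /pfactor_val.
by case: ifP => _; rewrite scZ scalerBl ?hv ?zv -scBl scA.
Qed.

Lemma wprojE s l k v : wv k v -> k \in s ->
  wproj s l *: v = if k == l then v else 0.
Proof.
move=> kv ks.
have -> : wproj s l *: v = sc (\prod_(m <- s | m != l) pfactor_val l m k) v.
  rewrite /wproj; elim: s {ks} => [|m s IHs]; first by rewrite !big_nil scale1r sc1.
  rewrite !big_cons; case: ifP => // _.
  by rewrite -scalerA IHs scU (pfactorE _ _ kv) scA mulrC.
case: eqVneq => [->|kl].
  rewrite big1 ?sc1 // => m; rewrite -pair_eqE /= negb_and /pfactor_val.
  case: eqVneq => /= [_|ml _]; last by rewrite mulVf // subr_eq0 eq_sym.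
  by move=> ml; rewrite mulVf // subr_eq0 eq_sym.
(* The factor for m = k vanishes on vectors of weight k. *)
rewrite (big_rem k) //= kl /pfactor_val !subrr !mulr0 if_same mul0r.
exact: sc0l.
Qed.

Lemma wproj_sum s l (w : weight -> M) : uniq s -> l \in s ->
  (forall k, wv k (w k)) -> wproj s l *: (\sum_(k <- s) w k) = w l.
Proof.
move=> us ls ww; rewrite scaler_sumr (bigD1_seq l) //= (wprojE _ (ww l)) // eqxx.
rewrite big_seq_cond big1 ?addr0 // => k /andP[ks kl].
by rewrite (wprojE _ (ww k)) // (negPf kl).
Qed.

Lemma wv_indep s (w : weight -> M) : uniq s -> (forall k, wv k (w k)) ->
  \sum_(k <- s) w k = 0 -> forall l, l \in s -> w l = 0.
Proof. by move=> us ww s0 l ls; rewrite -(wproj_sum us ls ww) s0 scaler0. Qed.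

Variable xi : set weight.

(** The set xi of allowed weights stays a parameter: it is later the whole coset, or the weights of
    a block. *)
Definition wsum v := exists s (w : weight -> M),
  [/\ uniq s, forall l, wv l (w l), forall l, l \in s -> xi l &
      v = \sum_(l <- s) w l].

Lemma wsum0 : wsum 0.
Proof. by exists [::], (fun=> 0); split=> // [l|]; [apply: wv0|rewrite big_nil]. Qed.

Lemma wsum_wv l v : xi l -> wv l v -> wsum v.
Proof.
move=> xl lv; exists [:: l], (fun m => if m == l then v else 0); split=> //.
- by move=> m; case: eqVneq => [->|_] //; apply: wv0.
- by move=> m; rewrite inE => /eqP->.
- by rewrite big_seq1 eqxx.
Qed.

Lemma wsumD v w : wsum v -> wsum w -> wsum (v + w).
Proof.
move=> [s [x [us xw xs ->]]] [t [y [ut yw yt ->]]].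
pose x' l := if l \in s then x l else 0; pose y' l := if l \in t then y l else 0.
exists (undup (s ++ t)), (fun l => x' l + y' l); split=> [||l|].
- exact: undup_uniq.
- by move=> l; rewrite /x' /y'; apply: wvD; case: ifP => _ //; apply: wv0.
- by rewrite mem_undup mem_cat => /orP[/xs|/yt].
rewrite big_split /=.
suff E (r : seq weight) (g : weight -> M) : uniq r -> {subset r <= undup (s ++ t)} ->
    \sum_(l <- undup (s ++ t)) (if l \in r then g l else 0) = \sum_(l <- r) g l.
  by rewrite !E // => l; rewrite mem_undup mem_cat => ->; rewrite ?orbT.
move=> ur rst; rewrite -big_mkcond -big_filter; apply: perm_big.
apply: uniq_perm => //; first by rewrite filter_uniq // undup_uniq.
by move=> l; rewrite mem_filter andb_idr //; apply: rst.
Qed.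

Lemma wsum_sum I (r : seq I) (F : I -> M) :
  (forall i, wsum (F i)) -> wsum (\sum_(i <- r) F i).
Proof. by move=> Fw; elim/big_ind: _ => //; [apply: wsum0|apply: wsumD]. Qed.

Lemma wsumZ a v : wsum v -> wsum (sc a v).
Proof.
move=> [s [w [us ww ws ->]]]; exists s, (fun l => sc a (w l)); split=> //.
  by move=> l; apply: wvZ.
by rewrite sc_sumr.
Qed.

(** If l did not occur in the sum, the projector onto l among l :: s would fix v and kill every
    summand. *)
Lemma wsum_wv_in v l : wsum v -> wv l v -> v != 0 -> xi l.
Proof.
move=> [s [w [us ww xs vE]]] lv v0.
have [/xs//|ls] := boolP (l \in s); case/eqP: v0.
have := wprojE l lv (mem_head l s); rewrite eqxx => <-.
rewrite vE scaler_sumr big_seq big1 // => k ks.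
rewrite (wprojE l (ww k)) ?inE ?ks ?orbT //; case: eqP => // kl.
by rewrite -kl ks in ls.
Qed.

Hypothesis xi_shift : forall l i, xi l -> xi (l + shift i).

Lemma wsum_gen i v : wsum v -> wsum (gen K i *: v).
Proof.
move=> [s [w [us ww ws ->]]]; rewrite scaler_sumr big_seq.
elim/big_ind: _ => [||l /ws xl]; [exact: wsum0|exact: wsumD|].
exact: (wsum_wv (xi_shift i xl) (wv_gen i (ww l))).
Qed.

Lemma wsum_sub : is_submodule wsum.
Proof. by apply: submodule_gen => *; [exact: wsum0|exact: wsumD|exact: wsumZ|exact: wsum_gen]. Qed.

Section Nilpotent.
Variable x : U.

Definition lnilp v := exists n, x ^+ n *: v = 0.

Lemma lnilp_le (n k : nat) v : (n <= k)%N -> x ^+ n *: v = 0 -> x ^+ k *: v = 0.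
Proof. by move=> /subnK <- xv; rewrite exprD -scalerA xv scaler0. Qed.

Lemma lnilp0 : lnilp 0. Proof. by exists 0%N; rewrite scaler0. Qed.

Lemma lnilpD v w : lnilp v -> lnilp w -> lnilp (v + w).
Proof.
move=> [n nv] [m mw]; exists (maxn n m).
by rewrite scalerDr (lnilp_le (leq_maxl _ _) nv) (lnilp_le (leq_maxr _ _) mw) addr0.
Qed.

Lemma lnilpZ a v : lnilp v -> lnilp (sc a v).
Proof. by move=> [n nv]; exists n; rewrite scU nv sc0. Qed.

(** Induction on the exponent that kills v: x y v = y (x v) + y' v, and x v is killed by one power
    less. *)
Lemma lnilp_comm (y y' : U) : x * y = y * x + y' ->
  (forall v, lnilp v -> lnilp (y' *: v)) -> forall v, lnilp v -> lnilp (y *: v).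
Proof.
move=> xy Hy' v [n]; elim: n v => [|n IHn] v; first by
  rewrite scale1r => ->; rewrite scaler0; apply: lnilp0.
rewrite exprSr -scalerA => nv.
have [m mv] : lnilp (x *: (y *: v)).
  rewrite scalerA xy scalerDl -scalerA; apply: lnilpD; first exact: IHn.
  by apply: Hy'; exists n.+1; rewrite exprSr -scalerA.
by exists m.+1; rewrite exprSr -scalerA.
Qed.

End Nilpotent.

(** The generators are treated in an order in which each bracket with e is 0 or a multiple of e or
    of a generator already treated: z, p, e, then h, then f since [e, f] = h, and q since [e, q] =
    p. *)
Lemma lnilp_e_sub : is_submodule (lnilp ge).
Proof.
have Nz v : lnilp ge v -> lnilp ge (gz *: v).
  apply: (@lnilp_comm _ _ 0) => [|w _]; first by rewrite gen_z addr0.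
  by rewrite scale0r; apply: lnilp0.
have Np v : lnilp ge v -> lnilp ge (gp *: v).
  apply: (@lnilp_comm _ _ 0) => [|w _]; first by rewrite gen_ep addr0.
  by rewrite scale0r; apply: lnilp0.
have Ne v : lnilp ge v -> lnilp ge (ge *: v).
  apply: (@lnilp_comm _ _ 0) => [|w _]; first by rewrite addr0.
  by rewrite scale0r; apply: lnilp0.
have Nh v : lnilp ge v -> lnilp ge (gh *: v).
  apply: (@lnilp_comm _ _ (- (2 *: ge))) => [|w nw]; first by rewrite gen_he addrK.
  by rewrite scaleNr scZ -scNl; apply: lnilpZ; apply: Ne.
have Nf v : lnilp ge v -> lnilp ge (gf *: v) by apply: (lnilp_comm (gen_ef K) Nh).
have Nq v : lnilp ge v -> lnilp ge (gq *: v) by apply: (lnilp_comm (gen_eqp K) Np).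
apply: submodule_gen => [||a v|i v]; [exact: lnilp0|exact: lnilpD|exact: lnilpZ|].
by elim/ord6P: i; auto.
Qed.

Lemma lnilp_p_sub : is_submodule (lnilp gp).
Proof.
have Nz v : lnilp gp v -> lnilp gp (gz *: v).
  apply: (@lnilp_comm _ _ 0) => [|w _]; first by rewrite gen_z addr0.
  by rewrite scale0r; apply: lnilp0.
have Ne v : lnilp gp v -> lnilp gp (ge *: v).
  apply: (@lnilp_comm _ _ 0) => [|w _]; first by rewrite gen_ep addr0.
  by rewrite scale0r; apply: lnilp0.
have Np v : lnilp gp v -> lnilp gp (gp *: v).
  apply: (@lnilp_comm _ _ 0) => [|w _]; first by rewrite addr0.
  by rewrite scale0r; apply: lnilp0.
have Nh v : lnilp gp v -> lnilp gp (gh *: v).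
  apply: (@lnilp_comm _ _ (- gp)) => [|w nw]; first by rewrite gen_hp addrK.
  by rewrite scaleNr -scaleN1r; apply: lnilpZ; apply: Np.
have Nq v : lnilp gp v -> lnilp gp (gq *: v) by apply: (lnilp_comm (gen_pq K) Nz).
have Nf v : lnilp gp v -> lnilp gp (gf *: v).
  apply: (@lnilp_comm _ _ (- gq)) => [|w nw]; first by rewrite gen_fp addrK.
  by rewrite scaleNr -scaleN1r; apply: lnilpZ; apply: Nq.
apply: submodule_gen => [||a v|i v]; [exact: lnilp0|exact: lnilpD|exact: lnilpZ|].
by elim/ord6P: i; auto.
Qed.

End OneModule.
End WeightVectors.

(** * Generated submodules and polynomial spans *)

Section Submodules.
Variables (A : pzRingType) (M : lmodType A).

(** The impredicative form serves as an induction principle: membership is applied to the submodule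
    of the vectors with the desired property. *)
Definition Ugen (T : set M) : set M :=
  [set v | forall N : set M, is_submodule N -> (T `<=` N)%classic -> N v]%classic.

Lemma Ugen_sub T : is_submodule (Ugen T).
Proof.
split=> [N [N0 _ _] _ //|v w Tv Tw N NS TN|a v Tv N NS TN].
  by case: (NS) => _ ND _; apply: ND; [apply: Tv|apply: Tw].
by case: (NS) => _ _ NZ; apply: NZ; apply: Tv.
Qed.

Lemma Ugen_in (T : set M) v : T v -> Ugen T v.
Proof. by move=> Tv N _; apply. Qed.

Lemma Ugen_min (T N : set M) : is_submodule N -> (T `<=` N)%classic ->
  (Ugen T `<=` N)%classic.
Proof. by move=> NS TN v; apply. Qed.

Lemma submodule_sum (N : set M) I (r : seq I) (P : pred I) (F : I -> M) :
  is_submodule N -> (forall i, P i -> N (F i)) -> N (\sum_(i <- r | P i) F i).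
Proof. by move=> [N0 ND _] NF; elim/big_ind: _. Qed.

Section SubmoduleType.
Variables (N : set M) (NS : is_submodule N).

Definition submod_pred of is_submodule N : {pred M} := fun v => `[< N v >].

Lemma submod_predP : submod_closed (submod_pred NS).
Proof.
case: NS => N0 ND NZ; split=> [|a v w]; first exact/asboolP.
by move=> /asboolP Nv /asboolP Nw; apply/asboolP; apply: ND => //; apply: NZ.
Qed.

HB.instance Definition _ :=
  GRing.isSubmodClosed.Build A M (submod_pred NS) submod_predP.

Record submod : Type :=
  Submod { submod_val :> M; _ : submod_val \in submod_pred NS }.

HB.instance Definition _ := [isSub for @submod_val].
HB.instance Definition _ := [Choice of submod by <:].
HB.instance Definition _ := [SubChoice_isSubLmodule of submod by <:].

Lemma submod_valP (x : submod) : N (val x).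
Proof. by apply/asboolP; apply: (valP x). Qed.

Definition submod_incl : {linear submod -> M} := val.

Lemma submod_lift v : N v -> exists x : submod, val x = v.
Proof. by move=> Nv; exists (Submod (asboolT Nv)). Qed.

End SubmoduleType.

Lemma preim_sub (Q : lmodType A) (g : {linear Q -> M}) (N : set M) :
  is_submodule N -> is_submodule [set x | N (g x)]%classic.
Proof.
case=> N0 ND NZ; split=> [|x y Nx Ny|a x Nx] /=; first by rewrite linear0.
  by rewrite linearD; apply: ND.
by rewrite linearZ; apply: NZ.
Qed.

Lemma zero_sub : is_submodule [set (0 : M)]%classic.
Proof. by split=> // [x y -> ->|a x ->]; rewrite ?addr0 ?scaler0. Qed.

(** Polynomials in x with coefficients in T. Used with x = F and then with x = q, this gives the
    sums of the q^b F^a t, the shape of the submodule generated by singular vectors. *)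
Definition spanP (x : A) (T : set M) : set M := [set v |
  exists n (t : nat -> M), (forall i, T (t i)) /\ v = \sum_(i < n) x ^+ i *: t i]%classic.

Section SpanP.
Variables (x : A) (T : set M).
Hypotheses (T0 : T 0) (TD : forall v w, T v -> T w -> T (v + w)).
Local Notation S := (spanP x T).

Lemma spanP_in v : T v -> S v.
Proof.
by move=> Tv; exists 1%N, (fun=> v); split=> //; rewrite big_ord1 expr0 scale1r.
Qed.

Lemma spanP0 : S 0. Proof. exact: spanP_in. Qed.

Lemma spanPD v w : S v -> S w -> S (v + w).
Proof.
move=> [n [t [Tt ->]]] [m [u [Tu ->]]].
pose cut k (a : nat -> M) i := if (i < k)%N then a i else 0.
have cutE k a N : (k <= N)%N ->
    \sum_(i < k) x ^+ i *: a (nat_of_ord i)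
      = \sum_(i < N) x ^+ i *: cut k a (nat_of_ord i).
  move=> kN; rewrite (big_ord_widen N (fun i => x ^+ i *: a i)) // big_mkcond.
  by apply: eq_bigr => i _; rewrite /cut; case: ifP => // _; rewrite scaler0.
exists (n + m)%N, (fun i => cut n t i + cut m u i); split.
  by move=> i; apply: TD; rewrite /cut; case: ifP.
rewrite (cutE _ _ (n + m)%N) ?leq_addr // (cutE m _ (n + m)%N) ?leq_addl //.
by rewrite -big_split /=; apply: eq_bigr => i _; rewrite scalerDr.
Qed.

Lemma spanP_x v : S v -> S (x *: v).
Proof.
move=> [n [t [Tt ->]]]; exists n.+1, (fun i => if i is k.+1 then t k else 0).
split=> [[]//|]; rewrite big_ord_recl scaler0 add0r scaler_sumr.
by apply: eq_bigr => i _; rewrite exprS -scalerA.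
Qed.

(** Induction on the exponent of x: when y is moved past one x, it is already known to send the
    shorter monomial into the span. *)
Lemma spanP_closed (y : A) : (forall t, T t -> S (y *: t)) ->
  (forall v, S v -> S (y *: v) -> S (y *: (x *: v))) -> forall v, S v -> S (y *: v).
Proof.
move=> yT yx v [n [t [Tt ->]]]; rewrite scaler_sumr.
elim/big_ind: _ => [||i _]; [exact: spanP0|exact: spanPD|].
suff [] : S (x ^+ i *: t i) /\ S (y *: (x ^+ i *: t i)) by [].
elim: (nat_of_ord i) (t i) (Tt i) => [|k IHk] u Tu.
  by rewrite expr0 scale1r; split; [apply: spanP_in|apply: yT].
have [Su ySu] := IHk _ Tu; rewrite exprS -scalerA.
by split; [apply: spanP_x|apply: yx].
Qed.

(* Applying y^n to an element of degree n in x isolates its top coefficient. *)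
Lemma spanP_ker (y : A) :
  (forall n t, T t -> y ^+ n.+1 *: (x ^+ n *: t) = 0) ->
  (forall n t, T t -> y ^+ n *: (x ^+ n *: t) = 0 -> t = 0) ->
  forall v, S v -> y *: v = 0 -> T v.
Proof.
move=> yx0 yxI v [n [t [Tt ->]]].
elim: n => [|[|n] IHn]; first by rewrite big_ord0.
  by rewrite big_ord1 expr0 scale1r.
rewrite big_ord_recr /= => yv.
suff t0 : t n.+1 = 0 by move: yv; rewrite t0 scaler0 addr0.
apply: (yxI n.+1) => //.
have := congr1 (fun w => y ^+ n *: w) yv.
rewrite scaler0 scalerA -exprSr scalerDr scaler_sumr big1 ?add0r // => i _.
have -> : y ^+ n.+1 = y ^+ (n - i) * y ^+ i.+1.
  by rewrite -exprD addnS subnK // -ltnS.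
by rewrite -scalerA yx0 // scaler0.
Qed.

End SpanP.
End Submodules.
Arguments submod_incl {A M N} NS.

(** * Integrality of weights, good modules and the element F *)

Section GoodModules.
Variables (K : fieldType).
Local Notation U := (Defs.U K).
Local Notation weight := (weight K).
Hypothesis charK : [pchar K] =i pred0.

Lemma nat_neq0 n : n.+1%:R != 0 :> K.
Proof. by rewrite ((pcharf0P K).1 charK). Qed.

Lemma int_inj (m n : int) : m%:~R = n%:~R :> K -> m = n.
Proof.
move/eqP; rewrite -subr_eq0 -intrB => /eqP mn; apply/eqP; rewrite -subr_eq0.
case: (m - n) mn => [[|k]|k] //=; first by move/eqP; rewrite (negPf (nat_neq0 k)).
by rewrite NegzE mulrNz => /eqP; rewrite oppr_eq0 (negPf (nat_neq0 k)).
Qed.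

(** Doubling would make the odd integer 2n + 1 vanish in characteristic 0. This is where the
    integrality of lambda(h) acts. *)
Lemma half_int (n : int) : n%:~R + 1 / 2 != 0 :> K.
Proof.
apply/eqP => n0; have : (n * 2 + 1)%:~R = 0%:~R :> K.
  have two0 : (2 : K) != 0 by apply: (nat_neq0 1).
  rewrite intrD intrM -[RHS](mulr0 2) -[X in 2 * X]n0 /=; field.
  exact: two0.
by move/int_inj; lia.
Qed.

Variable c : K.
Hypothesis c0 : c != 0.

Definition wt (n : int) : weight := (n%:~R, c).
Definition xi0 : set weight := [set l | exists n, l = wt n]%classic.

Lemma xi0_shift l i : xi0 l -> xi0 (l + shift K i).
Proof.
move=> [n ->]; rewrite /wt /shift /xi0 /=.
exists (n + nth 0 [:: 2; 0; - 2; 1; - 1; 0] i)%R.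
rewrite /wt intrD -[LHS]/(_ + _, _ + _) /= addr0; congr (_ + _, _).
by elim/ord6P: i.
Qed.

Definition uF : U := gf + (2 * c)^-1 *: (gq * gq).

Section OneModule.
Variable M : lmodType U.
Implicit Types v w t : M.

Definition sing v := ge *: v = 0 /\ gp *: v = 0.

Lemma sing0 : sing 0. Proof. by split; rewrite scaler0. Qed.
Lemma singD v w : sing v -> sing w -> sing (v + w).
Proof. by move=> [ev pv] [ew pw]; split; rewrite scalerDr ?ev ?pv ?ew ?pw addr0. Qed.
Lemma singZ a v : sing v -> sing (sc a v).
Proof. by move=> [ev pv]; split; rewrite scU ?ev ?pv sc0. Qed.
Lemma sing_h v : sing v -> sing (gh *: v).
Proof.
move=> [ev pv]; split; rewrite scalerA.
  have -> : ge * gh = gh * ge - 2 *: ge :> U by rewrite gen_he addrK.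
  by rewrite scalerBl -scalerA scZ ev scaler0 sc0 subr0.
have -> : gp * gh = gh * gp - gp :> U by rewrite gen_hp addrK.
by rewrite scalerBl -scalerA pv scaler0 subr0.
Qed.

Definition swv v := sing v /\ exists2 l, xi0 l & wv l v.

Definition good := [/\ forall v, wsum xi0 v, forall v, lnilp ge v & forall v, lnilp gp v].

(** Each of the three conditions cuts out a submodule, so it can be tested on generators. *)
Lemma good_of_gen : (forall v, Ugen swv v) -> good.
Proof.
move=> gM; split=> v; apply: (gM v).
- exact: wsum_sub xi0_shift.
- by move=> t [_ [l xl lt]]; apply: wsum_wv lt.
- exact: lnilp_e_sub.
- by move=> t [[et pt] _]; exists 1%N; rewrite expr1.
- exact: lnilp_p_sub.
- by move=> t [[et pt] _]; exists 1%N; rewrite expr1.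
Qed.

Hypothesis Hz : forall v, gz *: v = sc c v.

Lemma uFE v : uF *: v = gf *: v + sc (2 * c)^-1 (gq *: (gq *: v)).
Proof. by rewrite /uF scalerDl scZ -scalerA. Qed.

Lemma pq v : gp *: (gq *: v) = gq *: (gp *: v) + sc c v.
Proof. by rewrite scalerA gen_pq scalerDl -scalerA Hz. Qed.

Lemma qF v : gq *: (uF *: v) = uF *: (gq *: v).
Proof.
rewrite !scalerA; congr (_ *: _); rewrite /uF [RHS]mulrDl [LHS]mulrDr gen_fq.
by rewrite -scalerAl -scalerAr mulrA.
Qed.

(** The bracket [p, f] = -q cancels against (2c)^-1 [p, q^2] = q; this fixes the constant in F. *)
Lemma pF v : gp *: (uF *: v) = uF *: (gp *: v).
Proof.
have two0 : (2 : K) != 0 by apply: (nat_neq0 1).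
have pf w : gp *: (gf *: w) = gf *: (gp *: w) - gq *: w.
  have : gp * gf = gf * gp - gq :> U by rewrite gen_fp addrK.
  by rewrite scalerA => ->; rewrite scalerBl -scalerA.
rewrite !uFE scalerDr scU pf !pq scalerDr scU.
rewrite -addrA; congr (_ + _); rewrite -addrA !scD !scA -scDl.
have -> : (2 * c)^-1 * c + (2 * c)^-1 * c = 1 by field; rewrite two0 c0.
by rewrite sc1 addrCA addNr addr0.
Qed.

End OneModule.
End GoodModules.

(** * Singular vectors *)

Section Structure.
Variables (K : fieldType).
Local Notation U := (Defs.U K).
Local Notation weight := (weight K).
Hypothesis charK : [pchar K] =i pred0.
Variable c : K.
Hypothesis c0 : c != 0.
Local Notation uF := (uF c).
Local Notation xi0 := (xi0 c).

Section OneModule.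
Variable M : lmodType U.
Implicit Types v w t s : M.

Lemma sc2 v : sc 2 v = v + v.
Proof. by rewrite scDl sc1. Qed.

Lemma wsum_z v : wsum xi0 v -> gz *: v = sc c v.
Proof.
move=> [s [w [_ ww xs ->]]]; rewrite scaler_sumr sc_sumr big_seq [RHS]big_seq.
by apply: eq_bigr => l /xs [n ln]; case: (ww l) => _ ->; rewrite ln.
Qed.

Lemma good_z : good c M -> forall v, gz *: v = sc c v.
Proof. by case=> gM _ _ v; apply: wsum_z. Qed.

Hypothesis Hz : forall v, gz *: v = sc c v.

(** The shift by 1/2 comes from [e, q^2] = 2 q p + z, which acts by c on ker p and enters with the
    factor (2c)^-1. *)
Lemma eF v : gp *: v = 0 -> ge *: (uF *: v) = uF *: (ge *: v) + (gh *: v + sc (1 / 2) v).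
Proof.
move=> pv; have two0 : (2 : K) != 0 by apply: (nat_neq0 charK 1).
have ef w : ge *: (gf *: w) = gf *: (ge *: w) + gh *: w.
  by rewrite scalerA gen_ef scalerDl -scalerA.
have eq w : ge *: (gq *: w) = gq *: (ge *: w) + gp *: w.
  by rewrite scalerA gen_eqp scalerDl -scalerA.
rewrite !uFE scalerDr scU ef !eq scalerDr (pq Hz) pv scaler0 addr0 add0r.
rewrite -!addrA; congr (_ + _); rewrite scD scA addrCA; congr (_ + (_ + sc _ _)).
by field; rewrite two0 c0.
Qed.

Lemma hF v : gh *: (uF *: v) = uF *: (gh *: v) - sc 2 (uF *: v).
Proof.
have hf w : gh *: (gf *: w) = gf *: (gh *: w) - sc 2 (gf *: w).
  by rewrite scalerA gen_hf scalerBl scZ -scalerA.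
have hq w : gh *: (gq *: w) = gq *: (gh *: w) - gq *: w.
  by rewrite scalerA gen_hq scalerBl -scalerA.
rewrite !uFE scalerDr scU hf !hq scalerBr scD !scB.
rewrite scN [sc 2 (_ + sc _ _)]scD [sc 2 (sc _ _)]sc2 -!addrA !opprD.
by rewrite (addrCA (- sc 2 _)).
Qed.

Lemma gp_kerF v : gp *: v = 0 -> gp *: (uF *: v) = 0.
Proof. by rewrite (pF charK c0 Hz) => ->; rewrite scaler0. Qed.

Lemma gp_kerFn n v : gp *: v = 0 -> gp *: (uF ^+ n *: v) = 0.
Proof.
elim: n => [|n IHn] pv; first by rewrite scale1r.
by rewrite exprS -scalerA; apply: gp_kerF; apply: IHn.
Qed.

Lemma p_qn n s : gp *: s = 0 ->
  gp *: (gq ^+ n.+1 *: s) = sc (n.+1%:R * c) (gq ^+ n *: s).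
Proof.
move=> ps; elim: n => [|n IHn].
  by rewrite expr1 (pq Hz) ps scaler0 add0r scale1r mul1r.
rewrite exprS -scalerA (pq Hz) IHn scU scalerA -exprS -scDl.
by congr sc; rewrite -[n.+2%:R]natr1; ring.
Qed.

Lemma pn_qn n s : gp *: s = 0 -> gp ^+ n *: (gq ^+ n *: s) = sc (n`!%:R * c ^+ n) s.
Proof.
move=> ps; elim: n => [|n IHn]; first by rewrite !scale1r mul1r sc1.
rewrite exprSr -scalerA p_qn // scU IHn scA; congr sc.
by rewrite factS natrM exprS; ring.
Qed.

Lemma pn_qn_neq0 n : n`!%:R * c ^+ n != 0.
Proof.
rewrite mulf_neq0 ?expf_neq0 //; case: n`! (fact_gt0 n) => // k _.
exact: (nat_neq0 charK).
Qed.

Lemma pSn_qn n s : gp *: s = 0 -> gp ^+ n.+1 *: (gq ^+ n *: s) = 0.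
Proof. by move=> ps; rewrite exprS -scalerA pn_qn // scU ps sc0. Qed.

(** The sl_2 coefficient (n + 1) (mu - n) with mu = h + 1/2, kept as an element of U because a
    singular vector need not be an eigenvector of h. *)
Definition eDf (n : nat) : U := n.+1%:R *: (gh + (1 / 2 - n%:R)%:A).

Fixpoint eD n : U := if n is m.+1 then eD m * eDf m else 1.

Lemma h_Fn n t : gh *: (uF ^+ n *: t) = uF ^+ n *: (gh *: t) - sc (2 * n%:R) (uF ^+ n *: t).
Proof.
elim: n => [|n IHn]; first by rewrite !scale1r mulr0 sc0l subr0.
rewrite exprS -scalerA hF IHn scalerBr scU !scalerA -!exprS -addrA -opprD -scDl.
congr (_ - sc _ _); first by rewrite exprS mulrA.
by rewrite -natr1; ring.
Qed.

Lemma eDfE n v : eDf n *: v = sc n.+1%:R (gh *: v + sc (1 / 2 - n%:R) v).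
Proof. by rewrite /eDf scZ (scalerDl v gh). Qed.

Lemma sing_eDf n t : sing t -> sing (eDf n *: t).
Proof.
move=> st; rewrite eDfE; apply: singZ; apply: singD; first exact: sing_h.
exact: singZ.
Qed.

Lemma e_Fn n t : sing t -> ge *: (uF ^+ n.+1 *: t) = uF ^+ n *: (eDf n *: t).
Proof.
move=> [et pt]; elim: n => [|n IHn].
  rewrite expr1 eF // et scaler0 add0r scale1r eDfE sc1; congr (_ + sc _ _).
  by rewrite subr0.
rewrite exprS -scalerA eF ?gp_kerFn // IHn scalerA -exprS h_Fn -addrA -scNl -scDl.
rewrite -scU -!scalerDr !eDfE; congr (_ *: _).
rewrite !scD !scA addrACA -[in X in _ + X + _](sc1 (gh *: t)) -!scDl.
congr (sc _ _ + sc _ _); first exact: natr1.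
by rewrite -[n.+2%:R]natr1 -[n.+1%:R]natr1; field; apply: (nat_neq0 charK 1).
Qed.

Lemma en_Fn n t : sing t -> ge ^+ n *: (uF ^+ n *: t) = eD n *: t.
Proof.
elim: n t => [|n IHn] t st; first by rewrite !scale1r.
by rewrite exprSr -scalerA e_Fn // IHn ?scalerA //; apply: sing_eDf.
Qed.

Lemma sing_eD n t : sing t -> sing (eD n *: t).
Proof.
elim: n t => [|n IHn] t st /=; first by rewrite scale1r.
by rewrite -scalerA; apply: IHn; apply: sing_eDf.
Qed.

Lemma eSn_Fn n t : sing t -> ge ^+ n.+1 *: (uF ^+ n *: t) = 0.
Proof.
by move=> st; rewrite exprS -scalerA en_Fn //; case: (sing_eD n st).
Qed.

Definition eDval (l : weight) n : K := \prod_(i < n) (i.+1%:R * (l.1 + (1 / 2 - i%:R))).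

Lemma eD_wv l t n : wv l t -> eD n *: t = sc (eDval l n) t.
Proof.
move=> lt; elim: n => [|n IHn]; first by rewrite /eDval big_ord0 scale1r sc1.
rewrite /= -scalerA eDfE (lt.1) -scDl scA scU IHn scA /eDval big_ord_recr /=.
by rewrite mulrC.
Qed.

Lemma eDval_neq0 l n : xi0 l -> eDval l n != 0.
Proof.
move=> [k ->]; rewrite prodf_seq_neq0; apply/allP => i _ /=.
rewrite mulf_neq0 ?(nat_neq0 charK) //=.
have -> : k%:~R + (1 / 2 - i%:R) = (k - i%:Z)%:~R + 1 / 2 :> K.
  by rewrite intrB; ring.
exact: (half_int charK).
Qed.

(** Being a polynomial in h, [eD n] acts on each weight component by a scalar, which is nonzero, and
    components of distinct weights cannot cancel. *)
Lemma eD_inj n t : wsum xi0 t -> eD n *: t = 0 -> t = 0.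
Proof.
move=> [s [w [us ww xs ->]]]; rewrite scaler_sumr.
under eq_bigr => l _ do rewrite (eD_wv n (ww l)).
move=> s0; rewrite big_seq big1 // => l ls.
apply: (sc_eq0 (eDval_neq0 n (xs l ls))).
by apply: (wv_indep us _ s0 ls) => k; apply: wvZ.
Qed.

End OneModule.
End Structure.

(** * Singular vectors generate, and are controlled in generated submodules *)

Section Semisimple.
Variables (K : fieldType).
Local Notation U := (Defs.U K).
Local Notation weight := (weight K).
Hypothesis charK : [pchar K] =i pred0.
Variable c : K.
Hypothesis c0 : c != 0.
Local Notation uF := (uF c).
Local Notation xi0 := (xi0 c).
Local Notation swv := (@swv K c _).
Local Notation wt := (wt c).
Local Notation good := (good c).

Section OneModule.
Variable M : lmodType U.
Implicit Types v w t s : M.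

Section CentralCharge.
Hypothesis Hz : forall v, gz *: v = sc c v.

Lemma wv_wt k v : wv (wt k) v <-> gh *: v = sc k%:~R v.
Proof. by split=> [[]|]. Qed.

Lemma h_en k n v : gh *: v = sc k%:~R v ->
  gh *: (ge ^+ n *: v) = sc (k + 2 * n%:Z)%:~R (ge ^+ n *: v).
Proof.
move=> hv; elim: n => [|n IHn]; first by rewrite scale1r mulr0 addr0.
rewrite exprS -scalerA scalerA gen_he scalerDl -scalerA IHn scU scZ -scDl.
by congr sc; rewrite !intrD !intrM -[n.+1]addn1 PoszD intrD /=; ring.
Qed.

Lemma h_pn k n v : gh *: v = sc k%:~R v ->
  gh *: (gp ^+ n *: v) = sc (k + n%:Z)%:~R (gp ^+ n *: v).
Proof.
move=> hv; elim: n => [|n IHn]; first by rewrite scale1r addr0.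
rewrite exprS -scalerA scalerA gen_hp scalerDl -scalerA IHn scU -[X in _ + X]sc1 -scDl.
by congr sc; rewrite !intrD -[n.+1]addn1 PoszD intrD /=; ring.
Qed.

Lemma h_qn k n v : gh *: v = sc k%:~R v ->
  gh *: (gq ^+ n *: v) = sc (k - n%:Z)%:~R (gq ^+ n *: v).
Proof.
move=> hv; elim: n => [|n IHn]; first by rewrite scale1r subr0.
rewrite exprS -scalerA scalerA gen_hq scalerBl -scalerA IHn scU -[X in _ - X]sc1 -scBl.
by congr sc; rewrite !intrB -[n.+1]addn1 PoszD intrD /=; ring.
Qed.

Lemma h_Fn_wt k n v : gh *: v = sc k%:~R v ->
  gh *: (uF ^+ n *: v) = sc (k - 2 * n%:Z)%:~R (uF ^+ n *: v).
Proof.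
move=> hv; rewrite h_Fn hv scU -scBl; congr sc.
by rewrite intrB intrM.
Qed.

Lemma p_en n v : gp *: (ge ^+ n *: v) = ge ^+ n *: (gp *: v).
Proof.
elim: n => [|n IHn]; first by rewrite !scale1r.
by rewrite exprS -!scalerA -IHn scalerA -gen_ep -scalerA.
Qed.

(** Descent on the power of e that kills s. If e^(n+1) s = 0 then t = e^n s is singular and e^n F^n
    acts on it by a nonzero scalar a; so s - a^-1 F^n t is killed by e^n, while F^n t lies in the
    generated submodule. *)
Lemma kerp_gen n s k : gh *: s = sc k%:~R s -> gp *: s = 0 -> ge ^+ n *: s = 0 ->
  Ugen swv s.
Proof.
have [G0 GD GZ] := Ugen_sub (swv : set M).
elim: n s k => [|n IHn] s k hs ps; first by rewrite scale1r => ->.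
move=> es; pose t := ge ^+ n *: s.
have ht := h_en n hs; rewrite -/t in ht.
have st : sing t.
  by split; rewrite /t ?p_en ?ps ?scaler0 // scalerA -exprS.
have xt : xi0 (wt (k + 2 * n%:Z)) by eexists.
have Gt : Ugen swv t.
  by apply: Ugen_in; split=> //; exists (wt (k + 2 * n%:Z)) => //; apply/wv_wt.
pose a := eDval (wt (k + 2 * n%:Z)) n.
have a0 : a != 0 by apply: (eDval_neq0 charK _ xt).
rewrite -(subrK (sc a^-1 (uF ^+ n *: t)) s); apply: GD; last exact: (GZ _ _ (GZ _ _ Gt)).
apply: (IHn _ k).
- rewrite scalerBr hs scU (h_Fn_wt n ht) scB !scA mulrC; congr (_ - sc (_ * _) _).
  by congr (_%:~R); ring.
- by rewrite scalerBr ps scU (gp_kerFn charK c0 Hz) ?scaler0 ?sc0 ?subr0 //; case: st.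
- rewrite scalerBr scU (en_Fn charK c0 Hz) //.
  by rewrite (@eD_wv _ _ (wt (k + 2 * n%:Z))) ?scA ?mulVf // ?sc1 ?subrr //; apply/wv_wt.
Qed.

(** The same descent with p and q: t = p^n v lies in ker p, where the previous lemma applies, and
    p^n q^n acts on it by n! c^n. *)
Lemma wv_gen_nil n v k : (forall v, lnilp ge v) -> gh *: v = sc k%:~R v ->
  gp ^+ n *: v = 0 -> Ugen swv v.
Proof.
move=> en; have [G0 GD GZ] := Ugen_sub (swv : set M).
elim: n v k => [|n IHn] v k hv; first by rewrite scale1r => ->.
move=> pv; pose t := gp ^+ n *: v.
have ht := h_pn n hv; rewrite -/t in ht.
have pt : gp *: t = 0 by rewrite scalerA -exprS.
have Gt : Ugen swv t by have [m mt] := en t; apply: (kerp_gen ht pt mt).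
have a0 := pn_qn_neq0 charK c0 n; set a := _ * _ in a0.
rewrite -(subrK (sc a^-1 (gq ^+ n *: t)) v); apply: GD; last exact: (GZ _ _ (GZ _ _ Gt)).
apply: (IHn _ k).
- rewrite scalerBr hv scU (h_qn n ht) scB !scA mulrC; congr (_ - sc (_ * _) _).
  by congr (_%:~R); ring.
- by rewrite scalerBr scU (pn_qn Hz) // scA mulVf // sc1 subrr.
Qed.

End CentralCharge.

Lemma good_gen : good M -> forall v, Ugen swv v.
Proof.
move=> gM; have Hz := good_z gM; case: gM => gw ge_nil gp_nil v.
have [s [w [_ ww xs ->]]] := gw v; rewrite big_seq.
apply: submodule_sum (Ugen_sub _) _ => l /xs [k lk].
have [n nw] := gp_nil (w l).
by apply: (wv_gen_nil Hz ge_nil _ nw (k := k)); have := ww l; rewrite lk => -[].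
Qed.

Section GeneratedBySingular.
Variable T : set M.
Hypothesis gM : good M.
Hypotheses (T0 : T 0) (TD : forall v w, T v -> T w -> T (v + w)).
Hypotheses (TZ : forall a v, T v -> T (sc a v)) (Th : forall v, T v -> T (gh *: v)).
Hypothesis Ts : forall v, T v -> sing v.
Let Hz := good_z gM.
(** Y = K[F] T lies in ker p and is stable under h and e; W = K[q] Y is then stable under all of U,
    f being recovered from F and q^2. *)
Local Notation Y := (spanP uF T).
Local Notation W := (spanP gq Y).

Let Y0 : Y 0. Proof. exact: spanP0. Qed.
Let YD v w : Y v -> Y w -> Y (v + w). Proof. exact: spanPD. Qed.
Let YZ a v : Y v -> Y (sc a v).
Proof.
apply: (spanP_closed T0 TD) => [t Tt|w _ Yw].
  by apply: spanP_in => //; apply: TZ.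
by rewrite -[X in Y X]/(sc a _) -scU; apply: spanP_x.
Qed.
Let Yp v : Y v -> gp *: v = 0.
Proof.
move=> [n [t [Tt ->]]]; rewrite scaler_sumr big1 // => i _.
by apply: (gp_kerFn charK c0 Hz); case: (Ts (Tt i)).
Qed.
Let Yh v : Y v -> Y (gh *: v).
Proof.
apply: (spanP_closed T0 TD) => [t Tt|w Yw Yhw].
  by apply: spanP_in => //; apply: Th.
rewrite hF -scNl; apply: YD; first exact: spanP_x.
by apply: YZ; apply: spanP_x.
Qed.
Let Ye v : Y v -> Y (ge *: v).
Proof.
apply: (spanP_closed T0 TD) => [t /Ts [-> _] //|w Yw Yew].
rewrite (eF charK c0 Hz) ?Yp //; apply: YD; first exact: spanP_x.
by apply: YD; [apply: Yh|apply: YZ].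
Qed.

Let W0 : W 0. Proof. exact: spanP0. Qed.
Let WD v w : W v -> W w -> W (v + w). Proof. exact: spanPD. Qed.
Let WY v : Y v -> W v. Proof. exact: spanP_in. Qed.
Let Wq v : W v -> W (gq *: v). Proof. exact: spanP_x. Qed.
Let WZ a v : W v -> W (sc a v).
Proof.
apply: (spanP_closed Y0 YD) => [t Yt|w _ Ww]; first by apply: WY; apply: YZ.
by rewrite -[X in W X]/(sc a _) -scU; apply: Wq.
Qed.
Let Wp v : W v -> W (gp *: v).
Proof.
apply: (spanP_closed Y0 YD) => [t /Yp -> //|w Ww Wpw].
by rewrite (pq Hz); apply: WD; [apply: Wq|apply: WZ].
Qed.
Let Wh v : W v -> W (gh *: v).
Proof.
apply: (spanP_closed Y0 YD) => [t Yt|w Ww Whw]; first by apply: WY; apply: Yh.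
rewrite scalerA gen_hq scalerBl -scalerA -scaleN1r; apply: WD; first exact: Wq.
by rewrite -scaleN1r; apply: WZ; apply: Wq.
Qed.
Let We v : W v -> W (ge *: v).
Proof.
apply: (spanP_closed Y0 YD) => [t Yt|w Ww Whw]; first by apply: WY; apply: Ye.
by rewrite scalerA gen_eqp scalerDl -scalerA; apply: WD; [apply: Wq|apply: Wp].
Qed.
Let WF v : W v -> W (uF *: v).
Proof.
apply: (spanP_closed Y0 YD) => [t Yt|w Ww Whw]; first by apply: WY; apply: spanP_x.
by rewrite -qF; apply: Wq.
Qed.

Lemma span_sub : is_submodule W.
Proof.
apply: submodule_gen => [||a v|i v Wv]; [exact: W0|exact: WD|exact: WZ|].
elim/ord6P: i; [exact: We|exact: Wh| |exact: Wp|exact: Wq|by rewrite Hz; apply: WZ].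
have -> : gf *: v = uF *: v + sc (- (2 * c)^-1) (gq *: (gq *: v)).
  by rewrite uFE scNl addrK.
by apply: WD; [apply: WF|apply/WZ/Wq/Wq].
Qed.

(* The singular vectors of the submodule generated by T all lie in T: p and e
   lower the degrees in q and F by one with nonvanishing coefficients, because
   1/2 is not an integer. *)
Lemma sing_gen v : Ugen T v -> sing v -> T v.
Proof.
move=> Tv [ev pv].
have Wv : W v by apply: Tv; [exact: span_sub|move=> t Tt; apply: WY; apply: spanP_in].
have Yv : Y v.
  apply: (spanP_ker Y0 _ _ Wv pv) => n t Yt; first by rewrite (pSn_qn Hz) ?Yp.
  rewrite (pn_qn Hz) ?Yp //; apply: sc_eq0; exact: pn_qn_neq0.
apply: (spanP_ker T0 _ _ Yv ev) => n t Tt; first by rewrite (eSn_Fn charK c0 Hz) //; apply: Ts.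
rewrite (en_Fn charK c0 Hz); last exact: Ts.
by apply: (eD_inj charK); case: gM => gw _ _; apply: gw.
Qed.

End GeneratedBySingular.
End OneModule.
End Semisimple.

(** * Category O *)

Section LinearMaps.
Variables (K : fieldType).
Local Notation U := (Defs.U K).
Variables (M N : lmodType U) (g : {linear M -> N}).

Lemma linear_sc a v : g (sc a v) = sc a (g v).
Proof. exact: linearZ. Qed.

Lemma wv_lin l v : wv l v -> wv l (g v).
Proof. by move=> [hv zv]; split; rewrite -linearZ ?hv ?zv linear_sc. Qed.

Lemma sing_lin v : sing v -> sing (g v).
Proof. by move=> [ev pv]; split; rewrite -linearZ ?ev ?pv linear0. Qed.

Lemma swv_lin c v : swv c v -> swv c (g v).
Proof. by move=> [sv [l xl lv]]; split; [apply: sing_lin|exists l => //; apply: wv_lin]. Qed.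

Lemma wsum_lin xi v : wsum xi v -> wsum xi (g v).
Proof.
move=> [s [w [us ww xs ->]]]; exists s, (fun l => g (w l)); split=> //.
  by move=> l; apply: wv_lin.
by rewrite linear_sum.
Qed.

Hypothesis gI : injective g.

Lemma wv_lin_inj l v : wv l (g v) -> wv l v.
Proof. by move=> [hv zv]; split; apply: gI; rewrite linearZ linear_sc /= ?hv ?zv. Qed.

Lemma sing_lin_inj v : sing (g v) -> sing v.
Proof. by move=> [ev pv]; split; apply: gI; rewrite linearZ /= ?ev ?pv linear0. Qed.

Lemma lnilp_lin_inj x v : lnilp x (g v) -> lnilp x v.
Proof. by move=> [n nv]; exists n; apply: gI; rewrite linearZ /= nv linear0. Qed.

(** The weight components of g v are obtained from it by projectors in U, hence are images of the
    same projectors applied to v. *)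
Lemma wsum_lin_inj xi v : wsum xi (g v) -> wsum xi v.
Proof.
move=> [s [w [us ww xs gv]]].
have wE l : l \in s -> g (wproj s l *: v) = w l.
  by move=> ls; rewrite linearZ /= gv (wproj_sum us ls ww).
exists s, (fun l => if l \in s then wproj s l *: v else 0); split=> // [l|].
  case: ifP => ls; last exact: wv0.
  by apply: wv_lin_inj; rewrite wE.
apply: gI; rewrite gv linear_sum big_seq [RHS]big_seq.
by apply: eq_bigr => l ls; rewrite ls wE.
Qed.

Lemma good_inj c : good c N -> good c M.
Proof.
by move=> [Nw Ne Np]; split=> v; [apply: wsum_lin_inj|apply: lnilp_lin_inj|apply: lnilp_lin_inj].
Qed.

End LinearMaps.

(** * Finite-dimensional spaces of singular vectors and finite generation *)

Section FiniteSpans.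
Variables (K : fieldType).
Local Notation U := (Defs.U K).
Variable M : lmodType U.

(** The K-span, in a recursive form that lets an induction on the list split off one generator. *)
Fixpoint kspan (ts : seq M) (v : M) : Prop :=
  if ts is t :: ts' then exists a : K, kspan ts' (v - sc a t) else v = 0.

Lemma kspan0 ts : kspan ts 0.
Proof. by elim: ts => //= t ts IH; exists 0; rewrite sc0l subr0. Qed.

Lemma kspanD ts v w : kspan ts v -> kspan ts w -> kspan ts (v + w).
Proof.
elim: ts v w => [|t ts IH] v w /=; first by move=> -> ->; rewrite addr0.
by move=> [a va] [b wb]; exists (a + b); rewrite scDl opprD addrACA; apply: IH.
Qed.

Lemma kspanZ ts a v : kspan ts v -> kspan ts (sc a v).
Proof.
elim: ts v => [|t ts IH] v /=; first by move=> ->; rewrite sc0.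
by move=> [b vb]; exists (a * b); rewrite -scA -scB; apply: IH.
Qed.

Lemma kspan_in ts t : t \in ts -> kspan ts t.
Proof.
elim: ts => //= u ts IH; rewrite inE => /orP[/eqP->|/IH tts].
  by exists 1; rewrite sc1 subrr; apply: kspan0.
by exists 0; rewrite sc0l subr0.
Qed.

Lemma kspan_closed (P : set M) ts : P 0 -> (forall v w, P v -> P w -> P (v + w)) ->
  (forall a v, P v -> P (sc a v)) -> (forall t, t \in ts -> P t) ->
  forall v, kspan ts v -> P v.
Proof.
move=> P0 PD PZ; elim: ts => [|t ts IH] Pts v /=; first by move=> ->.
move=> [a va]; rewrite -(subrK (sc a t) v); apply: PD.
  by apply: IH va => u uts; apply: Pts; rewrite inE uts orbT.
by apply: PZ; apply: Pts; rewrite mem_head.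
Qed.

(** Gaussian elimination: the part of V inside the span of the tail is treated by induction, and at
    most one further vector, with nonzero coefficient at t, is added to reduce the rest of V to that
    part. *)
Lemma subspace_kspan (V : set M) ts : (forall v w, V v -> V w -> V (v + w)) ->
  (forall a v, V v -> V (sc a v)) -> (forall v, V v -> kspan ts v) ->
  exists us, (forall u, u \in us -> V u) /\ forall v, V v -> kspan us v.
Proof.
elim: ts V => [|t ts IH] V VD VZ Vts; first by exists [::].
have [||//|us [usV Vus]] := IH (V `&` kspan ts)%classic.
- by move=> v w [Vv kv] [Vw kw]; split; [apply: VD|apply: kspanD].
- by move=> a v [Vv kv]; split; [apply: VZ|apply: kspanZ].
- by move=> v [].
have [[v [a [Vv av a0]]]|noV] := pselect (exists v a,
    [/\ V v, kspan ts (v - sc a t) & a != 0]); last first.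
  exists us; split=> [u /usV[]//|v Vv]; apply: Vus; split=> //.
  have [a va] := Vts _ Vv; have [a0|a0] := eqVneq a 0.
    by rewrite -[v]subr0 -(sc0l t) -a0.
  by case: noV; exists v, a.
exists (v :: us); split=> [u|w Vw].
  by rewrite inE => /orP[/eqP->//|/usV[]].
have [b wb] := Vts _ Vw; exists (b / a); apply: Vus; split.
  by rewrite -scNl; apply: VD => //; apply: VZ.
have -> : w - sc (b / a) v = (w - sc b t) + sc (- (b / a)) (v - sc a t).
  rewrite scB !scA !scNl mulNr divfK // scNl opprK.
  by rewrite addrACA addNr addr0.
by apply: kspanD => //; apply: kspanZ.
Qed.

End FiniteSpans.

Section FinitelyGenerated.
Variables (A : pzRingType) (M : lmodType A).

Lemma Ugen_idem (T T' : set M) : (forall t, T t -> Ugen T' t) ->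
  forall v, Ugen T v -> Ugen T' v.
Proof. by move=> TT' v; apply: (Ugen_min (Ugen_sub T')). Qed.

Lemma Ugen_mono (T T' : set M) : (forall t, T t -> T' t) ->
  forall v, Ugen T v -> Ugen T' v.
Proof. by move=> TT'; apply: Ugen_idem => t /TT'; apply: Ugen_in. Qed.

Lemma fg_seq (ts : seq M) : (forall v, Ugen (fun t => t \in ts) v) ->
  finitely_generated M.
Proof.
move=> gM; exists (size ts), (fun i => nth 0 ts i) => v.
pose N : set M := fun v => exists a : 'I_(size ts) -> A, v = \sum_i a i *: nth 0 ts i.
apply: (gM v N).
- split=> [|_ _ [a ->] [b ->]|b _ [a ->]].
  + by exists (fun=> 0); rewrite big1 // => i _; rewrite scale0r.
  + exists (fun i => a i + b i); rewrite -big_split.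
    by apply: eq_bigr => i _; rewrite scalerDl.
  + exists (fun i => b * a i); rewrite scaler_sumr.
    by apply: eq_bigr => i _; rewrite scalerA.
- move=> t tts; have it : (index t ts < size ts)%N by rewrite index_mem.
  exists (fun i => if i == Ordinal it then 1 else 0).
  rewrite (bigD1 (Ordinal it)) //= eqxx big1 ?addr0 ?scale1r ?nth_index // => i.
  by move/negPf=> ->; rewrite scale0r.
Qed.

Lemma Ugen_finite (T : set M) v : Ugen T v ->
  exists ts : seq M, (forall t, t \in ts -> T t) /\ Ugen (fun t => t \in ts) v.
Proof.
move=> Tv; pose N : set M := fun v =>
  exists ts : seq M, (forall t, t \in ts -> T t) /\ Ugen (fun t => t \in ts) v.
apply: (Tv N) => [|t Tt]; last first.
  exists [:: t]; split=> [u|]; first by rewrite inE => /eqP->.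
  by apply: Ugen_in; rewrite mem_head.
split=> [|x y [ts [Tts tx]] [us [Tus uy]]|a x [ts [Tts tx]]].
- by exists [::]; split=> //; case: (Ugen_sub (fun t : M => t \in Nil M)).
- exists (ts ++ us); split=> [t|]; first by rewrite mem_cat => /orP[/Tts|/Tus].
  have [_ GD _] := Ugen_sub (fun t : M => t \in ts ++ us).
  by apply: GD; [apply: Ugen_mono tx => t /=|apply: Ugen_mono uy => t /=];
    rewrite mem_cat => ->; rewrite ?orbT.
- exists ts; split=> //; have [_ _ GZ] := Ugen_sub (fun t : M => t \in ts).
  exact: GZ.
Qed.

(** Each of the given generators involves only finitely many elements of T. In a good module the
    generators can thus be taken among singular weight vectors. *)
Lemma fg_Ugen (T : set M) : finitely_generated M -> (forall v, Ugen T v) ->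
  exists ts : seq M, (forall t, t \in ts -> T t) /\ forall v, Ugen (fun t => t \in ts) v.
Proof.
move=> [n [s sM]] TM.
suff [ts [Tts tsn]] : exists ts : seq M, (forall t, t \in ts -> T t) /\
    forall i, Ugen (fun t => t \in ts) (s i).
  exists ts; split=> // v; have [a ->] := sM v.
  by apply: submodule_sum (Ugen_sub _) _ => i _; case: (Ugen_sub (fun t => t \in ts)) => _ _; apply.
have /choice [ts tsP] i := Ugen_finite (TM (s i)).
exists (flatten [seq ts i | i : 'I_n]); split=> [t /flatten_imageP [i _ /(proj1 (tsP i))]//|i].
apply: Ugen_mono (tsP i).2 => t /= tts; apply/flatten_imageP; by exists i.
Qed.

End FinitelyGenerated.

Section CosetCategory.
Variables (K : fieldType).
Local Notation U := (Defs.U K).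
Local Notation weight := (weight K).
Hypothesis charK : [pchar K] =i pred0.
Variable c : K.
Hypothesis c0 : c != 0.
Local Notation xi0 := (xi0 c).
Local Notation swv := (@swv K c _).
Local Notation good := (good c).

Lemma swvZ (M : lmodType U) a (v : M) : swv v -> swv (sc a v).
Proof.
by move=> [sv [l xl lv]]; split; [apply: singZ|exists l => //; apply: wvZ].
Qed.

Lemma swv_h (M : lmodType U) (v : M) : swv v -> exists a, gh *: v = sc a v.
Proof. by move=> [_ [l _ [hv _]]]; exists l.1. Qed.

Definition sumof (M : lmodType U) (P : set M) (v : M) :=
  exists r : seq M, (forall t, t \in r -> P t) /\ v = \sum_(t <- r) t.

(** Sums of singular weight vectors form an h-stable space of singular vectors that generates M, so
    [sing_gen] leaves no other singular vector. *)
Lemma sing_sum (M : lmodType U) (v : M) : good M -> sing v -> sumof swv v.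
Proof.
move=> gM; have := good_gen charK c0 gM v => Gv.
have TP (T := sumof (swv : set M)) : forall t, swv t -> T t.
  move=> t st; exists [:: t]; split; last by rewrite big_seq1.
  by move=> u; rewrite inE => /eqP->.
apply: (sing_gen charK c0 gM) => [||||w [r [rs ->]]|].
- by exists [::]; rewrite big_nil.
- move=> x y [r [rs ->]] [r' [rs' ->]]; exists (r ++ r'); rewrite big_cat.
  by split=> // t; rewrite mem_cat => /orP[/rs|/rs'].
- move=> a x [r [rs ->]]; exists [seq sc a t | t <- r]; rewrite sc_sumr big_map.
  by split=> // t /mapP[u /rs su ->]; apply: swvZ.
- move=> x [r [rs ->]]; exists [seq gh *: t | t <- r]; rewrite scaler_sumr big_map.
  split=> // t /mapP[u /rs su ->]; have [a ->] := swv_h su; exact: swvZ.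
- rewrite big_seq; elim/big_ind: _ => [||t /rs[]//]; [exact: sing0|exact: singD].
- exact: Ugen_mono Gv.
Qed.

(** The span of the generators is h-stable because each is an eigenvector of h; [sing_gen] applies
    again and bounds the dimension of the space of singular vectors. *)
Lemma sing_kspan (M : lmodType U) (ts : seq M) : good M ->
  (forall t, t \in ts -> swv t) -> (forall v, Ugen (fun t => t \in ts) v) ->
  forall v : M, sing v -> kspan ts v.
Proof.
move=> gM tsw tsM v sv; apply: (sing_gen charK c0 gM) sv => [||a w|w|w|].
- exact: kspan0.
- exact: kspanD.
- exact: kspanZ.
- apply: (@kspan_closed _ _ (fun w => kspan ts (gh *: w))) => [|x y|a x|t tts];
    rewrite ?scaler0 ?scalerDr ?scU.
  + exact: kspan0.
  + exact: kspanD.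
  + exact: kspanZ.
  + by have [a ->] := swv_h (tsw _ tts); apply/kspanZ/kspan_in.
- apply: (@kspan_closed _ _ (@sing K M)) => [|x y|a x|t /tsw[]//];
    [exact: sing0|exact: singD|exact: singZ].
- by apply: Ugen_mono (tsM v) => t; apply: kspan_in.
Qed.

(** The singular vectors of M embed into those of N, which span a finite-dimensional space, and they
    generate M. *)
Lemma fg_inj (M N : lmodType U) (g : {linear M -> N}) : injective g ->
  good N -> finitely_generated N -> finitely_generated M.
Proof.
move=> gI gN /fg_Ugen /(_ (good_gen charK c0 gN)) [ts [tsw tsN]].
have gM := good_inj gI gN.
pose V : set N := fun v => exists2 x : M, sing x & v = g x.
have [|||us [usV Vus]] := @subspace_kspan _ _ V ts.
- by move=> _ _ [x sx ->] [y sy ->]; exists (x + y); rewrite ?linearD //; apply: singD.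
- by move=> a _ [x sx ->]; exists (sc a x); rewrite ?linear_sc //; apply: singZ.
- by move=> _ [x sx ->]; apply: (sing_kspan gN tsw tsN); apply: sing_lin.
have [xs usE] : exists xs : seq M, us = map g xs.
  elim: us usV {Vus} => [|u us IH] usV; first by exists [::].
  have [|xs ->] := IH; first by move=> w wus; apply: usV; rewrite inE wus orbT.
  by have [x _ ->] := usV u (mem_head _ _); exists (x :: xs).
apply: (@fg_seq _ _ xs) => v.
apply: Ugen_idem (good_gen charK c0 gM v) => x [sx _].
have : kspan us (g x) by apply: Vus; exists x.
have [G0 GD GZ] := Ugen_sub (fun t => t \in xs).
rewrite {us usV Vus}usE.
elim: xs x {sx} G0 GD GZ => [|y xs IH] x G0 GD GZ /=.
  by rewrite -[X in _ = X](linear0 g) => /gI ->.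
move=> [a]; rewrite -linear_sc -linearB => /IH.
have -> : x = (x - sc a y) + sc a y by rewrite subrK.
move=> H; apply: GD; last first.
  by apply: GZ; apply: Ugen_in; rewrite mem_head.
rewrite addrK in H.
have [G0' GD' GZ'] := Ugen_sub (fun t => t \in xs).
by apply: Ugen_mono (H G0' GD' GZ') => t txs; rewrite inE txs orbT.
Qed.

End CosetCategory.

(** * Category O within a coset, in terms of weights and nilpotency *)

Section CosetCharacterization.
Variables (K : fieldType).
Local Notation U := (Defs.U K).
Local Notation weight := (weight K).
Hypothesis charK : [pchar K] =i pred0.
Variable c : K.
Hypothesis c0 : c != 0.
Local Notation xi0 := (xi0 c).
Local Notation swv := (@swv K c _).
Local Notation good := (good c).

Section OneModule.
Variable M : lmodType U.
Implicit Types v w : M.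

Lemma wv_pow l i k v : wv l v -> wv (l + shift K i *+ k) (gen K i ^+ k *: v).
Proof.
move=> lv; elim: k => [|k IHk]; first by rewrite addr0 scale1r.
by rewrite exprS -scalerA mulrSr addrA; apply: wv_gen.
Qed.

Lemma incl_gen i (iP : vec K i \in @nplus_pred K) k :
  uea_incl (@nplus_closed K) (ugen (SubLie (@nplus_closed K) iP : nplus K) ^+ k)
  = gen K i ^+ k.
Proof. by rewrite rmorphXn; congr (_ ^+ _); apply: ulift_gen. Qed.

(** The powers of the generator applied to v have pairwise distinct weights but lie in the
    finite-dimensional space U(n_+) v, so one of them is zero. *)
Lemma lnilp_nplus i l v : vec K i \in @nplus_pred K -> (shift K i).1 != 0 ->
  nplus_finite v -> wv l v -> lnilp (gen K i) v.
Proof.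
move=> iP si0 [n [s sv]] lv.
pose mu k := l + shift K i *+ k.
have muI : injective mu.
  move=> j k /addrI /(congr1 fst); rewrite !raddfMn /= => jk.
  have := congr1 (fun x => x / (shift K i).1) jk.
  rewrite -[X in X / _]mulr_natr -[X in _ = X / _]mulr_natr.
  by rewrite ![_ * _%:R]mulrC !mulfK // !pmulrn => /(int_inj charK) [].
have /choice [C CE] (k : nat) : exists C : 'I_n -> K, gen K i ^+ k *: v =
    \sum_j sc (C j) ((uea_incl (@nplus_closed K) (s j) : U) *: v).
  by have [C CE] := sv (ugen (SubLie (@nplus_closed K) iP : nplus K) ^+ k);
    exists C; rewrite -CE incl_gen.
pose A : 'M[K]_(n.+1, n) := \matrix_(k, j) C k j.
(* A matrix with n + 1 rows and n columns has a nonzero left kernel: this is a linear relation among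
   the first n + 1 powers. *)
have [d dA d0] : exists2 d : 'rV_n.+1, d *m A = 0 & d != 0.
  have /rowV0Pn [d /sub_kermxP dA d0] : kermx A != 0; last by exists d.
  by rewrite -mxrank_eq0 mxrank_ker subn_eq0 -ltnNge ltnS rank_leq_col.
have dv : \sum_(k < n.+1) sc (d 0 k) (gen K i ^+ k *: v) = 0.
  under eq_bigr => k _ do rewrite CE sc_sumr.
  rewrite exchange_big /= big1 // => j _; under eq_bigr => k _ do rewrite scA.
  rewrite /sc -scaler_suml -scaler_suml.
  have := congr1 (fun B : 'rV_n => B 0 j) dA; rewrite !mxE.
  by under eq_bigr => k _ do rewrite mxE; move=> ->; rewrite !scale0r.
have [k dk] : exists k, d 0 k != 0.
  apply/existsP; apply: contraNT d0; rewrite negb_exists => /forallP dk.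
  by apply/eqP/rowP => k; rewrite mxE; apply/eqP; rewrite -[_ == _]negbK.
exists k; apply: (sc_eq0 dk).
(* The projector onto the k-th weight isolates the k-th term of the relation. *)
pose S := [seq mu j | j <- iota 0 n.+1].
rewrite -[RHS](scaler0 _ (wproj S (mu k))) -dv scaler_sumr (bigD1 k) //=.
have muS (j : 'I_n.+1) : mu j \in S by apply: map_f; rewrite mem_iota ltn_ord.
rewrite big1 ?addr0 => [|j jk]; rewrite scU (wprojE _ (wv_pow i _ lv) (muS _)).
  by rewrite eqxx.
by rewrite (inj_eq muI) (inj_eq val_inj) (negPf jk) sc0.
Qed.

Lemma O_coset_good : O_coset xi0 M -> good M.
Proof.
move=> [[fgM [dM _] nM] sM].
have gw v : wsum xi0 v.
  have [s [w [ww ->]]] := dM v; apply: wsum_sum => l.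
  have [->|wl0] := eqVneq (w l) 0; first exact: wsum0.
  by apply: (@wsum_wv _ _ _ l); [apply: sM; exists (w l)|apply/wvP].
have en i : vec K i \in @nplus_pred K -> (shift K i).1 != 0 -> forall v, lnilp (gen K i) v.
  move=> iP i0 v; have [s [w [_ ww _ ->]]] := gw v.
  elim/big_ind: _ => [||l _]; [exact: lnilp0|exact: lnilpD|].
  exact: lnilp_nplus (ww l).
split=> //; apply: en; rewrite /shift /= ?oner_eq0 ?(nat_neq0 charK 1) //;
  by rewrite unfold_in !coord_vec /= eqxx.
Qed.

(** Since e and p commute, the vectors e^a p^b v with a < A and b < B span U(n_+) v; a monomial
    outside this box vanishes. *)
Lemma nplus_finite_lnilp v : lnilp ge v -> lnilp gp v -> nplus_finite v.
Proof.
move=> [A ev] [B pv].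
pose m a b := ge ^+ a *: (gp ^+ b *: v).
pose Z : set M := fun w => exists C : 'I_A * 'I_B -> K,
  w = \sum_ab sc (C ab) (m ab.1 ab.2).
have Z0 : Z 0 by exists (fun=> 0); rewrite big1 // => ab _; rewrite sc0l.
have ZD x y : Z x -> Z y -> Z (x + y).
  move=> [C ->] [D ->]; exists (fun ab => C ab + D ab).
  by rewrite -big_split; apply: eq_bigr => ab _; rewrite scDl.
have ZZ a x : Z x -> Z (sc a x).
  move=> [C ->]; exists (fun ab => a * C ab).
  by rewrite sc_sumr; apply: eq_bigr => ab _; rewrite scA.
have ep a w : gp *: (ge ^+ a *: w) = ge ^+ a *: (gp *: w) by apply: p_en.
have epb a b w : gp ^+ b *: (ge ^+ a *: w) = ge ^+ a *: (gp ^+ b *: w).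
  elim: b => [|b IHb]; first by rewrite !scale1r.
  by rewrite exprS -!scalerA IHb ep.
have me a b : ge *: m a b = m a.+1 b by rewrite /m exprS -scalerA.
have mp a b : gp *: m a b = m a b.+1 by rewrite /m ep exprS -scalerA.
have Zm a b : Z (m a b).
  have [aA|Aa] := ltnP a A; last by rewrite /m -epb (lnilp_le Aa ev) scaler0.
  have [bB|Bb] := ltnP b B; last by rewrite /m (lnilp_le Bb pv) scaler0.
  exists (fun ab => if ab == (Ordinal aA, Ordinal bB) then 1 else 0).
  rewrite (bigD1 (Ordinal aA, Ordinal bB)) //= eqxx sc1 big1 ?addr0 // => ab.
  by move/negPf=> ->; rewrite sc0l.
have Ze x : Z x -> Z (ge *: x).
  move=> [C ->]; rewrite scaler_sumr; elim/big_ind: _ => // ab _.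
  by rewrite scU me; apply/ZZ/Zm.
have Zp x : Z x -> Z (gp *: x).
  move=> [C ->]; rewrite scaler_sumr; elim/big_ind: _ => // ab _.
  by rewrite scU mp; apply/ZZ/Zm.
have Zu (u : uea (nplus K)) x : Z x -> Z (uea_incl (@nplus_closed K) u *: x).
  elim/uea_ind: u x => [y|a|u u' IHu IHu'|u u' IHu IHu'] x Zx.
  - have -> : uea_incl (@nplus_closed K) (ugen y) = ugen (sublie_val y) by apply: ulift_gen.
    rewrite ugenE scaler_suml.
    have := valP y; rewrite unfold_in => /and4P[/eqP yh /eqP yf /eqP yq /eqP yz] /=.
    elim/big_ind: _ => // i _; rewrite scZ.
    by elim/ord6P: i; rewrite ?yh ?yf ?yq ?yz ?sc0l //; apply: ZZ; [apply: Ze|apply: Zp].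
  - by rewrite linearZ rmorph1; apply: ZZ.
  - by rewrite rmorphD scalerDl; apply: ZD; [apply: IHu|apply: IHu'].
  - by rewrite rmorphM -scalerA; apply/IHu/IHu'.
have eP : vec K ie \in @nplus_pred K by rewrite unfold_in !coord_vec /= eqxx.
have pP : vec K ip \in @nplus_pred K by rewrite unfold_in !coord_vec /= eqxx.
pose xe : uea (nplus K) := ugen (SubLie (@nplus_closed K) eP : nplus K).
pose xp : uea (nplus K) := ugen (SubLie (@nplus_closed K) pP : nplus K).
pose T := ('I_A * 'I_B)%type; pose ev_ (k : 'I_#|{: T}|) : T := enum_val k.
exists #|{: T}|, (fun k => xe ^+ (ev_ k).1 * xp ^+ (ev_ k).2).
move=> u; have [C ->] : Z (uea_incl (@nplus_closed K) u *: v).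
  by apply: Zu; rewrite -[v]scale1r -[_ *: v]scale1r; apply: (Zm 0%N 0%N).
exists (fun k => C (ev_ k)).
rewrite (reindex ev_) /=; last exact/onW_bij/enum_val_bij.
by apply: eq_bigr => k _; rewrite /xe /xp rmorphM /= !incl_gen /m /sc [in LHS](scalerA (ge ^+ _)).
Qed.

Lemma good_O_coset : good M -> finitely_generated M -> O_coset xi0 M.
Proof.
move=> [gw ge_nil gp_nil] fgM; split; last first.
  by move=> l [v v0 /wvP lv]; apply: wsum_wv_in (gw v) lv v0.
split=> //; last by move=> v; apply: nplus_finite_lnilp.
split=> [v|s w us ww]; last by apply: wv_indep => // k; apply/wvP.
by have [s [w [_ ww _ vE]]] := gw v; exists s, w; split=> // l; apply/wvP.
Qed.

Lemma O_cosetP : O_coset xi0 M <-> good M /\ finitely_generated M.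
Proof.
split=> [MO|[]]; last exact: good_O_coset.
by split; [apply: O_coset_good|case: MO => -[]].
Qed.

End OneModule.
End CosetCharacterization.

(** * A model of the Verma modules *)

Section LieModules.
Variables (K : fieldType) (L : lieAlgType K) (B : comNzRingType).
Variables (kappa : {rmorphism K -> B}) (W : lmodType B).

(** The operators are linear over a commutative ring B that receives K through [kappa], so that one
    construction covers B = K and B = K x K. *)
Record lie_act := LieAct {
  act_op :> L -> W -> W;
  act_linear : forall x b v w, act_op x (b *: v + w) = b *: act_op x v + act_op x w;
  act_linearl : forall a x y w, act_op (a *: x + y) w = kappa a *: act_op x w + act_op y w;
  act_bracket : forall x y w,
    act_op (lie_bracket x y) w = act_op x (act_op y w) - act_op y (act_op x w)
}.

Variable op : lie_act.

Fixpoint uact (t : uterm L) (w : W) : W :=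
  match t with
  | UGen x => op x w
  | UScal a => kappa a *: w
  | UAdd t u => uact t w + uact u w
  | UMul t u => uact t (uact u w)
  end.

Lemma uact_linear t b v w : uact t (b *: v + w) = b *: uact t v + uact t w.
Proof.
elim: t b v w => [x|a|t IHt u IHu|t IHt u IHu] b v w /=.
- exact: act_linear.
- by rewrite scalerDr !scalerA mulrC.
- by rewrite IHt IHu scalerDr addrACA.
- by rewrite IHu IHt.
Qed.

Lemma uact_add t v w : uact t (v + w) = uact t v + uact t w.
Proof. by rewrite -[v]scale1r uact_linear !scale1r. Qed.

Lemma uact0 t : uact t 0 = 0.
Proof. by apply: (addIr (uact t 0)); rewrite -uact_add !add0r. Qed.

Lemma uact_scale t b v : uact t (b *: v) = b *: uact t v.
Proof. by rewrite -[b *: v]addr0 uact_linear uact0 addr0. Qed.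

Lemma uact_eq t u : ueq t u -> forall w, uact t w = uact u w.
Proof.
elim=> {t u} //=.
- by move=> t u v _ tu _ uv w; rewrite tu.
- by move=> t t' u u' _ tt' _ uu' w; rewrite tt' uu'.
- by move=> t t' u u' _ tt' _ uu' w; rewrite tt' uu'.
- by move=> t u v w; rewrite addrA.
- by move=> t u w; rewrite addrC.
- by move=> t w; rewrite rmorph0 scale0r add0r.
- by move=> t w; rewrite rmorphN1 rmorph0 scaleN1r scale0r addNr.
- by move=> t w; rewrite rmorph1 scale1r.
- by move=> t w; rewrite rmorph1 scale1r.
- by move=> t u v w; rewrite uact_add.
- by move=> a b w; rewrite rmorphD scalerDl.
- by move=> a b w; rewrite rmorphM scalerA.
- by move=> a t w; rewrite uact_scale.
- by move=> x y w; rewrite -[x]scale1r act_linearl scale1r rmorph1 scale1r.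
- move=> a x w; have op0 v : op 0 v = 0.
    apply: (addIr (op 0 v)); rewrite add0r -{3}(addr0 0) -{3}[0]scale1r.
    by rewrite act_linearl rmorph1 scale1r.
  by rewrite -[a *: x]addr0 act_linearl op0 addr0.
- by move=> x y w; rewrite act_bracket rmorphN1 scaleN1r.
Qed.

(** The argument is a phantom: it records in the type which action defines the U(L)-module structure
    on W. *)
Definition act_module of lie_act : Type := W.
HB.instance Definition _ := GRing.Zmodule.on (act_module op).

Definition act_scale (u : uea L) (w : act_module op) : act_module op :=
  uact (repr u) w.

Lemma act_scaleE t (w : W) : act_scale (uclass t) w = uact t w.
Proof. exact: uact_eq (ueq_repr t) w. Qed.

Lemma act_scaleA u v w : act_scale u (act_scale v w) = act_scale (u * v) w.
Proof.
case: (uclassP u) (uclassP v) => t -> [t' ->].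
by rewrite -[_ * _]/(umul _ _) umulE !act_scaleE.
Qed.

Lemma act_scale1 : left_id 1 act_scale.
Proof.
move=> w; rewrite -[1]/(uclass (UScal L 1)) act_scaleE /= rmorph1.
exact: scale1r.
Qed.

Lemma act_scaleDr : right_distributive act_scale +%R.
Proof. by move=> u v w; apply: uact_add. Qed.

Lemma act_scaleDl w : {morph act_scale^~ w : u v / u + v}.
Proof.
move=> u v; case: (uclassP u) (uclassP v) => t -> [t' ->].
by rewrite -[_ + _]/(uadd _ _) uaddE !act_scaleE.
Qed.

HB.instance Definition _ := GRing.Zmodule_isLmodule.Build (uea L) (act_module op)
  act_scaleA act_scale1 act_scaleDr act_scaleDl.

Lemma act_gen x (w : act_module op) : ugen x *: w = op x w.
Proof. exact: act_scaleE. Qed.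

Lemma act_scalar a (w : act_module op) : (a%:A : uea L) *: w = kappa a *: (w : W).
Proof. by rewrite -uscal_alg; apply: act_scaleE. Qed.

End LieModules.

Lemma subrACA (V : zmodType) (x y z t : V) : (x - y) - (z - t) = (x - z) - (y - t).
Proof. by rewrite !opprB addrACA [RHS]addrACA [- z - y]addrC. Qed.

Lemma sub_regroup (V : zmodType) (x y t u v s : V) :
  x - y + (t - u) - (v + t - (y + s)) = (x - v) + (s - u).
Proof.
rewrite opprB opprD !addrA.
by rewrite (ACl ((1 * 7) * (6 * 4) * (5 * 2) * (3 * 8)))%AC /= !subrr !addr0 addrA.
Qed.

Section Model.
Variables (B : comNzRingType) (V : lmodType B) (c ic hf lam : B).
Hypotheses (hic : c * ic = hf) (hhf : 2 * hf = 1).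

(** Integer indices make all shifts total, and functions of infinite support are allowed; the
    vectors of interest are those generated from the entry at (0, 0). The scalars [ic] and [hf]
    stand for 1/(2c) and 1/2, and [lam] for the highest weight at h. *)
Definition mspace : Type := int -> int -> V.
HB.instance Definition _ := GRing.Lmodule.on mspace.
Implicit Types w : mspace.

Lemma mspaceD w w' a b : (w + w') a b = w a b + w' a b. Proof. by []. Qed.
Lemma mspaceN w a b : (- w) a b = - w a b. Proof. by []. Qed.
Lemma mspaceZ k w a b : (k *: w) a b = k *: w a b. Proof. by []. Qed.
Definition mspaceE := (mspaceD, mspaceN, mspaceZ).

Lemma mspaceP w w' : (forall a b, w a b = w' a b) -> w = w'.
Proof. by move=> ww'; apply/funext => a; apply/funext => b. Qed.

(* The entry of w at (a, b) is the coefficient of F^a q^b, where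
   F = f + q^2 / (2 c) commutes with p and q. *)
Definition mh w : mspace := fun a b => (lam - 2 * a%:~R - b%:~R) *: w a b.
Definition mz w : mspace := c *: w.
Definition mp w : mspace := fun a b => (c * (b + 1)%:~R) *: w a (b + 1).
Definition mq w : mspace := fun a b => w a (b - 1).
(** The first term is the sl_2 action on F^(a+1); the second is p^2 / (2c), by which e acts on the
    powers of q. *)
Definition me w : mspace := fun a b =>
  ((a + 1)%:~R * (lam + hf - a%:~R)) *: w (a + 1) b
  + (c * hf * (b + 1)%:~R * (b + 2)%:~R) *: w a (b + 2).
Definition mf w : mspace := fun a b => w (a - 1) b - ic *: w a (b - 2).

Definition mgen (i : 'I_6) : mspace -> mspace :=
  nth id [:: me; mh; mf; mp; mq; mz] i.

Lemma mgen_linear i k w w' : mgen i (k *: w + w') = k *: mgen i w + mgen i w'.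
Proof.
apply: mspaceP => a b; elim/ord6P: i; rewrite ?mspaceE /mgen /=.
- by rewrite /me !mspaceE !scalerDr !scalerA ![k * _]mulrC addrACA.
- by rewrite /mh !mspaceE !scalerDr !scalerA mulrC.
- by rewrite /mf !mspaceE scalerDr scalerBr opprD !scalerA ![k * _]mulrC addrACA.
- by rewrite /mp !mspaceE !scalerDr !scalerA mulrC.
- by [].
- by rewrite /mz !mspaceE !scalerDr !scalerA mulrC.
Qed.

Lemma mgen0 i : mgen i 0 = 0.
Proof.
by have := mgen_linear i (-1) 0 0; rewrite scaler0 addr0 scaleN1r addNr.
Qed.

Lemma mgenZ i k w : mgen i (k *: w) = k *: mgen i w.
Proof. by have := mgen_linear i k w 0; rewrite mgen0 !addr0. Qed.

Ltac mstart := move=> w; apply: mspaceP => a b; rewrite !mspaceE.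

Lemma m_he w : mh (me w) - me (mh w) = 2 *: me w.
Proof.
move: w; mstart; rewrite /mh /me !scalerDr !scalerA opprD addrACA -!scalerBl.
by congr (_ *: _ + _ *: _); rewrite !intrD; ring.
Qed.

Lemma m_hf w : mh (mf w) - mf (mh w) = - 2 *: mf w.
Proof.
move: w; mstart; rewrite /mh /mf !scalerBr !scalerA subrACA -!scalerBl.
by congr (_ *: _ - _ *: _); rewrite ?intrB; ring.
Qed.

Lemma m_hp w : mh (mp w) - mp (mh w) = mp w.
Proof.
move: w; mstart; rewrite /mh /mp !scalerA -!scalerBl.
by congr (_ *: _); rewrite !intrD; ring.
Qed.

Lemma m_hq w : mh (mq w) - mq (mh w) = - mq w.
Proof.
move: w; mstart; rewrite /mh /mq -!scalerBl -scaleN1r.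
by congr (_ *: _); rewrite !intrB; ring.
Qed.

Lemma m_pq w : mp (mq w) - mq (mp w) = mz w.
Proof.
move: w; mstart; rewrite /mz /mp /mq addrK subrK -!scalerBl mspaceE.
by congr (_ *: _); rewrite !intrD; ring.
Qed.

Lemma m_ep w : me (mp w) - mp (me w) = 0.
Proof.
move: w; mstart; rewrite /me /mp !scalerDr !scalerA [b + 2 + 1]addrAC.
rewrite opprD addrACA -!scalerBl.
transitivity (0 *: w (a + 1) (b + 1) + 0 *: w a (b + 1 + 2)).
  by congr (_ *: _ + _ *: _); rewrite ?intrD; ring.
by rewrite !scale0r addr0.
Qed.

Lemma m_fq w : mf (mq w) - mq (mf w) = 0.
Proof.
move: w; mstart; rewrite /mf /mq [b - 2 - 1]addrAC; exact: subrr.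
Qed.

Lemma m_eq w : me (mq w) - mq (me w) = mp w.
Proof.
move: w; mstart; rewrite /me /mq /mp subrK opprD addrACA subrr add0r.
rewrite [b - 1 + 2](_ : _ = b + 2 - 1); last by rewrite addrAC.
have -> : b + 2 - 1 = b + 1 by rewrite -addrA.
rewrite -scalerBl; congr (_ *: _); rewrite !intrD.
transitivity (c * (b%:~R + 1) * (2 * hf)); first by ring.
by rewrite hhf mulr1.
Qed.

Lemma m_fp w : mf (mp w) - mp (mf w) = mq w.
Proof.
move: w; mstart; rewrite /mf /mq /mp scalerBr !scalerA subrACA subrr sub0r.
rewrite [b + 1 - 2](_ : _ = b - 2 + 1); last by rewrite addrAC.
have -> : b - 2 + 1 = b - 1 by rewrite -addrA.
rewrite -scalerBl -scaleNr -[RHS]scale1r; congr (_ *: _).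
rewrite !(intrD, intrB); transitivity (2 * (c * ic)); first by ring.
by rewrite hic.
Qed.

Lemma m_ef w : me (mf w) - mf (me w) = mh w.
Proof.
move: w; mstart; rewrite /me /mf /mh !scalerBr !scalerDr !scalerA addrK subrK.
rewrite addrK subrK.
set x := w a b; set y := w (a + 1) _; set t := w _ (b + 2).
rewrite [ic * (_ * (_ - _))]mulrC sub_regroup.
rewrite -!scalerBl -scalerDl; congr (_ *: _).
rewrite !(intrD, intrB).
transitivity (lam + hf - 2 * a%:~R - (c * ic) * hf * (4 * b%:~R + 2)); first by ring.
rewrite hic; transitivity (lam - 2 * a%:~R + hf * (1 - 2 * hf) - b%:~R * (2 * hf) * (2 * hf)).
  by ring.
by rewrite hhf subrr; ring.
Qed.

End Model.

Section ModelModule.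
Variables (K : fieldType) (B : comNzRingType) (kappa : {rmorphism K -> B}).
Local Notation U := (Defs.U K).
Local Notation S := (schrodinger K).
Hypothesis charK : [pchar K] =i pred0.
Variable c : K.
Hypothesis c0 : c != 0.
Variables (V : lmodType B) (lam : B).

Local Notation W := (mspace V).
Local Notation mg := (mgen (kappa c) (kappa (2 * c)^-1) (kappa 2^-1) lam).

Let hic : kappa c * kappa (2 * c)^-1 = kappa 2^-1.
Proof. by rewrite -rmorphM invfM mulrCA divff ?mulr1. Qed.
Let hhf : 2 * kappa 2^-1 = 1.
Proof.
have two0 : (2 : K) != 0 by apply: (nat_neq0 charK 1).
by rewrite -[2](rmorph_nat kappa) -rmorphM divff // rmorph1.
Qed.

Definition mop (x : S) (w : W) : W := \sum_i kappa (Defs.coord i x) *: mg i w.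

Lemma mop_linear x b v w : mop x (b *: v + w) = b *: mop x v + mop x w.
Proof.
rewrite /mop scaler_sumr -big_split; apply: eq_bigr => i _ /=.
by rewrite mgen_linear scalerDr !scalerA mulrC.
Qed.

Lemma mop_linearl a x y w : mop (a *: x + y) w = kappa a *: mop x w + mop y w.
Proof.
rewrite /mop scaler_sumr -big_split; apply: eq_bigr => i _ /=.
by rewrite !coordE rmorphD rmorphM scalerDl scalerA.
Qed.

Lemma mop_vec i w : mop (vec K i) w = mg i w.
Proof.
rewrite /mop (bigD1 i) //= big1 ?addr0 => [|j /negPf ji].
  by rewrite coord_vec eqxx rmorph1 scale1r.
by rewrite coord_vec ji rmorph0 scale0r.
Qed.

Lemma mop0l w : mop 0 w = 0.
Proof. by rewrite /mop big1 // => i _; rewrite Defs.coord0 rmorph0 scale0r. Qed.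

Lemma mopZl a x w : mop (a *: x) w = kappa a *: mop x w.
Proof. by rewrite -[a *: x]addr0 mop_linearl mop0l addr0. Qed.

Lemma mopNl x w : mop (- x) w = - mop x w.
Proof. by rewrite -scaleN1r mopZl rmorphN1 scaleN1r. Qed.

(** Antisymmetry, the zero diagonal and the centrality of z reduce the 36 pairs to ten brackets. *)
Lemma mop_vec_bracket i j w :
  mop (lie_bracket (vec K i) (vec K j)) w = mg i (mg j w) - mg j (mg i w).
Proof.
have sym (k l : 'I_6) :
    mop (lie_bracket (vec K k) (vec K l)) w = mg k (mg l w) - mg l (mg k w) ->
    mop (lie_bracket (vec K l) (vec K k)) w = mg l (mg k w) - mg k (mg l w).
  have -> : lie_bracket (vec K l) (vec K k) = - lie_bracket (vec K k) (vec K l) :> S.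
    by apply: coordP => m; elim/ord6P: m; rewrite coordN !coord_bracketE /wedge; ring.
  by rewrite mopNl => ->; rewrite opprB.
have diag k : mop (lie_bracket (vec K k) (vec K k)) w = mg k (mg k w) - mg k (mg k w).
  by rewrite bracketxx mop0l subrr.
have he : mop (lie_bracket (vec K ih) (vec K ie)) w = mg ih (mg ie w) - mg ie (mg ih w).
  by rewrite [lie_bracket _ _]bracket_he mopZl mop_vec rmorph_nat; symmetry; apply: m_he.
have ef : mop (lie_bracket (vec K ie) (vec K if_)) w = mg ie (mg if_ w) - mg if_ (mg ie w).
  by rewrite [lie_bracket _ _]bracket_ef mop_vec; symmetry; apply: m_ef.
have hf : mop (lie_bracket (vec K ih) (vec K if_)) w = mg ih (mg if_ w) - mg if_ (mg ih w).
  by rewrite [lie_bracket _ _]bracket_hf mopZl mop_vec rmorphN rmorph_nat; symmetry; apply: m_hf.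
have eq : mop (lie_bracket (vec K ie) (vec K iq)) w = mg ie (mg iq w) - mg iq (mg ie w).
  by rewrite [lie_bracket _ _]bracket_eq mop_vec; symmetry; apply: m_eq.
have ep : mop (lie_bracket (vec K ie) (vec K ip)) w = mg ie (mg ip w) - mg ip (mg ie w).
  by rewrite [lie_bracket _ _]bracket_ep mop0l; symmetry; apply: m_ep.
have hp : mop (lie_bracket (vec K ih) (vec K ip)) w = mg ih (mg ip w) - mg ip (mg ih w).
  by rewrite [lie_bracket _ _]bracket_hp mop_vec; symmetry; apply: m_hp.
have fp : mop (lie_bracket (vec K if_) (vec K ip)) w = mg if_ (mg ip w) - mg ip (mg if_ w).
  by rewrite [lie_bracket _ _]bracket_fp mop_vec; symmetry; apply: (m_fp hic hhf).
have fq : mop (lie_bracket (vec K if_) (vec K iq)) w = mg if_ (mg iq w) - mg iq (mg if_ w).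
  by rewrite [lie_bracket _ _]bracket_fq mop0l; symmetry; apply: m_fq.
have hq : mop (lie_bracket (vec K ih) (vec K iq)) w = mg ih (mg iq w) - mg iq (mg ih w).
  by rewrite [lie_bracket _ _]bracket_hq mopNl mop_vec; symmetry; apply: m_hq.
have pq : mop (lie_bracket (vec K ip) (vec K iq)) w = mg ip (mg iq w) - mg iq (mg ip w).
  by rewrite [lie_bracket _ _]bracket_pq mop_vec; symmetry; apply: m_pq.
have z k : mop (lie_bracket (vec K iz) (vec K k)) w = mg iz (mg k w) - mg k (mg iz w).
  by rewrite [lie_bracket _ _]bracket_z mop0l [mg k (mg iz w)]mgenZ subrr.
elim/ord6P: i.
- elim/ord6P: j; [exact: diag|exact: sym he|exact: ef|exact: ep|exact: eq|exact: sym (z _)].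
- elim/ord6P: j; [exact: he|exact: diag|exact: hf|exact: hp|exact: hq|exact: sym (z _)].
- elim/ord6P: j;
    [exact: sym ef|exact: sym hf|exact: diag|exact: fp|exact: fq|exact: sym (z _)].
- elim/ord6P: j;
    [exact: sym ep|exact: sym hp|exact: sym fp|exact: diag|exact: pq|exact: sym (z _)].
- elim/ord6P: j;
    [exact: sym eq|exact: sym hq|exact: sym fq|exact: sym pq|exact: diag|exact: sym (z _)].
- exact: z.
Qed.

Lemma bracket_sumr (x : S) (a : 'I_6 -> K) (y : 'I_6 -> S) :
  lie_bracket x (\sum_i a i *: y i) = \sum_i a i *: lie_bracket x (y i) :> S.
Proof.
have b0 : lie_bracket x 0 = 0 :> S.
  have := bracketPr (-1) (0 : S) (0 : S) x.
  by rewrite scaler0 addr0 scaleN1r addNr.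
by elim/big_rec2: _ => [//|i u v _ <-]; rewrite bracketPr.
Qed.

Lemma bracket_suml (x : S) (a : 'I_6 -> K) (y : 'I_6 -> S) :
  lie_bracket (\sum_i a i *: y i) x = \sum_i a i *: lie_bracket (y i) x :> S.
Proof.
have b0 : lie_bracket 0 x = 0 :> S.
  have := bracketPl (-1) (0 : S) (0 : S) x.
  by rewrite scaler0 addr0 scaleN1r addNr.
by elim/big_rec2: _ => [//|i u v _ <-]; rewrite bracketPl.
Qed.

Lemma mop_suml (a : 'I_6 -> K) (y : 'I_6 -> S) w :
  mop (\sum_i a i *: y i) w = \sum_i kappa (a i) *: mop (y i) w.
Proof. by elim/big_rec2: _ => [|i u v _ <-]; rewrite ?mop0l ?mop_linearl. Qed.

Lemma mg_sumr j (a : 'I_6 -> B) (y : 'I_6 -> W) :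
  mg j (\sum_i a i *: y i) = \sum_i a i *: mg j (y i).
Proof.
by elim/big_rec2: _ => [|i u v _ <-]; rewrite ?mgen0 ?mgen_linear.
Qed.

Lemma schr_sum (x : S) : x = \sum_i Defs.coord i x *: vec K i.
Proof. exact: (row_sum_delta x). Qed.

Lemma mop_bracket x y w :
  mop (lie_bracket x y) w = mop x (mop y w) - mop y (mop x w).
Proof.
have E (u v : S) : mop u (mop v w)
    = \sum_i \sum_j (kappa (Defs.coord i u) * kappa (Defs.coord j v)) *: mg i (mg j w).
  apply: eq_bigr => i _; rewrite mg_sumr scaler_sumr.
  by apply: eq_bigr => j _; rewrite scalerA.
rewrite !E {1}(schr_sum x) {1}(schr_sum y) bracket_suml mop_suml.
rewrite [X in _ - X]exchange_big -sumrB; apply: eq_bigr => i _.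
rewrite bracket_sumr mop_suml scaler_sumr -sumrB; apply: eq_bigr => j _.
by rewrite mop_vec_bracket scalerA [X in _ - X *: _]mulrC -scalerBr.
Qed.

Definition model_act : lie_act (schrodinger K) kappa (mspace V) :=
  LieAct mop_linear mop_linearl mop_bracket.

Definition model : lmodType U := act_module model_act.

Lemma model_gen i (w : model) : gen K i *: w = mg i w.
Proof. by rewrite [LHS]act_gen /= mop_vec. Qed.

Lemma model_sc a (w : model) : sc a w = kappa a *: (w : W).
Proof. exact: act_scalar. Qed.

Definition mconst (v : V) : model := fun a b => if (a == 0) && (b == 0) then v else 0.

Lemma mconstD u v : mconst (u + v) = mconst u + mconst v.
Proof.
by apply: mspaceP => a b; rewrite mspaceD /mconst; case: ifP; rewrite ?addr0.
Qed.

Lemma mconstZ k v : mconst (k *: v) = k *: (mconst v : W).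
Proof.
by apply: mspaceP => a b; rewrite mspaceZ /mconst; case: ifP; rewrite ?scaler0.
Qed.

Lemma mconst_inj : injective mconst.
Proof. by move=> u v /(congr1 (fun w : W => w 0 0)). Qed.

Lemma mconst_h v : gh *: mconst v = mconst (lam *: v).
Proof.
rewrite model_gen; apply: mspaceP => a b.
rewrite /mgen /= /mh /mconst; case: andP => [[/eqP-> /eqP->]|]; last by rewrite scaler0.
by rewrite mulr0 !subr0.
Qed.

Lemma mconst_z v : gz *: mconst v = sc c (mconst v).
Proof. by rewrite model_gen model_sc. Qed.

(** The operators e and p could move the entry at (0, 0) only to a negative index, where the factor
    a + 1, b + 1 or b + 2 vanishes. *)
Lemma mconst_sing v : sing (mconst v).
Proof.
split; rewrite model_gen; apply: mspaceP => a b; rewrite /mgen /=.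
- rewrite /me /mconst -[RHS](addr0 0); congr (_ + _).
    by case: (a + 1 =P 0) => [->|_]; rewrite ?mul0r ?scale0r ?scaler0.
  by case: (b + 2 =P 0) => [->|_]; rewrite ?mulr0 ?scale0r // andbF scaler0.
- rewrite /mp /mconst.
  by case: (b + 1 =P 0) => [->|_]; rewrite ?mulr0 ?scale0r // andbF scaler0.
Qed.

End ModelModule.

(** * Verma modules *)

Section VermaModules.
Variables (K : fieldType) (l : weight K).
Local Notation U := (Defs.U K).
Local Notation phi := (uea_incl (@borel_closed K)).

Definition vgen : verma l := pure_tensor phi 1 (1 : char_module l).

Lemma weight_char_scalar (a : K) : weight_char l (a%:A : uea (borel K)) = a :> K.
Proof. by rewrite -uscal_alg [LHS]uliftE /=; apply: mulr1. Qed.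

Lemma char_scale (a : K) (n : char_module l) : (a%:A : uea (borel K)) *: n = a * (n : K) :> K.
Proof.
by rewrite -[LHS]/((weight_char l a%:A : K) * (n : K)) weight_char_scalar.
Qed.

Lemma pure_tensorE (b : U) (n : char_module l) :
  pure_tensor phi b n = (b * (n : K)%:A) *: vgen.
Proof.
rewrite -[RHS]/(tscale _ (tclass _ _)) tscaleE /smul /= mulr1.
have -> : (n : K)%:A = phi (n : K)%:A :> U by rewrite linearZ rmorph1.
rewrite /pure_tensor (tclass_eq (teq_bal phi b _ _)).
by congr (tclass _ [:: (_, _)]); rewrite char_scale mulr1.
Qed.

Lemma verma_gen (v : verma l) : Ugen [set vgen]%classic v.
Proof.
have [s ->] := tclassP v; elim: s => [|[b n] s IHs]; first by case: (Ugen_sub [set vgen]%classic).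
have -> : tclass phi ((b, n) :: s) = pure_tensor phi b n + tclass phi s.
  by rewrite -[RHS]/(tadd _ _) taddE.
have [_ GD GZ] := Ugen_sub [set vgen]%classic.
by apply: GD => //; rewrite pure_tensorE; apply: GZ; apply: Ugen_in.
Qed.

Lemma vgen_borel (x : schrodinger K) : x \in @borel_pred K ->
  (ugen x : U) *: vgen = sc (weval l x) vgen.
Proof.
move=> xB; pose y : borel K := SubLie (@borel_closed K) xB.
have yx : ugen x = phi (ugen y) :> U by rewrite [RHS]ulift_gen.
rewrite -[LHS]/(tscale _ (tclass _ _)) tscaleE /smul /= mulr1 yx -[phi _]mul1r.
rewrite (tclass_eq (teq_bal phi 1 _ _)) -[LHS]/(pure_tensor phi 1 _) pure_tensorE mul1r.
rewrite -[ugen y *: _]/((weight_char l (ugen y) : K) * 1) mulr1.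
by rewrite [weight_char _ _]ulift_gen.
Qed.

Lemma vgen_sing : sing vgen.
Proof.
split; rewrite vgen_borel ?unfold_in ?coord_vec ?eqxx //; rewrite /weval !coord_vec /=;
  by rewrite !mulr0 addr0 sc0l.
Qed.

Lemma vgen_wv : wv l vgen.
Proof.
split; rewrite vgen_borel ?unfold_in ?coord_vec ?eqxx //; rewrite /weval !coord_vec /=;
  by rewrite mulr1 mulr0 ?addr0 ?add0r.
Qed.

Section VermaMap.
Variables (M : lmodType U) (m : M).
Hypotheses (ms : sing m) (mw : wv l m).

Lemma borel_scale (a : uea (borel K)) : phi a *: m = sc (weight_char l a : K) m.
Proof.
elim/uea_ind: a => [y|a|a b IHa IHb|a b IHa IHb].
- have -> : phi (ugen y) = ugen (sublie_val y) :> U by apply: ulift_gen.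
  have -> : (weight_char l (ugen y) : K) = weval l (sublie_val y).
    exact: (ulift_gen (borel_char_morphism l) y).
  have := valP y; rewrite unfold_in => /andP[/eqP yf /eqP yq].
  rewrite ugenE scaler_suml (bigD1 ih) //= (bigD1 iz) //= big1 ?addr0.
    by rewrite !scZ mw.1 mw.2 !scA -scDl; congr sc; rewrite /weval; ring.
  move=> i; rewrite scZ; elim/ord6P: i; rewrite ?yf ?yq ?sc0l ?ms.1 ?ms.2 ?sc0 //.
- rewrite linearZ rmorph1; congr sc; exact/esym/weight_char_scalar.
- have -> : (weight_char l (a + b) : K) = (weight_char l a : K) + (weight_char l b : K).
    by rewrite /weight_char rmorphD.
  by rewrite rmorphD scalerDl IHa IHb -scDl.
- have -> : (weight_char l (a * b) : K) = (weight_char l b : K) * (weight_char l a : K).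
    by rewrite /weight_char rmorphM [LHS]mulrC.
  by rewrite rmorphM -scalerA IHb scU IHa scA.
Qed.

(** The universal property of the induced module, on formal sums of tensors: a singular vector m of
    weight l receives [vgen]. The balance relation is respected by [borel_scale]. *)
Definition verma_fun_seq (s : seq (U * char_module l)) : M :=
  \sum_(x <- s) x.1 *: sc (x.2 : K) m.

Lemma verma_fun_teq s t : teq phi s t -> verma_fun_seq s = verma_fun_seq t.
Proof.
rewrite /verma_fun_seq; elim=> {s t} //.
- by move=> s t u _ -> _ ->.
- by move=> s s' t t' _ ss' _ tt'; rewrite !big_cat ss' tt'.
- by move=> s t; rewrite !big_cat /= addrC.
- by move=> b b' n; rewrite !big_cons big_nil !addr0 scalerDl.
- by move=> b n n'; rewrite !big_cons big_nil !addr0 /= scDl scalerDr.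
- move=> b a n; rewrite !big_seq1 /= -scalerA; congr (_ *: _).
  by rewrite scU borel_scale scA mulrC.
- by move=> n; rewrite big_seq1 big_nil scale0r.
Qed.

Definition verma_fun (v : verma l) : M := verma_fun_seq (repr (v : tensor phi (char_module l))).

Lemma verma_funE s : verma_fun (tclass phi s) = verma_fun_seq s.
Proof. exact: verma_fun_teq (teq_repr _ s). Qed.

Lemma verma_fun_linear : linear verma_fun.
Proof.
move=> a v w; case: (tclassP v) (tclassP w) => s -> [t ->].
rewrite -[a *: _]/(tscale _ _) tscaleE -[_ + _]/(tadd _ _) taddE !verma_funE.
rewrite /verma_fun_seq big_cat big_map scaler_sumr; congr (_ + _).
by apply: eq_bigr => x _; rewrite -scalerA.
Qed.

HB.instance Definition _ :=
  GRing.isLinear.Build U (verma l) M _ verma_fun verma_fun_linear.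

Definition verma_map : {linear verma l -> M} := verma_fun.

Lemma verma_map_gen : verma_map vgen = m.
Proof. by rewrite [LHS]verma_funE /verma_fun_seq big_seq1 /= scale1r sc1. Qed.

End VermaMap.
End VermaModules.

Section VermaSimple.
Variable K : fieldType.
Hypothesis charK : [pchar K] =i pred0.
Variable c : K.
Hypothesis c0 : c != 0.
Local Notation wt := (wt c).
Local Notation good := (good c).

Variable n : int.
Local Notation l := (wt n).

Lemma vgen_swv : swv c (vgen l).
Proof. by split; [exact: vgen_sing|exists l; [exists n|exact: vgen_wv]]. Qed.

Lemma verma_good : good (verma l).
Proof.
apply: good_of_gen => v; apply: Ugen_mono (verma_gen v) => _ ->; exact: vgen_swv.
Qed.

Lemma verma_fg : finitely_generated (verma l).
Proof.
apply: (@fg_seq _ _ [:: vgen l]) => v; apply: Ugen_mono (verma_gen v) => _ ->.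
exact: mem_head.
Qed.

(** The map to the model over K sends [vgen] to a function with value 1 at (0, 0). *)
Lemma vgen_neq0 : vgen l != 0.
Proof.
pose m := @mconst K K idfun charK c c0 K^o n%:~R 1.
have ms : sing m by apply: mconst_sing.
have mw : wv l m by split; [rewrite mconst_h mconstZ; exact/esym/model_sc|exact: mconst_z].
apply/eqP => v0; have := verma_map_gen ms mw.
rewrite v0 linear0 => m0; have /eqP : m 0 0 = 0 by rewrite -m0.
by rewrite oner_eq0.
Qed.

Lemma verma_sing v : sing v -> exists a, v = sc a (vgen l).
Proof.
move=> sv; suff [a /eqP] : kspan [:: vgen l] v by rewrite subr_eq0 => /eqP ->; exists a.
apply: (sing_kspan charK c0 verma_good) sv => [t|w].
  by rewrite inE => /eqP ->; apply: vgen_swv.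
by apply: Ugen_mono (verma_gen w) => _ ->; apply: mem_head.
Qed.

End VermaSimple.

Section SingularSocle.
Variable K : fieldType.
Hypothesis charK : [pchar K] =i pred0.
Variable c : K.
Hypothesis c0 : c != 0.

(** A submodule of a good module is good, hence generated by its own singular weight vectors; these
    play the part of a socle. *)
Lemma sub_no_swv (M : lmodType (U K)) (N : set M) : good c M -> is_submodule N ->
  (forall v, N v -> swv c v -> v = 0) -> forall v, N v -> v = 0.
Proof.
move=> gM NS N0 v /(submod_lift NS) [x <-].
have iI : injective (submod_incl NS) by apply: val_inj.
have gN := good_inj iI gM.
have : Ugen (@swv K c _) x by apply: good_gen.
move=> /(_ [set 0]%classic (@zero_sub _ _)) -> // y sy.
apply: iI; rewrite linear0; apply: N0; first exact: submod_valP.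
exact: (swv_lin (submod_incl NS)).
Qed.

(** A nonzero submodule contains a nonzero singular vector, which is a multiple of the generator. *)
Lemma verma_simple n : simple_module (verma (wt c n)).
Proof.
split; first by exists (vgen (wt c n)); apply: vgen_neq0.
move=> N NS; have [allN|] := pselect (forall v, N v -> swv c v -> v = 0).
  left; apply/seteqP; split=> [v Nv|_ ->]; last by case: NS.
  exact: (sub_no_swv (verma_good _ _) NS allN).
move/existsNP => [v /not_implyP [Nv /not_implyP [[sv _] v0]]]; right.
have [a vE] := verma_sing charK c0 sv.
have Ng : N (vgen (wt c n)).
  have a0 : a != 0 by apply/eqP => a0; apply: v0; rewrite vE a0 sc0l.
  rewrite -[vgen _]sc1 -(mulVf a0) -scA -vE; case: NS => _ _; exact.
apply/seteqP; split=> // w _; apply: (verma_gen w NS) => _ -> //.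
Qed.

End SingularSocle.

(** * Blocks as Serre subcategories *)

Definition mk_linear (A : pzRingType) (M N : lmodType A) (f : M -> N) (fL : linear f) :
  {linear M -> N} := HB.pack f (GRing.isLinear.Build A M N _ f fL).

Section ZeroMap.
Variables (A : pzRingType) (M N : lmodType A).

Lemma zero_linear : linear (fun _ : M => 0 : N).
Proof. by move=> a x y; rewrite scaler0 addr0. Qed.

Definition zeroL := mk_linear zero_linear.

Lemma range_sub (g : {linear M -> N}) : is_submodule [set y | exists x, g x = y]%classic.
Proof.
split=> [|_ _ [x <-] [x' <-]|a _ [x <-]]; first by exists 0; rewrite linear0.
  by exists (x + x'); rewrite linearD.
by exists (a *: x); rewrite linearZ.
Qed.

End ZeroMap.
Arguments zeroL {A} M N.

Section Products.
Variables (A : pzRingType) (M N Q : lmodType A).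

Lemma inl_linear : linear (fun x : M => (x, 0) : M * N).
Proof. by move=> a x y; rewrite -[RHS]/(_ + _, _ + _) /= scaler0 addr0. Qed.
Lemma inr_linear : linear (fun y : N => (0, y) : M * N).
Proof. by move=> a x y; rewrite -[RHS]/(_ + _, _ + _) /= scaler0 addr0. Qed.
Lemma snd_linear : linear (fun x : M * N => x.2). Proof. by []. Qed.
Lemma copair_linear (f : {linear M -> Q}) (g : {linear N -> Q}) :
  linear (fun x : M * N => f x.1 + g x.2).
Proof. by move=> a x y /=; rewrite !linearP scalerDr addrACA. Qed.

Definition inlL := mk_linear inl_linear.
Definition inrL := mk_linear inr_linear.
Definition sndL := mk_linear snd_linear.
Definition copairL f g := mk_linear (copair_linear f g).

(** The two factors are indexed by [bool] so that a product is a case of a module generated by the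
    images of a finite family, as finite direct sums are. *)
Definition factor (b : bool) : lmodType A := if b then M else N.
Definition factorL b : {linear factor b -> (M * N)%type} :=
  match b with true => inlL | false => inrL end.

Lemma inlrE (x : M * N) : x = inlL x.1 + inrL x.2.
Proof. by case: x => x y; rewrite -[RHS]/(_ + _, _ + _) /= addr0 add0r. Qed.

Lemma prod_cover (v : M * N) :
  Ugen (fun v => exists b x, b \in [:: true; false] /\ v = factorL b x) v.
Proof.
rewrite [v]inlrE; have [_ GD _] := Ugen_sub (fun v : M * N =>
  exists b x, b \in [:: true; false] /\ v = factorL b x).
by apply: GD; apply: Ugen_in; [exists true, v.1|exists false, v.2].
Qed.

End Products.

Lemma Ugen_lin (A : pzRingType) (M N : lmodType A) (g : {linear M -> N})
    (T : set M) (T' : set N) x :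
  Ugen T x -> (forall t, T t -> Ugen T' (g t)) -> Ugen T' (g x).
Proof. by move=> Tx TT'; apply: (Tx _ (preim_sub g (Ugen_sub T'))). Qed.

Section Covers.
Variables (A : pzRingType) (I : eqType) (X : I -> lmodType A) (N : lmodType A).
Variables (j : forall i, {linear X i -> N}) (s : seq I).
Hypothesis jN : forall v, Ugen (fun v => exists i x, i \in s /\ v = j i x) v.

Lemma cover_fg : (forall i, i \in s -> finitely_generated (X i)) -> finitely_generated N.
Proof.
move=> fgX; suff [ts tsP] : exists ts : seq N,
    forall i x, i \in s -> Ugen (fun t => t \in ts) (j i x).
  by apply: (@fg_seq _ _ ts) => v; apply: Ugen_idem (jN v) => _ [i [x [iS ->]]]; apply: tsP.
elim: s fgX => [|i r IHr] fgX; first by exists [::].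
have [|ts tsP] := IHr; first by move=> k kr; apply: fgX; rewrite inE kr orbT.
have [us [_ usP]] := fg_Ugen (fgX i (mem_head _ _)) (fun v => @Ugen_in _ _ setT v Logic.I).
exists (map (j i) us ++ ts) => k x; rewrite inE => /orP[/eqP ki|kr]; last first.
  by apply: Ugen_mono (tsP k x kr) => t /=; rewrite mem_cat => ->; rewrite orbT.
subst k; apply: (Ugen_lin (usP x)) => u uus; apply: Ugen_in.
by rewrite mem_cat map_f.
Qed.

End Covers.

Section BlockModules.
Variable K : fieldType.
Local Notation U := (Defs.U K).
Hypothesis charK : [pchar K] =i pred0.
Variable c : K.
Hypothesis c0 : c != 0.
Local Notation wt := (wt c).
Local Notation xi0 := (xi0 c).
Local Notation good := (good c).

Lemma cover_good (I : eqType) (X : I -> lmodType U) (N : lmodType U)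
    (j : forall i, {linear X i -> N}) (s : seq I) :
  (forall v, Ugen (fun v => exists i x, i \in s /\ v = j i x) v) ->
  (forall i, i \in s -> good (X i)) -> good N.
Proof.
move=> jN gX; apply: good_of_gen => v; apply: Ugen_idem (jN v) => _ [i [x [iS ->]]].
apply: (Ugen_lin (good_gen charK c0 (gX i iS) x)) => t tw.
by apply: Ugen_in; apply: swv_lin.
Qed.

Lemma O_coset_cover (I : eqType) (X : I -> lmodType U) (N : lmodType U)
    (j : forall i, {linear X i -> N}) (s : seq I) :
  (forall v, Ugen (fun v => exists i x, i \in s /\ v = j i x) v) ->
  (forall i, i \in s -> O_coset xi0 (X i)) -> O_coset xi0 N.
Proof.
move=> jN OX; apply/(O_cosetP charK); split.
  by apply: cover_good jN _ => i /OX /(O_cosetP charK) [].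
by apply: cover_fg jN _ => i /OX /(O_cosetP charK) [].
Qed.

Lemma O_coset_prod (M N : lmodType U) :
  O_coset xi0 M -> O_coset xi0 N -> O_coset xi0 (M * N)%type.
Proof.
by move=> OM ON; apply: (O_coset_cover (@prod_cover _ M N)) => -[].
Qed.

Lemma O_coset_inj (M N : lmodType U) (g : {linear M -> N}) : injective g ->
  O_coset xi0 N -> O_coset xi0 M.
Proof.
move=> gI /(O_cosetP charK) [gN fN]; apply/(O_cosetP charK); split.
  exact: (good_inj gI gN).
exact: (fg_inj charK c0 gI gN fN).
Qed.

Definition zmod0 : lmodType U := 'rV[U]_0.

Lemma zmod0E (x : zmod0) : x = 0.
Proof. by apply/rowP => -[]. Qed.

Lemma O_coset_zmod0 : O_coset xi0 zmod0.
Proof.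
apply: (@O_coset_cover void (fun=> zmod0) _ (fun=> idfun) [::]) => // v N [N0 _ _] _.
by rewrite [v]zmod0E.
Qed.

Variable D : set int.
Definition wtset : set (weight K) := [set l | exists2 n, D n & l = wt n]%classic.

(** Membership in a block, phrased by the weights of singular vectors. In this form it passes to
    submodules, quotients and extensions. *)
Definition inblk (M : lmodType U) :=
  O_coset xi0 M /\ forall v : M, sing v -> wsum wtset v.

Lemma inblk_gen (M : lmodType U) : inblk M -> forall v : M,
  Ugen (fun t => exists n, [/\ D n, sing t & wv (wt n) t]) v.
Proof.
move=> [/(O_cosetP charK) [gM _] Ms] v.
apply: Ugen_idem (good_gen charK c0 gM v) => t [st [_ [n ->] lt]].
have [->|t0] := eqVneq t 0.
  by have [] := Ugen_sub (fun t : M => exists n, [/\ D n, sing t & wv (wt n) t]).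
have [k Dk nk] := wsum_wv_in (Ms _ st) lt t0.
by apply: Ugen_in; exists k; rewrite -nk.
Qed.

Lemma inblk_verma n : D n -> inblk (verma (wt n)).
Proof.
move=> Dn; split.
  by apply/(O_cosetP charK); split; [exact: verma_good|exact: verma_fg].
move=> v /(verma_sing charK c0) [a ->]; apply: wsumZ.
by apply: (@wsum_wv _ _ _ (wt n)); [exists n|exact: vgen_wv].
Qed.

Lemma inblk_inj (M N : lmodType U) (g : {linear M -> N}) : injective g ->
  inblk N -> inblk M.
Proof.
move=> gI [ON Ns]; split; first exact: (O_coset_inj gI ON).
by move=> v sv; apply: (wsum_lin_inj gI); apply: Ns; apply: sing_lin.
Qed.

(** Images of singular vectors form an h-stable space of singular vectors that generates N, so by
    [sing_gen] they exhaust the singular vectors. *)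
Lemma sing_surj (M N : lmodType U) (g : {linear M -> N}) : (forall y, exists x, g x = y) ->
  good M -> good N -> forall y, sing y -> exists2 x, sing x & g x = y.
Proof.
move=> gS gM gN y sy.
apply: (sing_gen charK c0 gN (T := fun y => exists2 x, sing x & g x = y)) sy.
- by exists 0; [exact: sing0|rewrite linear0].
- by move=> _ _ [x sx <-] [x' sx' <-]; exists (x + x'); [apply: singD|rewrite linearD].
- by move=> a _ [x sx <-]; exists (sc a x); [apply: singZ|rewrite linear_sc].
- by move=> _ [x sx <-]; exists (gh *: x); [apply: sing_h|rewrite linearZ].
- by move=> _ [x sx <-]; apply: sing_lin.
have [x <-] := gS y; apply: (Ugen_lin (good_gen charK c0 gM x)) => t [st _].
by apply: Ugen_in; exists t.
Qed.

Lemma serre_inblk : serre_subcategory (O_coset xi0) inblk.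
Proof.
split=> [M []//||M N Q f g OM ON OQ [fI gS ex]].
  by exists zmod0; split=> [|v _]; [exact: O_coset_zmod0|rewrite [v]zmod0E; apply: wsum0].
have [gM _] := (O_cosetP charK c M).1 OM.
have [gN _] := (O_cosetP charK c N).1 ON.
have [gQ _] := (O_cosetP charK c Q).1 OQ.
split=> [[_ Ns]|[[_ Ms] [_ Qs]]].
  split; first exact: (inblk_inj fI).
  split=> // q /(sing_surj gS gN gQ) [x /Ns sx <-]; exact: wsum_lin.
split=> // v /(sing_sum charK c0 gN) [r [rs ->]].
rewrite big_seq; elim/big_ind: _ => [||t /rs [st [_ [n ->] nt]]]; [exact: wsum0|exact: wsumD|].
(* For an extension, a singular weight vector t either comes from the submodule, or has a nonzero
   singular image of the same weight in the quotient. *)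
have [/ex [x xt]|gt0] := eqVneq (g t) 0.
  rewrite -xt; apply: wsum_lin; apply: Ms; apply: (sing_lin_inj fI); by rewrite xt.
apply: (wsum_wv _ nt); apply: wsum_wv_in (wv_lin g nt) gt0.
by apply: Qs; apply: sing_lin.
Qed.

Section InSerre.
Variable S : lmodType U -> Prop.
Hypothesis serreS : serre_subcategory (O_coset xi0) S.
Hypothesis vermaS : forall n, D n -> S (verma (wt n)).

Let SO M : S M -> O_coset xi0 M. Proof. by case: serreS => SO _ _; apply: SO. Qed.
Let Sex (M N Q : lmodType U) (f : {linear M -> N}) (g : {linear N -> Q}) :
  O_coset xi0 M -> O_coset xi0 N -> O_coset xi0 Q -> short_exact f g ->
  (S N <-> S M /\ S Q).
Proof. by case: serreS => _ _; apply. Qed.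

Lemma serre_zmod0 : S zmod0.
Proof.
case: serreS => _ [M SM] _; have OM := SO SM.
have : short_exact (zeroL zmod0 M) (idfun : {linear M -> M}).
  split=> [x y _|z|y]; [by rewrite [x]zmod0E [y]zmod0E|by exists z|].
  by split=> [/= ->|[x /= <-]//]; exists 0.
by move=> /(Sex O_coset_zmod0 OM OM) [/(_ SM) []].
Qed.

Lemma serre_prod (M N : lmodType U) : S M -> S N -> S (M * N)%type.
Proof.
move=> SM SN; have [OM ON] := (SO SM, SO SN).
apply/(@Sex _ _ _ (inlL M N) (sndL M N)) => //; first exact: O_coset_prod.
split=> [x y []//|y|[x y] /=]; first by exists (0, y).
by split=> [->|[z [_ <-]]]; [exists x|].
Qed.

(** M is a quotient of a finite product of Verma modules with highest weights in D, one for each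
    singular generator. *)
Lemma inblk_serre M : inblk M -> S M.
Proof.
move=> bM; have [OM _] := bM; have [_ fgM] := (O_cosetP charK c M).1 OM.
have [ts [tsP tsM]] := fg_Ugen fgM (inblk_gen bM).
have [X [g [SX gts]]] : exists (X : lmodType U) (g : {linear X -> M}),
    S X /\ forall t, t \in ts -> exists x, g x = t.
  elim: ts tsP {tsM} => [|t ts IHts] tsP.
    by exists zmod0, (zeroL zmod0 M); split=> //; exact: serre_zmod0.
  have [|X [g [SX gts]]] := IHts; first by move=> u uts; apply: tsP; rewrite inE uts orbT.
  have [n [Dn st nt]] := tsP t (mem_head _ _).
  exists (X * verma (wt n))%type, (copairL g (verma_map st nt)); split.
    by apply: serre_prod SX _; apply: vermaS.
  move=> u; rewrite inE => /orP[/eqP->|/gts [x <-]].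
    exists (0, vgen (wt n)); rewrite -[LHS]/(g 0 + verma_map st nt _).
    by rewrite linear0 add0r verma_map_gen.
  exists (x, 0); rewrite -[LHS]/(g x + verma_map st nt 0).
  by rewrite linear0 addr0.
have gS y : exists x, g x = y by apply: (tsM y _ (range_sub g)).
have kS := preim_sub g (zero_sub M).
have iI : injective (submod_incl kS) by apply: val_inj.
have OX := SO SX.
(* The kernel of g lies in O[xi], so closure of S along this exact sequence yields the quotient
   M. *)
apply: (proj2 ((@Sex _ _ _ (submod_incl kS) g (O_coset_inj iI OX) OX OM _).1 SX)).
split=> // y; split=> [gy|[x <-]]; last exact: (submod_valP x).
exact: (submod_lift kS gy).
Qed.

End InSerre.
End BlockModules.

Section Blocks.
Variable K : fieldType.
Hypothesis charK : [pchar K] =i pred0.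
Variable c : K.
Hypothesis c0 : c != 0.

Lemma refl_dot_wt n : refl_dot (wt c n) = wt c (- 3 - n).
Proof.
have two0 : (2 : K) != 0 by apply: (nat_neq0 charK 1).
rewrite /refl_dot /refl /rho /wt -[LHS]/(_ - _, _ - _) /= addr0 subr0 intrB.
by congr (_, _); rewrite /=; field.
Qed.

(** The modules on the right form a Serre subcategory containing both Verma modules, and by
    [inblk_serre] the smallest one. *)
Lemma O_blockP n M :
  O_block (xi0 c) (wt c n) M <-> inblk c [set k | k = n \/ k = - 3 - n]%classic M.
Proof.
split=> [[OM /(_ (inblk c [set k | k = n \/ k = - 3 - n]%classic))]|bM].
  apply; first exact: serre_inblk.
  move=> N [->|->]; rewrite ?refl_dot_wt; apply: inblk_verma => //=; [by left|by right].
split=> [|S SS gS]; first by case: bM.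
apply: (inblk_serre charK c0 SS _ bM) => k [->|->]; apply: gS; first by left.
by right; rewrite refl_dot_wt.
Qed.

End Blocks.

(** * Equivalences of categories *)

Section Equivalences.
Variables (C D : category) (F : functor C D).
Hypothesis faithfulF : forall (X Y : C) (f g : Defs.hom X Y), fmap F f = fmap F g -> f = g.
Hypothesis fullF : forall (X Y : C) (h : Defs.hom (F X) (F Y)), exists f, fmap F f = h.
Hypothesis essF : forall Y : D, exists (X : C) (f : Defs.hom (F X) Y), is_iso f.

(** The quasi-inverse is data, so preimages of objects and maps and the isomorphisms are picked with
    [cid]; faithfulness makes the choices functorial. *)
Lemma ff_ess_equivalence : is_equivalence F.
Proof.
have pre (Y : D) : {X : C & {f : Defs.hom (F X) Y & {g : Defs.hom Y (F X) |
    compc g f = idc (F X) /\ compc f g = idc Y}}}.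
  have [X HX] := cid (essF Y); have [f Hf] := cid HX.
  by exists X, f; have [g Hg] := cid Hf; exists g.
pose G0 Y := projT1 (pre Y).
pose ep Y : Defs.hom (F (G0 Y)) Y := projT1 (projT2 (pre Y)).
pose ei Y : Defs.hom Y (F (G0 Y)) := sval (projT2 (projT2 (pre Y))).
have epK Y : compc (ei Y) (ep Y) = idc _ := (svalP (projT2 (projT2 (pre Y)))).1.
have eiK Y : compc (ep Y) (ei Y) = idc _ := (svalP (projT2 (projT2 (pre Y)))).2.
pose lf X Y (h : Defs.hom (F X) (F Y)) : Defs.hom X Y := sval (cid (fullF h)).
have lfE X Y (h : Defs.hom (F X) (F Y)) : fmap F (lf X Y h) = h := svalP (cid (fullF h)).
pose G1 Y Y' (g : Defs.hom Y Y') := lf (G0 Y) (G0 Y') (compc (ei Y') (compc g (ep Y))).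
have G11 Y : G1 _ _ (idc Y) = idc _.
  by apply: faithfulF; rewrite lfE comp1c epK fmap1.
have G1M X Y Z (g : Defs.hom Y Z) (f : Defs.hom X Y) :
    G1 _ _ (compc g f) = compc (G1 _ _ g) (G1 _ _ f).
  apply: faithfulF; rewrite fmapM !lfE -!compcA; congr compc; congr compc.
  by rewrite !compcA eiK comp1c.
exists (Functor G11 G1M); split.
- exists (fun X => lf (G0 (F X)) X (ep (F X))); split=> [X|X Y f].
    exists (lf X (G0 (F X)) (ei (F X))).
    by split; apply: faithfulF; rewrite fmapM !lfE ?epK ?eiK fmap1.
  apply: faithfulF; rewrite [LHS]fmapM [RHS]fmapM /= !lfE.
  by rewrite !compcA eiK comp1c.
- exists ep; split=> [Y|Y Y' g].
    by exists (ei Y); split; [apply: epK|apply: eiK].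
  by rewrite /= lfE !compcA eiK comp1c.
Qed.

End Equivalences.

Section ModuleIso.
Variables (A : pzRingType) (P : lmodType A -> Prop).

Lemma bij_iso (M N : module_category P) (f : Defs.hom M N) :
  injective (f : {linear (M : full_obj P) -> (N : full_obj P)}) ->
  (forall y, exists x, (f : {linear (M : full_obj P) -> (N : full_obj P)}) x = y) ->
  is_iso f.
Proof.
move=> fI fS; pose g y := sval (cid (fS y)).
have gK y : (f : {linear (M : full_obj P) -> (N : full_obj P)}) (g y) = y := svalP (cid (fS y)).
have gL : linear g.
  by move=> a x y; apply: fI; rewrite linearP !gK.
exists (mk_linear gL); split; apply: linear_eq => x /=; last exact: gK.
by apply: fI; rewrite gK.
Qed.

End ModuleIso.

Lemma eqL_sub (A : pzRingType) (M N : lmodType A) (f g : {linear M -> N}) :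
  is_submodule [set v | f v = g v]%classic.
Proof.
by split=> [|x y /= fx fy|a x /= fx]; rewrite /= ?linear0 ?linearD ?linearZ ?fx ?fy.
Qed.

(** * Extending maps from singular vectors *)

Section Extension.
Variable K : fieldType.
Local Notation U := (Defs.U K).
Hypothesis charK : [pchar K] =i pred0.
Variable c : K.
Hypothesis c0 : c != 0.
Local Notation good := (good c).

Lemma eq_on_sing (M N : lmodType U) (f g : {linear M -> N}) : good M ->
  (forall v, swv c v -> f v = g v) -> f =1 g.
Proof.
by move=> gM fg v; apply: (good_gen charK c0 gM v (eqL_sub f g)).
Qed.

Lemma good_prod (M N : lmodType U) : good M -> good N -> good (M * N)%type.
Proof.
by move=> gM gN; apply: (cover_good charK c0 (@prod_cover _ M N)) => -[].
Qed.

(* The submodule of M * N generated by the graph of phi is the graph of the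
   extension: it has no singular vector (0, y) with y != 0. *)
Lemma sing_extend (M N : lmodType U) (phi : M -> N) : good M -> good N ->
  (forall v, sing v -> sing (phi v)) ->
  (forall v w, sing v -> sing w -> phi (v + w) = phi v + phi w) ->
  (forall a v, sing v -> phi (sc a v) = sc a (phi v)) ->
  (forall v, sing v -> phi (gh *: v) = gh *: phi v) ->
  exists f : {linear M -> N}, forall v, sing v -> f v = phi v.
Proof.
move=> gM gN phis phiD phiZ phih; have gP := good_prod gM gN.
have phi0 : phi 0 = 0 by rewrite -(sc0l 0) phiZ ?sc0l //; apply: sing0.
pose T : set (M * N)%type := [set v | sing v.1 /\ v.2 = phi v.1]%classic.
have WS := Ugen_sub T; case: (WS) => W0 WD WZ.
have pairD (x x' : M) (y y' : N) : (x, y) + (x', y') = (x + x', y + y') :> (M * N)%type by [].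
have pairZ (a : U) (x : M) (y : N) : a *: ((x, y) : (M * N)%type) = (a *: x, a *: y) by [].
have Wsing v : Ugen T v -> sing v -> T v.
  apply: (sing_gen charK c0 gP).
  - by split; [exact: sing0|rewrite phi0].
  - by move=> [x y] [x' y'] [/= sx ->] [/= sx' ->]; split; [exact: singD|rewrite /= phiD].
  - by move=> a [x y] [/= sx ->]; split; [exact: singZ|rewrite /= phiZ].
  - by move=> [x y] [/= sx ->]; split; [exact: sing_h|rewrite /= phih].
  - move=> [x y] [/= sx ->]; have [ey py] := phis _ sx; case: sx => ex px.
    by split; rewrite pairZ ?ex ?px ?ey ?py.
have W2 y : Ugen T (0, y) -> y = 0.
  apply: (sub_no_swv charK c0 gN (preim_sub (inrL M N) WS)) => /= {}y Wy [[ey py] _].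
  have [|_ /= ->] := Wsing (0, y) Wy; last exact: phi0.
  by split; rewrite pairZ scaler0 ?ey ?py.
(* The vectors that have a partner in the graph form a submodule containing all singular weight
   vectors, hence are everything. *)
have W1 x : exists y, Ugen T (x, y).
  apply: (good_gen charK c0 gM x (N := [set x | exists y, Ugen T (x, y)]%classic)).
    split=> [|u v [y Wy] [y' Wy']|a u [y Wy]]; first by exists 0.
      by exists (y + y'); rewrite -pairD; apply: WD.
    by exists (a *: y); rewrite -pairZ; apply: WZ.
  by move=> t [st _]; exists (phi t); apply: Ugen_in.
have [f fP] := choice W1.
have fE x y : Ugen T (x, y) -> f x = y.
  move=> Wxy; apply/eqP; rewrite -subr_eq0; apply/eqP/W2.
  have -> : (0, f x - y) = (x, f x) + (-1) *: (x, y) :> (M * N)%type.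
    by rewrite pairZ pairD !scaleN1r subrr.
  by apply: WD => //; apply: WZ.
have fL : linear f.
  by move=> a x y; apply: fE; rewrite -pairD -pairZ; apply: WD => //; apply: WZ.
by exists (mk_linear fL) => v sv; apply: fE; apply: Ugen_in.
Qed.

End Extension.

Section DiagonalMap.
Variable K : fieldType.
Definition diag (a : K) : (K * K)%type := (a, a).
Lemma diag_zmod : zmod_morphism diag. Proof. by []. Qed.
Lemma diag_monoid : monoid_morphism diag. Proof. by []. Qed.
HB.instance Definition _ := GRing.isZmodMorphism.Build K (K * K)%type diag diag_zmod.
HB.instance Definition _ := GRing.isMonoidMorphism.Build K (K * K)%type diag diag_monoid.
End DiagonalMap.

(** * A block and the modules over K x K *)

Section SingularVectors.
Variable K : fieldType.
Local Notation U := (Defs.U K).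
Local Notation KK := (K * K)%type.
Hypothesis charK : [pchar K] =i pred0.
Variable c : K.
Hypothesis c0 : c != 0.
Local Notation wt := (wt c).
Local Notation xi0 := (xi0 c).
Variable n : int.
Local Notation P := (O_block xi0 (wt n)).
Local Notation al := (n%:~R : K).
Local Notation be := ((- 3 - n)%:~R : K).

(** The difference is the odd integer 2n + 3. *)
Lemma albe0 : al - be != 0.
Proof.
apply/eqP => ab; have : (n - (- 3 - n))%:~R = 0%:~R :> K by rewrite intrB ab.
by move/(int_inj charK) => n3; clear -n3; lia.
Qed.

(** Singular vectors of the block have only the weights n and -3 - n, so (h - al) (h - be) kills
    them; solved for h^2, this serves as a rewriting rule. *)
Lemma blk_quad (M : lmodType U) (v : M) : P M -> sing v ->
  gh *: (gh *: v) = sc (al + be) (gh *: v) - sc (al * be) v.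
Proof.
move=> /(O_blockP charK c0) [_ bM] /bM [s [w [_ ww xs ->]]].
rewrite !scaler_sumr !sc_sumr -sumrB big_seq [RHS]big_seq; apply: eq_bigr => l /xs.
move=> [k kD lk]; have [hw _] := ww l; rewrite hw scU hw !scA -scBl lk /=.
by congr sc; case: kD => ->; ring.
Qed.

Definition hcomb (a b : K) (M : lmodType U) (v : M) : M := sc a (gh *: v) + sc b v.

Lemma hcombD a b (M : lmodType U) (v w : M) : hcomb a b (v + w) = hcomb a b v + hcomb a b w.
Proof. by rewrite /hcomb scalerDr !scD addrACA. Qed.

Lemma hcomb_sing a b (M : lmodType U) (v : M) : sing v -> sing (hcomb a b v).
Proof. by move=> sv; apply: singD; apply: singZ => //; apply: sing_h. Qed.

Lemma hcomb_comp a b a' b' (M : lmodType U) (v : M) : P M -> sing v ->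
  hcomb a b (hcomb a' b' v)
  = hcomb (a * a' * (al + be) + a * b' + b * a') (b * b' - a * a' * (al * be)) v.
Proof.
move=> PM sv; rewrite /hcomb scalerDr !scU blk_quad // !scD scN !scA.
rewrite !addrA (ACl ((1 * 3 * 4) * (5 * 2)))%AC /=. rewrite scN scA -!scDl -scBl.
by congr (sc _ _ + sc _ _); ring.
Qed.

(** The polynomial [kcoef1 k] h + [kcoef2 k] takes the value k.1 at al and k.2 at be: linear
    interpolation inverts the map from K[h] / ((h - al) (h - be)) to K x K. *)
Definition kcoef1 (k : KK) : K := (k.1 - k.2) / (al - be).
Definition kcoef2 (k : KK) : K := (al * k.2 - be * k.1) / (al - be).
Definition kact (k : KK) (M : lmodType U) (v : M) : M := hcomb (kcoef1 k) (kcoef2 k) v.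

Lemma kact_sing k (M : lmodType U) (v : M) : sing v -> sing (kact k v).
Proof. exact: hcomb_sing. Qed.

Lemma kactD k (M : lmodType U) (v w : M) : kact k (v + w) = kact k v + kact k w.
Proof. exact: hcombD. Qed.

Lemma kact_comp k k' (M : lmodType U) (v : M) : P M -> sing v ->
  kact k (kact k' v) = kact (k * k') v.
Proof.
move=> PM sv; rewrite /kact hcomb_comp // /hcomb /kcoef1 /kcoef2 /=.
by move: albe0; move: al be => A B AB; congr (sc _ _ + sc _ _); field.
Qed.

Lemma kact1 (M : lmodType U) (v : M) : kact 1 v = v.
Proof.
rewrite /kact /hcomb /kcoef1 /kcoef2 /= subrr mul0r sc0l add0r !mulr1.
by rewrite divff ?sc1 // albe0.
Qed.

Lemma kactDl k k' (M : lmodType U) (v : M) : kact (k + k') v = kact k v + kact k' v.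
Proof.
rewrite /kact /hcomb addrACA -!scDl /kcoef1 /kcoef2 /=.
by move: albe0; move: al be => A B AB; congr (sc _ _ + sc _ _); field.
Qed.

Lemma kact_diag a (M : lmodType U) (v : M) : kact (a, a) v = sc a v.
Proof.
rewrite /kact /hcomb /kcoef1 /kcoef2 /= subrr mul0r sc0l add0r -mulrBl.
by rewrite mulrAC divff ?mul1r // albe0.
Qed.

Lemma kact_h (M : lmodType U) (v : M) : kact (al, be) v = gh *: v.
Proof.
rewrite /kact /hcomb /kcoef1 /kcoef2 /= divff ?albe0 // sc1 (mulrC be) subrr mul0r.
by rewrite sc0l addr0.
Qed.

Lemma kact_lin k (M N : lmodType U) (f : {linear M -> N}) v : f (kact k v) = kact k (f v).
Proof. by rewrite /kact /hcomb linearD !linear_sc linearZ. Qed.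

Section SingModule.
Variable X : full_obj P.
Local Notation M := (full_mod X).

Definition sing_pred of full_obj P : {pred M} := fun v => `[< sing v >].

Lemma sing_zmod_closed : zmod_closed (sing_pred X).
Proof.
split=> [|v w /asboolP sv /asboolP sw]; apply/asboolP; first exact: sing0.
have -> : v - w = v + sc (-1) w by rewrite scNl sc1.
by apply: singD => //; apply: singZ.
Qed.

HB.instance Definition _ := GRing.isZmodClosed.Build M (sing_pred X) sing_zmod_closed.

Record sing_space : Type := SingVec { sing_val :> M; _ : sing_val \in sing_pred X }.
HB.instance Definition _ := [isSub for @sing_val].
HB.instance Definition _ := [Choice of sing_space by <:].
HB.instance Definition _ := [SubChoice_isSubZmodule of sing_space by <:].

Lemma sing_valP (v : sing_space) : sing (val v).
Proof. exact/asboolP/(valP v). Qed.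

Definition sing_scale (k : KK) (v : sing_space) : sing_space :=
  SingVec (asboolT (kact_sing k (sing_valP v))).

Lemma sing_scaleA k k' v : sing_scale k (sing_scale k' v) = sing_scale (k * k') v.
Proof.
by apply: val_inj; apply: kact_comp (sing_valP v); apply: full_objP.
Qed.
Lemma sing_scale1 : left_id 1 sing_scale.
Proof. by move=> v; apply: val_inj; apply: kact1. Qed.
Lemma sing_scaleDr : right_distributive sing_scale +%R.
Proof. by move=> k v w; apply: val_inj; apply: kactD. Qed.
Lemma sing_scaleDl v : {morph sing_scale^~ v : k k' / k + k'}.
Proof. by move=> k k'; apply: val_inj; apply: kactDl. Qed.

HB.instance Definition _ := GRing.Zmodule_isLmodule.Build KK sing_space
  sing_scaleA sing_scale1 sing_scaleDr sing_scaleDl.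

Lemma sing_lift v : sing v -> exists x : sing_space, val x = v.
Proof. by move=> sv; exists (SingVec (asboolT sv)). Qed.

Lemma sing_space_fg : finitely_generated sing_space.
Proof.
have OM : O_coset xi0 M by case: (full_objP X).
have [gM fgM] := (O_cosetP charK c M).1 OM.
have [ts [tsP tsM]] := fg_Ugen fgM (good_gen charK c0 gM).
have [us usE] : exists us : seq sing_space, ts = map val us.
  elim: ts tsP {tsM} => [|t ts IHts] tsP; first by exists [::].
  have [|us ->] := IHts; first by move=> u uts; apply: tsP; rewrite inE uts orbT.
  have [st _] := tsP t (mem_head _ _); have [x <-] := sing_lift st.
  by exists (x :: us).
apply: (@fg_seq _ _ us) => v; have := sing_kspan charK c0 gM tsP tsM (sing_valP v).
rewrite usE {ts tsP tsM usE}; elim: us v => [|u us IHus] v /=.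
  move=> v0; have -> : v = 0 by apply: val_inj.
  by case: (Ugen_sub (fun t : sing_space => t \in [::])).
move=> [a]; have -> : val v - sc a (val u) = val (v - (a, a) *: u).
  by rewrite -kact_diag.
move=> /IHus vu; rewrite -(subrK ((a, a) *: u) v).
have [_ GD GZ] := Ugen_sub (fun t => t \in u :: us).
apply: GD; last by apply: GZ; apply: Ugen_in; apply: mem_head.
by apply: Ugen_mono vu => t tus; rewrite inE tus orbT.
Qed.

End SingModule.

Section SingMap.
Variables (X Y : full_obj P) (f : {linear full_mod X -> full_mod Y}).

Definition sing_map (v : sing_space X) : sing_space Y :=
  SingVec (asboolT (sing_lin f (sing_valP v))).

Lemma sing_map_linear : linear sing_map.
Proof.
by move=> k v w; apply: val_inj; rewrite /= linearD; congr (_ + _); apply: kact_lin.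
Qed.

End SingMap.

(** This is the functor of n_+-invariants, in other words Hom from the sum of the two Verma modules
    of the block. *)
Definition sing_functor : functor (module_category P) (module_category (@finitely_generated KK)).
Proof.
exists (fun X => FullObj (sing_space_fg X)) (fun X Y f => mk_linear (sing_map_linear f)).
- by move=> X; apply: linear_eq => v; apply: val_inj.
- by move=> X Y Z g f; apply: linear_eq => v; apply: val_inj.
Defined.

Local Notation F := sing_functor.

Let goodX (X : full_obj P) : good c (full_mod X).
Proof. by case: (full_objP X) => /(O_cosetP charK) []. Qed.

Lemma sing_functor_faithful (X Y : module_category P) (f g : Defs.hom X Y) :
  fmap F f = fmap F g -> f = g.
Proof.
move=> fg; apply: linear_eq; apply: (eq_on_sing charK c0 (goodX X)) => v [sv _].
have [x <-] := sing_lift sv.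
have := congr1 (fun h : {linear sing_space X -> sing_space Y} => val (h x)) fg.
by [].
Qed.

Lemma sing_functor_full (X Y : module_category P) (h : Defs.hom (F X) (F Y)) :
  exists f, fmap F f = h.
Proof.
pose h' : {linear sing_space X -> sing_space Y} := h.
(* [sing_extend] takes a function on all of M; outside the singular vectors [insubd] supplies the
   default 0. *)
pose phi v : full_mod (Y : full_obj P) := val (h' (insubd (0 : sing_space X) v)).
have phiE x : phi (val x) = val (h' x) by rewrite /phi valKd.
have [||||f fE] := @sing_extend _ charK _ c0 _ _ phi (goodX X) (goodX Y).
- by move=> v _; apply: sing_valP.
- move=> v w sv sw; have [[x <-] [y <-]] := (sing_lift sv, sing_lift sw).
  have -> : val x + val y = val (x + y) by [].
  by rewrite !phiE linearD.
- move=> a v sv; have [x <-] := sing_lift sv.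
  have -> : sc a (val x) = val ((a, a) *: x) by rewrite /= kact_diag.
  by rewrite !phiE linearZ /= kact_diag.
- move=> v sv; have [x <-] := sing_lift sv.
  have -> : gh *: val x = val ((al, be) *: x) by rewrite /= kact_h.
  by rewrite !phiE linearZ /= kact_h.
exists f; apply: linear_eq => x; apply: val_inj.
by rewrite -[RHS]phiE -fE //; apply: sing_valP.
Qed.

Section EssentialSurjectivity.
Variable V : lmodType KK.
Hypothesis fgV : finitely_generated V.
Local Notation MW := (model (@diag K) charK c0 V (al, be)).
Local Notation mc := (@mconst K KK (@diag K) charK c c0 V (al, be)).

(** With (al, be) in K x K as highest weight, the two idempotents split V into the parts of weight n
    and -3 - n. The full model contains functions of infinite support, hence the restriction to the
    submodule generated by V. *)
Definition block_model : lmodType U := submod (Ugen_sub [set mc v | v in setT]%classic).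
Local Notation M := block_model.

Lemma block_const_exists v : exists x : M, val x = mc v.
Proof. by apply: submod_lift; apply: Ugen_in; exists v. Qed.

Definition bconst (v : V) : M := sval (cid (block_const_exists v)).

Lemma bconstE v : val (bconst v) = mc v.
Proof. exact: svalP (cid (block_const_exists v)). Qed.

Lemma bconst_gen (x : M) : Ugen [set bconst v | v in setT]%classic x.
Proof.
have : [set y | exists2 x : M, val x = y
    & Ugen [set bconst v | v in setT]%classic x]%classic (val x).
  apply: (submod_valP x).
    have [G0 GD GZ] := Ugen_sub [set bconst v | v in setT]%classic.
    split=> [|_ _ [x1 <- G1] [x2 <- G2]|a _ [x1 <- G1]]; first by exists 0.
      by exists (x1 + x2); [|apply: GD].
    by exists (a *: x1); [|apply: GZ].
  by move=> _ [v _ <-]; exists (bconst v); [exact: bconstE|apply: Ugen_in; exists v].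
by move=> [y /val_inj <-].
Qed.

Let incl_inj : injective (submod_incl (Ugen_sub [set mc v | v in setT]%classic)).
Proof. exact: val_inj. Qed.

Lemma bconstD u v : bconst (u + v) = bconst u + bconst v.
Proof. by apply: val_inj; rewrite /= !bconstE; apply: mconstD. Qed.

Lemma bconst_diag a v : bconst ((a, a) *: v) = sc a (bconst v).
Proof.
apply: val_inj; rewrite /= !bconstE [LHS]mconstZ; exact/esym/model_sc.
Qed.

Lemma bconst_h v : gh *: bconst v = bconst ((al, be) *: v).
Proof.
apply: val_inj; rewrite bconstE -mconst_h.
by rewrite -bconstE.
Qed.

Lemma bconst_sing v : sing (bconst v).
Proof. by apply: (sing_lin_inj incl_inj); rewrite /= bconstE; apply: mconst_sing. Qed.

Lemma bconst_z v : gz *: bconst v = sc c (bconst v).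
Proof.
apply: val_inj; rewrite -[LHS]/(gz *: val (bconst v)) -[RHS]/(sc c (val (bconst v))) bconstE.
exact: mconst_z.
Qed.

Lemma bconst_split v : v = (1, 0) *: v + (0, 1) *: v :> V.
Proof.
by rewrite -scalerDl -[X in X *: _]/(1 + 0, 0 + 1) addr0 add0r; apply/esym/scale1r.
Qed.

Lemma bconst_wv1 v : wv (wt n) (bconst ((1, 0) *: v)).
Proof.
split; last exact: bconst_z.
rewrite bconst_h -bconst_diag !scalerA; congr (bconst (_ *: _)).
by rewrite -[LHS]/(_ * _, _ * _) -[RHS]/(_ * _, _ * _) /= !mulr0.
Qed.

Lemma bconst_wv2 v : wv (wt (- 3 - n)) (bconst ((0, 1) *: v)).
Proof.
split; last exact: bconst_z.
rewrite bconst_h -bconst_diag !scalerA; congr (bconst (_ *: _)).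
by rewrite -[LHS]/(_ * _, _ * _) -[RHS]/(_ * _, _ * _) /= !mulr0.
Qed.

Lemma block_model_good : good c M.
Proof.
apply: good_of_gen => x; apply: Ugen_idem (bconst_gen x) => _ [v _ <-].
rewrite {1}(bconst_split v) bconstD.
have [_ GD _] := Ugen_sub (@swv K c M).
apply: GD; apply: Ugen_in; split; try exact: bconst_sing.
  by exists (wt n); [exists n|exact: bconst_wv1].
by exists (wt (- 3 - n)); [exists (- 3 - n)|exact: bconst_wv2].
Qed.

Lemma block_model_fg : finitely_generated M.
Proof.
have [ts [_ tsV]] := fg_Ugen fgV (fun v => @Ugen_in _ _ setT v Logic.I).
pose L := [seq bconst ((1, 0) *: t) | t <- ts] ++ [seq bconst ((0, 1) *: t) | t <- ts].
apply: (@fg_seq _ _ L) => x; apply: Ugen_idem (bconst_gen x) => _ [v _ <-].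
have [G0 GD GZ] := Ugen_sub (fun x => x \in L).
have b0 : bconst 0 = 0 by rewrite -(scale0r (0 : V)) bconst_diag sc0l.
(* Generators of V over K x K yield generators over U after splitting by the two idempotents, since
   k acts on the two parts by the scalars k.1 and k.2. *)
pose N : set V := fun v => Ugen (fun x => x \in L) (bconst ((1, 0) *: v)) /\
  Ugen (fun x => x \in L) (bconst ((0, 1) *: v)).
have [N1 N2] : N v.
  apply: (tsV v) => [|t tts]; last first.
    by split; apply: Ugen_in; rewrite mem_cat; apply/orP; [left|right]; apply/mapP; exists t.
  split=> [|u w [u1 u2] [w1 w2]|k u [u1 u2]]; rewrite /N ?scaler0 ?b0 //.
    by rewrite !scalerDr !bconstD; split; apply: GD.
  split.
    have -> : (1, 0) *: (k *: u) = (k.1, k.1) *: ((1, 0) *: u) :> V.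
      rewrite !scalerA; congr (_ *: _).
      rewrite -[LHS]/(_ * _, _ * _) -[RHS]/(_ * _, _ * _).
      by rewrite /= !(mulr0, mul0r, mul1r, mulr1).
    by rewrite bconst_diag; apply: GZ.
  have -> : (0, 1) *: (k *: u) = (k.2, k.2) *: ((0, 1) *: u) :> V.
    rewrite !scalerA; congr (_ *: _).
      rewrite -[LHS]/(_ * _, _ * _) -[RHS]/(_ * _, _ * _).
      by rewrite /= !(mulr0, mul0r, mul1r, mulr1).
  by rewrite bconst_diag; apply: GZ.
by rewrite (bconst_split v) bconstD; apply: GD.
Qed.

(** The copy of V is h-stable, singular and generating, so [sing_gen] recovers V as the whole space
    of singular vectors. *)
Lemma block_model_sing x : sing x -> exists v, bconst v = x.
Proof.
move=> sx; apply: (sing_gen charK c0 block_model_good (T := fun x => exists v, bconst v = x)) sx.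
- by exists ((0, 0) *: 0); rewrite bconst_diag sc0l.
- by move=> _ _ [u <-] [v <-]; exists (u + v); rewrite bconstD.
- by move=> a _ [v <-]; exists ((a, a) *: v); rewrite bconst_diag.
- by move=> _ [v <-]; exists ((al, be) *: v); rewrite bconst_h.
- by move=> _ [v <-]; apply: bconst_sing.
by apply: Ugen_mono (bconst_gen x) => _ [v _ <-]; exists v.
Qed.

Lemma block_model_block : P M.
Proof.
apply/(O_blockP charK c0); split.
  by apply/(O_cosetP charK); split; [exact: block_model_good|exact: block_model_fg].
move=> _ /block_model_sing [v <-]; rewrite (bconst_split v) bconstD; apply: wsumD.
  by apply: (wsum_wv _ (bconst_wv1 v)); exists n => //; left.
by apply: (wsum_wv _ (bconst_wv2 v)); exists (- 3 - n) => //; right.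
Qed.

Definition block_obj : full_obj P := FullObj block_model_block.

(** The inverse of [bconst] on singular vectors: the entry at F^0 q^0. *)
Definition bval (x : sing_space block_obj) : V :=
  (submod_incl (Ugen_sub [set mc v | v in setT]%classic) (val x) : mspace V) 0 0.

Lemma bvalE (x : sing_space block_obj) : val x = bconst (bval x).
Proof.
have [v vx] := block_model_sing (sing_valP x).
by rewrite /bval -vx /= bconstE.
Qed.

Lemma bconst_inj : injective bconst.
Proof. by move=> u v /(congr1 val); rewrite !bconstE; apply: mconst_inj. Qed.

Lemma bval_linear : linear bval.
Proof.
move=> k x y; apply: bconst_inj; rewrite -bvalE bconstD -bvalE.
have -> : val (k *: x + y) = kact k (val x) + val y by [].
congr (_ + _).
rewrite bvalE /kact /hcomb bconst_h -!bconst_diag -bconstD scalerA -scalerDl.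
congr (bconst (_ *: _)); rewrite -[LHS]/(_ + _, _ + _) /= /kcoef1 /kcoef2.
by case: k => k1 k2 /=; move: albe0; move: al be => A B AB; congr (_, _); field.
Qed.

End EssentialSurjectivity.

Lemma sing_functor_ess (Y : module_category (@finitely_generated KK)) :
  exists (X : module_category P) (f : Defs.hom (F X) Y), is_iso f.
Proof.
case: Y => V fgV; exists (block_obj fgV); exists (mk_linear (@bval_linear V fgV)).
apply: bij_iso => [x y /= xy|v /=].
  by apply: val_inj; rewrite !bvalE xy.
have [x xv] := sing_lift (X := block_obj fgV) (bconst_sing v).
by exists x; apply: bconst_inj; rewrite -bvalE.
Qed.

Lemma block_equivalent :
  equivalent (module_category P) (module_category (@finitely_generated KK)).
Proof.
exists F; apply: ff_ess_equivalence.
- exact: sing_functor_faithful.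
- exact: sing_functor_full.
- exact: sing_functor_ess.
Qed.

End SingularVectors.

(** * Direct sums of modules and the decomposition into blocks *)

Section DirectSumInjections.
Variables (A : pzRingType) (I : eqType) (M : I -> lmodType A).

Lemma dinj_finsupp i (x : M i) : finsupp (dfwith (fun k => 0 : M k) x).
Proof. by exists [:: i] => k; rewrite inE => ki; rewrite dfwith_out // eq_sym. Qed.

Definition dinj i (x : M i) : dsum M := Dsum (dinj_finsupp x).

Lemma dinj_linear i : linear (@dinj i).
Proof.
move=> a x y; apply: dsumP => k /=; have [ik|ik] := eqVneq i k.
  by subst k; rewrite !dfwith_in.
by rewrite !dfwith_out // scaler0 addr0.
Qed.

Definition dinjL i := mk_linear (@dinj_linear i).

Lemma dproj_linear i : linear (fun x : dsum M => x i).
Proof. by []. Qed.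

Definition dprojL i := mk_linear (@dproj_linear i).

Lemma dinj_cover (s : seq I) : (forall i, i \notin s -> forall x : M i, x = 0) ->
  forall v : dsum M, Ugen (fun v => exists i x, i \in s /\ v = dinjL i x) v.
Proof.
move=> Ms v; have -> : v = \sum_(i <- undup s) dinjL i (v i).
  apply: dsumP => k.
  rewrite -[RHS]/(dprojL k (\sum_(i <- undup s) dinjL i (v i))) linear_sum /=.
  have [ks|ks] := boolP (k \in s); last first.
    rewrite (Ms k ks (v k)) big_seq big1 // => i; rewrite mem_undup => iS.
    by rewrite dfwith_out //; apply: contraNneq ks => <-.
  rewrite (bigD1_seq k) ?mem_undup ?undup_uniq //= dfwith_in big1 ?addr0 // => i ik.
  by rewrite dfwith_out.
rewrite big_seq; apply: submodule_sum (Ugen_sub _) _ => i; rewrite mem_undup => iS.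
by apply: Ugen_in; exists i, (v i).
Qed.

End DirectSumInjections.

Section ZeroObjects.
Variables (A : pzRingType) (P : lmodType A -> Prop).

(** The identity and the zero endomorphism must coincide. *)
Lemma zero_obj_eq0 (X : module_category P) : is_zero_obj X ->
  forall x : full_mod (X : full_obj P), x = 0.
Proof.
move=> /(_ X) [[f [_ fU]] _] x.
have := fU (idfun : {linear _ -> _}) Logic.I.
rewrite (fU (zeroL _ _) Logic.I) => /(congr1 (fun g : {linear _ -> _} => g x)).
by move=> /= <-.
Qed.

Lemma eq0_zero_obj (X : module_category P) :
  (forall x : full_mod (X : full_obj P), x = 0) -> is_zero_obj X.
Proof.
move=> X0 Y.
split.
  exists (zeroL _ _); split=> // f _; apply: linear_eq => x /=.
  by rewrite (X0 x) linear0.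
exists (zeroL _ _); split=> // f _; apply: linear_eq => x /=.
exact/esym/X0.
Qed.

End ZeroObjects.

Section Decomposition.
Variable K : fieldType.
Local Notation U := (Defs.U K).
Hypothesis charK : [pchar K] =i pred0.
Variable c : K.
Hypothesis c0 : c != 0.
Local Notation wt := (wt c).
Local Notation xi0 := (xi0 c).
Local Notation good := (good c).

(** The pair i - 1 and -2 - i, written as in [O_blockP]. For i = 0, 1, 2, ... these pairs partition
    the integers, which explains the start at -1. *)
Definition blk (i : nat) : set int := [set k | k = i%:Z - 1 \/ k = - 3 - (i%:Z - 1)]%classic.
Local Notation P := (fun i : nat => O_block xi0 (wt (i%:Z - 1))).

Lemma blk_disj i j k : blk i k -> blk j k -> i = j.
Proof. by rewrite /blk /=; lia. Qed.

Lemma blk_cover k : exists i, blk i k.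
Proof.
have [k0|k0] := boolP (-1 <= k); first by exists (absz (k + 1)%R); rewrite /blk /=; lia.
by exists (absz (- 2 - k)%R); rewrite /blk /=; lia.
Qed.

Lemma wt_inj : injective wt.
Proof. by move=> m n [/(int_inj charK)]. Qed.

Lemma blk_wv (M : lmodType U) i k (v : M) : P i M -> sing v -> wv (wt k) v ->
  v != 0 -> blk i k.
Proof.
move=> /(O_blockP charK c0) [_ bM] /bM wM vk v0.
by have [m mb /wt_inj ->] := wsum_wv_in wM vk v0.
Qed.

(** A nonzero image of a singular weight vector would have a weight belonging to both blocks. *)
Lemma block_hom0 (M N : lmodType U) i j (g : {linear M -> N}) : i != j ->
  P i M -> P j N -> forall v, g v = 0.
Proof.
move=> ij PM PN v; have [OM _] := PM; have [gM _] := (O_cosetP charK c M).1 OM.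
rewrite (eq_on_sing charK c0 (f := g) (g := zeroL M N) gM) // => {}v [sv [_ [k ->] vk]] /=.
apply/eqP; apply: contraNT ij => gv0; apply/eqP.
apply: (@blk_disj _ _ k).
  by apply: blk_wv PM sv vk _; apply: contraNneq gv0 => ->; rewrite linear0.
by apply: blk_wv PN (sing_lin g sv) (wv_lin g vk) gv0.
Qed.

Local Notation dcat := (dsum_category (fun i => module_category (P i))).

Lemma dsum_zero_out (X : dcat) : exists s : seq nat, forall i, i \notin s ->
  forall x : full_mod ((X : dsum_obj _) i : full_obj (P i)), x = 0.
Proof.
by case: X => X [s sX]; exists s => i /sX; apply: zero_obj_eq0.
Qed.

Lemma dsum_cover (X : dcat) : exists s : seq nat, forall v : dsum_module X,
  Ugen (fun v => exists i x, i \in s /\ v = dinjL _ i x) v.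
Proof.
have [s sX] := dsum_zero_out X; exists s; exact: dinj_cover.
Qed.

Lemma dsum_O_coset (X : dcat) : O_coset xi0 (dsum_module X).
Proof.
have [s sX] := dsum_cover X.
apply: (O_coset_cover charK c0 sX) => i _.
by case: (full_objP ((X : dsum_obj _) i : full_obj (P i))).
Qed.

Definition decomp_functor : functor dcat (module_category (O_coset xi0)).
Proof.
exists (fun X => FullObj (dsum_O_coset X)) (fun X Y f => dsum_hom f).
- by move=> X; apply: linear_eq => x; apply: dsumP.
- by move=> X Y Z g f; apply: linear_eq => x; apply: dsumP.
Defined.

Local Notation F := decomp_functor.

Lemma decomp_faithful (X Y : dcat) (f g : Defs.hom X Y) : fmap F f = fmap F g -> f = g.
Proof.
move=> fg; apply: functional_extensionality_dep => i; apply: linear_eq => x.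
have := congr1 (fun h : {linear dsum_module X -> dsum_module Y} => h (dinj x) i) fg.
by rewrite /= !dfwith_in.
Qed.

Lemma decomp_full (X Y : dcat) (h : Defs.hom (F X) (F Y)) : exists f, fmap F f = h.
Proof.
pose h' : {linear dsum_module X -> dsum_module Y} := h.
(* These are the diagonal entries of the matrix of h; the others vanish by [block_hom0]. *)
pose f i : Defs.hom ((X : dsum_obj _) i) ((Y : dsum_obj _) i) :=
  (dprojL _ i \o h' \o dinjL _ i)%FUN : {linear _ -> _}.
exists (f : Defs.hom X Y); apply: linear_eq => v.
have [s sX] := dsum_cover X.
apply: (sX v _ (eqL_sub (dsum_hom f) h')).
move=> _ [i [x [_ ->]]] /=; apply: dsumP => j /=.
have [ij|ij] := eqVneq i j; first by subst j; rewrite dfwith_in.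
rewrite dfwith_out // -[dinj _]/(dinjL _ j _) (linear0 (dinjL _ j)) (linear0 h').
apply/esym.
by apply: (@block_hom0 _ _ i j (dprojL _ j \o h' \o dinjL _ i)%FUN ij); apply: full_objP.
Qed.

(** The projector onto a weight of the first expression, taken among the weights of both, kills
    every term of the second. *)
Lemma wsum_disj (M : lmodType U) (A B : set (weight K)) (v : M) :
  wsum A v -> wsum B v -> (forall l, A l -> B l -> False) -> v = 0.
Proof.
move=> [s [w [us ww As vw]]] [t [x [ut xx Bt vx]]] AB.
have E l : l \in s -> w l = wproj (s ++ t) l *: v.
  move=> ls; rewrite vw scaler_sumr (bigD1_seq l) //=.
  rewrite (wprojE _ (ww l)) ?mem_cat ?ls // eqxx big_seq_cond big1 ?addr0 // => k /andP[ks kl].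
  by rewrite (wprojE _ (ww k)) ?mem_cat ?ks // (negPf kl).
rewrite vw big_seq big1 // => l ls; rewrite (E l ls) vx scaler_sumr big_seq big1 // => k kt.
rewrite (wprojE _ (xx k)) ?mem_cat ?kt ?orbT //; case: eqP => // kl.
by case: (AB l); [exact: As|rewrite -kl; apply: Bt].
Qed.

Section Components.
Variable M : lmodType U.
Hypothesis OM : O_coset xi0 M.

Let gM : good M. Proof. by case/(O_cosetP charK): OM. Qed.

Definition csing i : set M := [set v | sing v /\ wsum (wtset c (blk i)) v]%classic.

Lemma csing_gen i v : Ugen (csing i) v -> sing v -> csing i v.
Proof.
apply: (sing_gen charK c0 gM).
- by split; [exact: sing0|exact: wsum0].
- by move=> x y [sx wx] [sy wy]; split; [exact: singD|exact: wsumD].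
- by move=> a x [sx wx]; split; [exact: singZ|exact: wsumZ].
- move=> x [sx [s [w [us ww xs xE]]]]; split; first exact: sing_h.
  rewrite xE scaler_sumr big_seq; elim/big_ind: _ => [||l /xs xl]; [exact: wsum0|exact: wsumD|].
  by rewrite (ww l).1; apply: wsumZ; apply: wsum_wv xl (ww l).
- by move=> x [].
Qed.

Definition cmod i : lmodType U := submod (Ugen_sub (csing i)).
Local Notation ci i := (submod_incl (Ugen_sub (csing i))).

Lemma ci_inj i : injective (ci i). Proof. exact: val_inj. Qed.

Lemma cmod_block i : P i (cmod i).
Proof.
apply/(O_blockP charK c0); split; first exact: (O_coset_inj charK c0 (@ci_inj i) OM).
move=> v sv; apply: (wsum_lin_inj (@ci_inj i)).
by have [] := csing_gen (submod_valP v) (sing_lin (ci i) sv).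
Qed.

(** Finitely many singular weight vectors span all singular vectors, so only the blocks of their
    weights can contribute. *)
Lemma cmod_finite : exists s : seq nat, forall i, i \notin s -> forall x : cmod i, x = 0.
Proof.
have [_ fgM] := (O_cosetP charK c M).1 OM.
have [ts [tsP tsM]] := fg_Ugen fgM (good_gen charK c0 gM).
have [s sP] : exists s : seq nat, forall t, t \in ts ->
    exists2 i, i \in s & exists2 k, blk i k & wv (wt k) t.
  elim: ts tsP {tsM} => [|t ts IH] tsP; first by exists [::].
  have [|s sP] := IH; first by move=> u uts; apply: tsP; rewrite inE uts orbT.
  have [_ [_ [k ->] tk]] := tsP t (mem_head _ _); have [i ik] := blk_cover k.
  exists (i :: s) => u; rewrite inE => /orP[/eqP->|/sP [j js ju]].
    by exists i; [exact: mem_head|exists k].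
  by exists j; rewrite // inE js orbT.
exists s => i iS x; apply: (@ci_inj i); rewrite linear0.
suff /(_ _ (submod_valP x)) : (Ugen (csing i) `<=` [set 0])%classic by [].
apply: Ugen_min (zero_sub M) _ => v [sv wv].
pose B : set (weight K) := [set l | exists2 j, j \in s & wtset c (blk j) l]%classic.
apply: (wsum_disj wv (B := B)).
  apply: (@kspan_closed _ _ (wsum B) ts) (sing_kspan charK c0 gM tsP tsM sv).
  - exact: wsum0.
  - exact: wsumD.
  - exact: wsumZ.
  by move=> t /sP [j js [k jk tk]]; apply: (wsum_wv _ tk); exists j => //; exists k.
move=> _ [k ik ->] [j js [m jm /wt_inj mk]]; subst m.
by rewrite (blk_disj ik jm) js in iS.
Qed.

Definition cfam i : module_category (P i) := FullObj (cmod_block i).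

Lemma cfam_finite : exists s : seq nat, forall i, i \notin s -> is_zero_obj (cfam i).
Proof.
by have [s sP] := cmod_finite; exists s => i /sP x0; apply: (@eq0_zero_obj _ _ (cfam i) x0).
Qed.

Definition cobj : dcat := DsumObj cfam_finite.

Lemma csum_linear (s : seq nat) :
  linear (fun x : dsum_module cobj => \sum_(i <- s) ci i (x i)).
Proof.
by move=> a x y; rewrite scaler_sumr -big_split; apply: eq_bigr => i _; apply: linearP.
Qed.

Lemma cobj_iso : exists f : {linear dsum_module cobj -> M},
  injective f /\ forall y, exists x, f x = y.
Proof.
have [s0 s0P] := cmod_finite; pose s := undup s0.
have sP i : i \notin s -> forall x : cmod i, x = 0 by rewrite mem_undup; apply: s0P.
have us : uniq s by apply: undup_uniq.
(* A finite sum suffices because the components outside s are zero. Its kernel is tested on singular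
   weight vectors, which have only the component of the block of their weight. *)
exists (mk_linear (csum_linear s)); split.
  suff ker0 (x : dsum_module cobj) : \sum_(i <- s) ci i (x i) = 0 -> x = 0.
    move=> x y /= /eqP; rewrite -subr_eq0 -sumrB => /eqP xy.
    apply/eqP; rewrite -subr_eq0; apply/eqP/ker0; rewrite -[RHS]xy.
    by apply: eq_bigr => i _; rewrite /= scaleN1r.
  have [gD _] := (O_cosetP charK c _).1 (dsum_O_coset cobj).
  apply: (sub_no_swv charK c0 gD (preim_sub (mk_linear (csum_linear s)) (zero_sub M))).
  move=> {}x /= x0 [sx [_ [k ->] xk]]; have [i ik] := blk_cover k.
  have xj j : j != i -> x j = 0.
    move=> ji; apply/eqP; apply: contraNT ji => xj0; apply/eqP.
    apply: (blk_disj _ ik); apply: (blk_wv (cmod_block j) _ _ xj0).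
      exact: (sing_lin (dprojL _ j) sx).
    exact: (wv_lin (dprojL _ j) xk).
  apply: dsumP => j; have [->|ji] := eqVneq j i; last exact: xj.
  have [iS|iS] := boolP (i \in s); last exact: sP.
  apply: (@ci_inj i); rewrite linear0 -[RHS]x0 (bigD1_seq i) //= big1 ?addr0 // => m mi.
  by rewrite xj.
move=> y; apply: (good_gen charK c0 gM y (range_sub (mk_linear (csum_linear s)))).
move=> t [st [_ [k ->] tk]]; have [i ik] := blk_cover k.
have Tt : csing i t by split=> //; apply: (wsum_wv _ tk); exists k.
have [x xt] := submod_lift (Ugen_sub (csing i)) (Ugen_in Tt).
exists (dinj (M := cmod) x); rewrite /= -xt.
(* Outside s the component is the zero module, so x and t are zero. *)
have [iS|/sP x0] := boolP (i \in s).
  rewrite (bigD1_seq i) //= dfwith_in big1 ?addr0 // => j ji.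
  by rewrite dfwith_out // eq_sym.
rewrite (x0 x) big1 // => j _.
have -> : dfwith (fun k : nat => 0 : cmod k) (0 : cmod i) j = 0; last by [].
by case: dfwithP.
Qed.

End Components.

Lemma decomp_ess (Y : module_category (O_coset xi0)) :
  exists (X : dcat) (f : Defs.hom (F X) Y), is_iso f.
Proof.
case: Y => M OM; have [f [fI fS]] := cobj_iso OM.
by exists (cobj OM), f; apply: bij_iso.
Qed.

Lemma O_coset_decomposes : decomposes (O_coset xi0) P.
Proof.
exists F; split.
  apply: ff_ess_equivalence; [exact: decomp_faithful|exact: decomp_full|exact: decomp_ess].
exists (fun X => (idfun : {linear dsum_module X -> dsum_module X})); split=> [X|X Y f].
  by exists (idfun : {linear dsum_module X -> dsum_module X}); split; apply: linear_eq.
exact: linear_eq.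
Qed.

End Decomposition.

(** * From the coset of the theorem to integral weights of fixed charge *)

Lemma hcheck_mulrz (K : fieldType) (n : int) : hcheck K *~ n = (n%:~R, 0).
Proof.
rewrite [LHS]surjective_pairing; congr (_, _).
  by rewrite -[LHS]/(fst (hcheck K *~ n)) raddfMz.
by rewrite -[LHS]/(snd (hcheck K *~ n)) raddfMz /= mul0rz.
Qed.

(** The base point of the coset is moved to l, whose value at h is known to be an integer. *)
Lemma integral_coset (K : fieldType) (xi : set (weight K)) (l : weight K) (n : int) :
  is_coset xi -> xi l -> l.1 = n%:~R -> xi = xi0 l.2.
Proof.
move=> [l0 ->] [m lE] l1; have l0E : l0 = l - hcheck K *~ m by rewrite lE addrK.
have lwt : l = wt l.2 n by rewrite [LHS]surjective_pairing l1.
have shiftE k : l + hcheck K *~ k = wt l.2 (n + k).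
  by rewrite {1}lwt hcheck_mulrz /wt -[LHS]/(_ + _, _ + _) /= addr0 intrD.
apply/seteqP; split=> [_ [k ->]|_ [k ->]] /=.
  by exists (n + (k - m)); rewrite -shiftE l0E mulrzBr addrA addrAC.
by exists (k - n + m); rewrite l0E mulrzDr addrA [l - _ + _]addrAC subrK shiftE addrC subrK.
Qed.

Theorem proposition5 (R : realType) (xi : set (weight (complex R)))
    (hxi : is_coset xi)
    (hcharge : forall l, xi l -> l.2 <> 0)
    (hint : forall l, xi l -> exists n : int, l.1 = n%:~R)
    (lam : nat -> weight (complex R))
    (hlam : forall i : nat, xi (lam i) /\ (lam i).1 = -1 + i%:R) :
  [/\ forall l, xi l -> simple_module (verma l),
      decomposes (O_coset xi) (fun i : nat => O_block xi (lam i)) &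
      forall i : nat,
        equivalent (module_category (O_block xi (lam i)))
          (module_category
             (@finitely_generated (complex R * complex R)%type))].
Proof.
have charC : [pchar (complex R)] =i pred0 by apply: Num.Theory.pchar_num.
have [xl0 _] := hlam 0%N; set c := (lam 0%N).2.
have c0 : c != 0 by apply/eqP; apply: hcharge.
have [n0 n0E] := hint _ xl0.
have xiE : xi = xi0 c by apply: integral_coset n0E.
have lamE i : lam i = wt c (i%:Z - 1).
  have [xli li] := hlam i; move: xli; rewrite xiE => -[k lk].
  by rewrite [LHS]surjective_pairing li lk /wt intrB addrC.
split=> [l|| i].
- by rewrite xiE => -[n ->]; apply: verma_simple.
- rewrite xiE (_ : (fun i => _) = fun i : nat => O_block (xi0 c) (wt c (i%:Z - 1))).
    exact: O_coset_decomposes.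
  by apply/funext => i; rewrite lamE.
- by rewrite xiE lamE; apply: block_equivalent.
Qed.
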